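(* Let $a<b$ be real numbers, let $p,q\in L^\infty(a,b)$ satisfy $\operatorname{ess\,inf}_{(a,b)}p=p_0>0$ and $\operatorname{ess\,inf}_{(a,b)}q\ge 0$. Let $F:\mathbb{R}\to 2^{\mathbb{R}}$ be upper semicontinuous with nonempty compact convex values, and let $\alpha>0$, $s\in(1,2)$, $0<c<d$ be such that (i) $0\le\min F(t)\le\alpha(1+|t|^{s-1})$ for all $t\in\mathbb{R}$; (ii) $\displaystyle\frac{1}{c^2}\int_0^c\min F(t)\,dt<\frac{K}{d^2}\int_0^d\min F(t)\,dt$, where $K=3p_0\big(12\|p\|_\infty+4(b-a)^2\|q\|_\infty\big)^{-1}$. Set $$\Lambda=\left(\frac{p_0d^2}{2K(b-a)^2}\Big(\int_0^d\min F(t)\,dt\Big)^{-1},\ \frac{p_0c^2}{2(b-a)^2}\Big(\int_0^c\min F(t)\,dt\Big)^{-1}\right).$$ Then, for all $\lambda\in\Lambda$, the problem $$\begin{cases}-(p(x)u')'+q(x)u\in\lambda F(u)&\text{in }(a,b)\\ u(a)=u'(b)=0\end{cases}$$ has at least three (weak) solutions.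
   Context: A set-valued mapping $F:\mathbb{R}\to 2^{\mathbb{R}}$ is upper semicontinuous if for every open $A\subseteq\mathbb{R}$ the set $\{t\in\mathbb{R}: F(t)\subseteq A\}$ is open. The convention $0^{-1}=\infty$ is used in defining the interval $\Lambda$. $\|\cdot\|_\infty$ is the norm of $L^\infty(a,b)$. Let $X=\{u\in H^1(a,b): u(a)=0\}$ with inner product $\langle u,v\rangle=\int_a^b(p(x)u'v'+q(x)uv)\,dx$. A function $u\in X$ is a (weak) solution of the problem if there exist $\nu>1$ and $w\in L^\nu(a,b)$ such that $\langle u,v\rangle=\lambda\int_a^b wv\,dx$ for all $v\in X$, and $w(x)\in F(u(x))$ for a.e. $x\in(a,b)$. *)

(* Defs.v *)
From HB Require Import structures.
From mathcomp Require Import all_boot all_order all_algebra.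
From mathcomp Require Import all_classical all_reals all_analysis.
From mathcomp Require Import ess_sup_inf.

Set Implicit Arguments.
Unset Strict Implicit.
Unset Printing Implicit Defensive.

Import Order.TTheory GRing.Theory Num.Theory.
Import numFieldNormedType.Exports.

Local Open Scope classical_set_scope.
Local Open Scope ring_scope.

Definition upper_semicontinuous (R : realType) (F : R -> set R) : Prop :=
  forall A : set R, open A -> open [set t | F t `<=` A].

(* The minimum of A, with default value 0 if A has no least element. *)
Definition set_min (R : realType) (A : set R) : R := xget 0 (A `&` lbound A).

(* Lebesgue measure on (a, b), as a measure on R that vanishes outside (a, b):
   a function on (a, b) is represented by a function R -> R whose values outside
   (a, b) are irrelevant, and L^r(a, b) is Lfun (leb a b) r, whose elements are
   functions rather than classes modulo a.e. equality. *)
Definition leb (R : realType) (a b : R) :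
    {measure set (measurableTypeR R) -> \bar R} :=
  mrestr (@lebesgue_measure R) (measurable_itv `]a, b[).

(* C^1 functions with compact support contained in (a, b). *)
Definition test_function (R : realType) (a b : R) (phi : R -> R) : Prop :=
  [/\ forall x, derivable phi x 1,
      continuous (derive1 phi) &
      closure [set x | phi x != 0] `<=` `]a, b[ ].

Definition is_weak_derivative (R : realType) (a b : R) (u g : R -> R) : Prop :=
  forall phi, test_function a b phi ->
    \int[leb a b]_x (u x * derive1 phi x) = - \int[leb a b]_x (g x * phi x).

Definition H1 (R : realType) (a b : R) : set (R -> R) :=
  [set u | u \in Lfun (leb a b) 2%:E /\
    exists2 g, g \in Lfun (leb a b) 2%:E & is_weak_derivative a b u g].

(* The weak derivative of u in H^1(a, b); it is determined up to a.e. equality,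
   and one representative is chosen. *)
Definition weak_derivative (R : realType) (a b : R) (u : R -> R) : R -> R :=
  xget (cst 0)
    [set g | g \in Lfun (leb a b) 2%:E /\ is_weak_derivative a b u g].

(* X = {u in H^1(a, b) : u(a) = 0}, where u(a) is the value at a of the
   representative of u that is continuous on [a, b]. *)
Definition X (R : realType) (a b : R) : set (R -> R) :=
  [set u | H1 a b u /\
    exists v : R -> R, [/\ {within `[a, b], continuous v},
      u = v %[ae (leb a b)] & v a = 0]].

Definition inner (R : realType) (a b : R) (p q u v : R -> R) : R :=
  \int[leb a b]_x
    (p x * weak_derivative a b u x * weak_derivative a b v x
     + q x * u x * v x).

Definition weak_solution (R : realType) (a b : R) (p q : R -> R)
    (F : R -> set R) (lambda : R) (u : R -> R) : Prop :=
  X a b u /\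
  exists nu : R, exists w : R -> R,
    [/\ 1 < nu,
        w \in Lfun (leb a b) nu%:E,
        forall v, X a b v ->
          inner a b p q u v = lambda * \int[leb a b]_x (w x * v x) &
        \forall x \ae leb a b, F (u x) (w x)].

Definition int_min (R : realType) (F : R -> set R) (c : R) : R :=
  \int[@lebesgue_measure R]_(t in `[0, c]) set_min (F t).

Definition norm_oo (R : realType) (a b : R) (f : R -> R) : R :=
  fine ('N[leb a b]_+oo[EFin \o f])%E.

Definition K (R : realType) (a b p0 : R) (p q : R -> R) : R :=
  3 * p0 * (12 * norm_oo a b p + 4 * (b - a) ^+ 2 * norm_oo a b q)^-1.

(* The inverses of the two integrals are taken in \bar R, where 0^-1 = +oo. *)
Definition Lambda (R : realType) (a b p0 : R) (p q : R -> R) (F : R -> set R)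
    (c d : R) : set R :=
  [set lambda |
    ((p0 * d ^+ 2 / (2 * K a b p0 p q * (b - a) ^+ 2))%:E
       * ((int_min F d)%:E)^-1 < lambda%:E)%E /\
    (lambda%:E < (p0 * c ^+ 2 / (2 * (b - a) ^+ 2))%:E
       * ((int_min F c)%:E)^-1)%E].

(* Main.v *)
Require Import Defs.
From HB Require Import structures.
From mathcomp Require Import all_boot all_order all_algebra.
From mathcomp Require Import all_classical all_reals all_analysis.
From mathcomp Require Import ess_sup_inf measurable_realfun.
From mathcomp Require Import ring lra.

Set Implicit Arguments.
Unset Strict Implicit.
Unset Printing Implicit Defensive.

Import Order.TTheory GRing.Theory Num.Theory.
Import numFieldNormedType.Exports.

Local Open Scope classical_set_scope.
Local Open Scope ring_scope.

(* The functional is I(u) = Phi(u) - lam int_a^b G(u), with Phi(u) = <u,u>/2 and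
   G the primitive of min F vanishing at 0.  On the sphere Phi = r, with
   r = p0 c^2 / (2(b-a)), one has |u| <= c, so that I is at least some dl > 0
   there: this is the upper bound on lam.  Inside the ball I(0) = 0, and outside
   it I is negative at the function that is affine up to the midpoint of (a,b)
   and equal to d afterwards: this is the lower bound on lam.  One therefore
   expects a critical point inside the ball with I <= 0, one outside with
   I <= 0, and a mountain pass point with I >= dl/2.

   Since min F is only lower semicontinuous, it is replaced by its n-Lipschitz
   regularizations f_n.  For f_n, steepest descent with small steps decreases the
   energy and does not cross the sphere, and it produces three almost critical
   points at these levels for every n, in a fixed bounded set because min F grows
   sublinearly.  Along an ultrafilter on n, the functions f_n(u_n) converge weakly
   to some w, hence u_n converges strongly in H^1 to some u with
   -(p u')' + q u = lam w; convexity of F(u(x)) and upper semicontinuity of F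
   give w(x) in F(u(x)).  Strong convergence keeps the three limits apart.

   A function u of X is represented by its derivative g, as u = prim a b g. *)

(** The constants come from two estimates. Cauchy-Schwarz gives u(x)^2 <= (2(b-a)/p0) Phi(u), so r
    is the level at which this reads |u| <= c, and there int G(u) <= (b-a) G(c). For the function
    that reaches the height d, Phi <= p0 d^2 / (4 K (b-a)), which is where K originates, while int G
    >= (b-a) G(d) / 2. All derivatives g handled by the descent are bounded measurable functions: a
    step adds to g a multiple of g and of an integral divided by p, so it stays in this class, and
    so does the limit. Compactness comes from the integrated equation. An almost critical g_n
    satisfies p g_n = int_x^b (lam f_n(u_n) - q u_n) up to an error small in L^2. The right side is
    Lipschitz in x uniformly in n, so it converges uniformly, and g_n converges strongly. It also
    vanishes at b, which is the condition u'(b) = 0. The obstacle is that the Lipschitz constants of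
    f_n blow up with n. They are allowed to influence only the length of the descent steps; every
    estimate used in the limit depends on upper bounds of f_n alone. *)

Section finite_measure_wrap.
Context d (T : measurableType d) (R : realType).
Variable m : {measure set T -> \bar R}.
Hypothesis m_fin : fin_num_fun m.

Definition finite_wrap of fin_num_fun m : set T -> \bar R := m.
HB.instance Definition _ := Measure.copy (finite_wrap m_fin) m.
HB.instance Definition _ :=
  Measure_isFinite.Build _ _ _ (finite_wrap m_fin) m_fin.

End finite_measure_wrap.

Lemma leb_fin (R : realType) (a b : R) : fin_num_fun (leb a b).
Proof.
move=> A mA; rewrite ge0_fin_numE ?measure_ge0//.
apply: (@le_lt_trans _ _ (@lebesgue_measure R `]a, b[%classic)).
  rewrite /leb /= /mrestr; apply: le_measure; rewrite ?inE//.
  by apply: measurableI.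
by rewrite lebesgue_measure_itv/=; case: ifP => // _; rewrite -EFinB ltry.
Qed.

(* The library attaches the finiteness of a measure to its syntactic form;
   lebf is leb packaged with it. *)
Definition lebf (R : realType) (a b : R) :
    {finite_measure set (measurableTypeR R) -> \bar R} :=
  finite_wrap (@leb_fin R a b).

#[global] Instance leb_ae_filter (R : realType) (a b : R) :
  Filter (almost_everywhere (leb a b)).
Proof. exact: ae_filter_ringOfSetsType. Qed.

(** * Integration over (a, b) and bounded measurable functions *)

Section integral.
Context (R : realType) (a b : R).
Implicit Types (f g h k : R -> R).

Definition itg f : Prop := (leb a b).-integrable setT (EFin \o f).
Definition integ f : R := \int[leb a b]_x f x.

(** The bound holds at every point, not just almost everywhere. The derivatives produced by the
    descent and their limits are of this kind, so their sums, products and squares are integrable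
    with no discussion of exponents. *)
Definition bmeas f : Prop :=
  measurable_fun setT f /\ exists M, forall x, `|f x| <= M.

Lemma bmeas_itg f : bmeas f -> itg f.
Proof.
move=> [mf [M fM]]; apply: (@measurable_bounded_integrable _ _ _ (leb a b)) => //.
  by rewrite -ge0_fin_numE ?measure_ge0//; exact: leb_fin.
exists M; split; first exact: num_real.
by move=> y My x _ /=; exact: le_trans (fM x) (ltW My).
Qed.

Lemma itgZ (c : R) f : itg f -> itg (fun x => c * f x).
Proof. by move=> If; have := integrableZl measurableT c If. Qed.

Lemma itgB f g : itg f -> itg g -> itg (fun x => f x - g x).
Proof. by move=> If Ig; have := integrableB measurableT If Ig. Qed.

Lemma itgM f g : bmeas f -> itg g -> itg (fun x => f x * g x).
Proof.
move=> [mf [M fM]] Ig.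
have := @integrableMr _ _ _ (leb a b) setT measurableT f (EFin \o g) mf _ Ig.
apply; exists M; split; first exact: num_real.
by move=> y My x _ /=; exact: le_trans (fM x) (ltW My).
Qed.

Lemma itg_meas f : itg f -> measurable_fun setT f.
Proof. by move=> /integrableP[/measurable_EFinP]. Qed.

Lemma integ_EFin f : itg f -> (\int[leb a b]_x (f x)%:E)%E = (integ f)%:E.
Proof. by move=> If; rewrite fineK//; exact: integrable_fin_num If. Qed.

Lemma integD f g : itg f -> itg g ->
  integ (fun x => f x + g x) = integ f + integ g.
Proof. exact: RintegralD. Qed.

Lemma integB f g : itg f -> itg g ->
  integ (fun x => f x - g x) = integ f - integ g.
Proof. exact: RintegralB. Qed.

Lemma integZ (c : R) f : itg f -> integ (fun x => c * f x) = c * integ f.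
Proof. exact: RintegralZl. Qed.

Lemma integ_le f g : itg f -> itg g -> (forall x, f x <= g x) ->
  integ f <= integ g.
Proof. by move=> If Ig fg; apply: le_Rintegral => // x _. Qed.

Lemma integ_ge0 f : (forall x, 0 <= f x) -> 0 <= integ f.
Proof. by move=> f0; apply: Rintegral_ge0. Qed.

Lemma integ_eq f g : f =1 g -> integ f = integ g.
Proof. by move=> fg; apply: eq_Rintegral => x _; exact: fg. Qed.

Lemma integ_ae f g : measurable_fun setT f -> measurable_fun setT g ->
  (\forall x \ae leb a b, f x = g x) -> integ f = integ g.
Proof.
move=> mf mg fg; congr fine; apply: ae_eq_integral => //.
- exact/measurable_EFinP.
- exact/measurable_EFinP.
- by apply: filterS fg => x fgx _; rewrite fgx.
Qed.

Lemma integ_norm f : itg f -> `|integ f| <= integ (fun x => `|f x|).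
Proof. exact: le_normr_Rintegral. Qed.

Lemma leb_total : a <= b -> leb a b setT = (b - a)%:E.
Proof.
move=> ab; rewrite /leb /= /mrestr setTI lebesgue_measure_itv/= lte_fin.
by move: ab; rewrite le_eqVlt => /orP[/eqP ->|->//]; rewrite ltxx subrr.
Qed.

Lemma integ_cst (c : R) : a <= b -> integ (fun=> c) = c * (b - a).
Proof. by move=> ab; rewrite /integ Rintegral_cst// leb_total. Qed.

Lemma bmeas_cst (c : R) : bmeas (fun=> c).
Proof. by split; [exact: measurable_cst|exists `|c|]. Qed.

Lemma bmeasD f g : bmeas f -> bmeas g -> bmeas (fun x => f x + g x).
Proof.
move=> [mf [M fM]] [mg [N gN]]; split; first exact: measurable_funD.
by exists (M + N) => x; rewrite (le_trans (ler_normD _ _))// lerD.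
Qed.

Lemma bmeasM f g : bmeas f -> bmeas g -> bmeas (fun x => f x * g x).
Proof.
move=> [mf [M fM]] [mg [N gN]]; split; first exact: measurable_funM.
by exists (M * N) => x; rewrite normrM ler_pM.
Qed.

Lemma bmeasB f g : bmeas f -> bmeas g -> bmeas (fun x => f x - g x).
Proof.
move=> [mf [M fM]] [mg [N gN]]; split; first exact: measurable_funB.
by exists (M + N) => x; rewrite (le_trans (ler_normB _ _))// lerD.
Qed.

Lemma bmeasN f : bmeas f -> bmeas (fun x => - f x).
Proof.
by move=> [mf [M fM]]; split; [exact: measurable_funN|exists M => x; rewrite normrN].
Qed.

Lemma bmeas_norm f : bmeas f -> bmeas (fun x => `|f x|).
Proof.
move=> [mf [M fM]]; split; first exact: measurableT_comp.
by exists M => x; rewrite normr_id.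
Qed.

Lemma bmeasX f n : bmeas f -> bmeas (fun x => f x ^+ n).
Proof.
move=> [mf [M fM]]; split; first exact: measurable_funX.
exists (M ^+ n) => x; rewrite normrX lerXn2r ?nnegrE//.
exact: le_trans (fM x).
Qed.

Lemma bmeas_divr f g (m : R) : 0 < m -> bmeas f -> bmeas g ->
  (forall x, m <= g x) -> bmeas (fun x => f x / g x).
Proof.
move=> m0 bf [mg [N gN]] gm.
have g0 x : 0 < g x by exact: lt_le_trans (gm x).
apply: bmeasM => //; split.
  have -> : (fun x => (g x)^-1) = (fun x => g x `^ (-1)).
    by apply/funext => x; rewrite powR_inv1// ltW.
  have mp := @measurable_powR R (-1).
  exact: (@measurableT_comp _ _ _ _ _ _ (@powR R ^~ (-1))).
exists m^-1 => x; rewrite ger0_norm ?invr_ge0 ?(ltW (g0 x))//.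
by rewrite lef_pV2 ?posrE.
Qed.

Lemma bmeas_le_indic (x : R) : bmeas (fun t => (t <= x)%R%:R).
Proof.
split; last by exists 1 => t; case: (t <= x); rewrite ?normr1 ?normr0.
have -> : (fun t => (t <= x)%R%:R) = (\1_`]-oo, x] : R -> R).
  by apply/funext => t; rewrite indicE mem_setE/= in_itv.
exact: measurable_indic.
Qed.

(* From the positivity of integ ((b - a) h - integ (h k) k)^2. *)
Lemma cauchy_schwarz_le1 h k : a < b -> bmeas h -> bmeas k ->
  (forall x, `|k x| <= 1) ->
  integ (fun x => h x * k x) ^+ 2 <= (b - a) * integ (fun x => h x ^+ 2).
Proof.
move=> ab bh bk k1; set A := integ _; set D := integ _.
have m0 : 0 < b - a by rewrite subr_gt0.
have bhk : bmeas (fun x => h x * k x) by exact: bmeasM.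
have bh2 : bmeas (fun x => h x ^+ 2) by exact: bmeasX.
have bk2 : bmeas (fun x => k x ^+ 2) by exact: bmeasX.
have k2 : integ (fun x => k x ^+ 2) <= b - a.
  rewrite -[leRHS]mul1r -integ_cst; last exact: ltW.
  apply: integ_le.
  - exact: bmeas_itg.
  - exact/bmeas_itg/bmeas_cst.
  - by move=> x; rewrite -real_normK ?num_real// expr_le1.
have : 0 <= integ (fun x => ((b - a) * h x - A * k x) ^+ 2).
  by apply: integ_ge0 => x; exact: sqr_ge0.
have -> : integ (fun x => ((b - a) * h x - A * k x) ^+ 2) =
    (b - a) ^+ 2 * D - 2 * (b - a) * A * A + A ^+ 2 * integ (fun x => k x ^+ 2).
  rewrite -integZ; last exact: bmeas_itg.
  rewrite -[2 * (b - a) * A * _]integZ; last exact: bmeas_itg.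
  rewrite -integZ; last exact: bmeas_itg.
  rewrite -integB; [|exact/itgZ/bmeas_itg|exact/itgZ/bmeas_itg].
  rewrite -integD; [|apply: itgB|]; [|exact/itgZ/bmeas_itg..].
  by apply: integ_eq => x; ring.
move=> pos.
have : A ^+ 2 * integ (fun x => k x ^+ 2) <= A ^+ 2 * (b - a).
  by rewrite ler_wpM2l ?sqr_ge0.
nra.
Qed.

End integral.

(* Sections below abbreviate [integ a b] by [integ], and so on; these aliases
   still name the constants there. *)
Local Notation integ_def := integ.

(** * Primitives *)

Section primitive.
Context (R : realType) (a b : R).
Implicit Types (f g h k : R -> R) (x y t : R).
Local Notation itg := (itg a b).
Local Notation integ := (integ a b).

(** Since [leb a b] charges only (a, b), this is the integral of [g] from a to x, and [coprim] is
    the integral from x to b. An indicator factor in place of a domain keeps every integral on the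
    same measure. *)
Definition prim g x : R := integ (fun t => g t * (t <= x)%R%:R).
Definition coprim k x : R := integ k - prim k x.

Lemma ae_leb_itv : \forall x \ae leb a b, x \in `]a, b[.
Proof.
exists (~` `]a, b[%classic); split.
- exact: measurableC.
- by rewrite /leb /= /mrestr setICl; exact: (measure0 (@lebesgue_measure R)).
- by move=> x; rewrite /= in_itv.
Qed.

Lemma ae_leb_lebesgue (P : set R) :
  (\forall x \ae @lebesgue_measure R, P x) -> \forall x \ae leb a b, P x.
Proof.
move=> [N [mN N0 PN]]; exists N; split => //.
apply/eqP; rewrite eq_le measure_ge0 andbT /leb /= /mrestr -N0.
by apply: le_measure; rewrite ?inE//; exact: measurableI.
Qed.

Lemma ae_leb_neq t : \forall x \ae leb a b, x != t.
Proof.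
apply: ae_leb_lebesgue; exists [set t]; split => //.
  exact: lebesgue_measure_set1.
by move=> x /= /negP; rewrite negbK => /eqP.
Qed.

Lemma itg_indic g x : itg g -> itg (fun t => g t * (t <= x)%R%:R).
Proof.
move=> ig; have := itgM (bmeas_le_indic x) ig.
by apply: eq_integrable => // t _; rewrite /= mulrC.
Qed.

Lemma primD g h x : itg g -> itg h ->
  prim (fun t => g t + h t) x = prim g x + prim h x.
Proof.
move=> ig ih; rewrite /prim -integD; [|exact: itg_indic..].
by apply: integ_eq => t; rewrite mulrDl.
Qed.

Lemma primB g h x : itg g -> itg h ->
  prim (fun t => g t - h t) x = prim g x - prim h x.
Proof.
move=> ig ih; rewrite /prim -integB; [|exact: itg_indic..].
by apply: integ_eq => t; rewrite mulrBl.
Qed.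

Lemma primZ c g x : itg g -> prim (fun t => c * g t) x = c * prim g x.
Proof.
move=> ig; rewrite /prim -integZ; last exact: itg_indic.
by apply: integ_eq => t; rewrite mulrA.
Qed.

Lemma itg_norm g : itg g -> itg (fun t => `|g t|).
Proof. exact: integrable_norm. Qed.

Lemma prim_bound g x : itg g -> `|prim g x| <= integ (fun t => `|g t|).
Proof.
move=> ig; have ix := itg_indic x ig.
apply: (le_trans (integ_norm ix)); apply: integ_le; [exact: itg_norm..|].
move=> t; rewrite normrM; case: (t <= x)%R; first by rewrite normr1 mulr1.
by rewrite normr0 mulr0.
Qed.

Lemma prim_nd g : itg g -> (forall t, 0 <= g t) -> nondecreasing (prim g).
Proof.
move=> ig g0 x y xy; apply: integ_le; [exact: itg_indic..|].
move=> t; apply: ler_wpM2l => //; case: (leP t x) => tx /=; last exact: ler0n.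
by rewrite (le_trans tx xy).
Qed.

Lemma prim_meas g : itg g -> measurable_fun setT (prim g).
Proof.
move=> ig; have ng := itg_norm ig.
have -> : prim g = prim (fun t => `|g t|) \- prim (fun t => `|g t| - g t).
  apply/funext => x; rewrite /= primB//; ring.
apply: measurable_funB; apply: nondecreasing_measurable => //; apply: prim_nd => //.
- exact: itgB.
- by move=> t; rewrite subr_ge0 ler_norm.
Qed.

Lemma prim_bmeas g : itg g -> bmeas (prim g).
Proof.
move=> ig; split; first exact: prim_meas.
by exists (integ (fun t => `|g t|)) => x; exact: prim_bound.
Qed.

Lemma coprim_bmeas g : itg g -> bmeas (coprim g).
Proof. by move=> ig; apply: bmeasB; [exact: bmeas_cst|exact: prim_bmeas]. Qed.

Lemma prim_sub g x y : itg g -> x <= y ->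
  prim g y - prim g x = integ (fun t => g t * (x < t <= y)%R%:R).
Proof.
move=> ig xy; rewrite /prim -integB; [|exact: itg_indic..].
apply: integ_eq => t; rewrite -mulrBr; congr (_ * _).
case: (leP t x) => tx /=; last by rewrite subr0.
by rewrite (le_trans tx xy) subrr.
Qed.

Lemma itv_indic_bmeas x y : bmeas (fun t => (x < t <= y)%R%:R : R).
Proof.
split; last by exists 1 => t; case: (_ && _); rewrite ?normr1 ?normr0.
have -> : (fun t => (x < t <= y)%R%:R) = (\1_`]x, y] : R -> R).
  by apply/funext => t; rewrite indicE mem_setE/= in_itv.
exact: measurable_indic.
Qed.

Lemma lt_indic_bmeas x : bmeas (fun t => (x < t)%R%:R : R).
Proof.
split; last by exists 1 => t; case: (_ < _); rewrite ?normr1 ?normr0.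
have -> : (fun t => (x < t)%R%:R) = (\1_`]x, +oo[ : R -> R).
  by apply/funext => t; rewrite indicE mem_setE/= in_itv/= andbT.
exact: measurable_indic.
Qed.

Lemma gt_indic_bmeas x : bmeas (fun t => (t < x)%R%:R : R).
Proof.
split; last by exists 1 => t; case: (_ < _); rewrite ?normr1 ?normr0.
have -> : (fun t => (t < x)%R%:R) = (\1_`]-oo, x[ : R -> R).
  by apply/funext => t; rewrite indicE mem_setE/= in_itv.
exact: measurable_indic.
Qed.

Lemma integ_indic (A : set R) : measurable A -> integ \1_A = fine (leb a b A).
Proof. by move=> mA; rewrite /integ /integ_def /Rintegral integral_indic// setIT. Qed.

Lemma integ_itv x y : x <= y -> integ (fun t => (x < t <= y)%R%:R) <= y - x.
Proof.
move=> xy.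
have -> : (fun t => (x < t <= y)%R%:R) = (\1_`]x, y] : R -> R).
  by apply/funext => t; rewrite indicE mem_setE/= in_itv.
rewrite integ_indic// -lee_fin fineK; last exact: leb_fin.
apply: (@le_trans _ _ (@lebesgue_measure R `]x, y]%classic)).
  by rewrite /leb /= /mrestr; apply: le_measure; rewrite ?inE//; exact: measurableI.
rewrite lebesgue_measure_itv/= lte_fin; case: ifP => //; rewrite ?lee_fin ?subr_ge0//.
Qed.

Lemma prim_lipschitz g M x y : measurable_fun setT g -> (forall t, `|g t| <= M) ->
  `|prim g x - prim g y| <= M * `|x - y|.
Proof.
move=> mg gM; have ig : itg g by apply: bmeas_itg; split => //; exists M.
have M0 : 0 <= M by exact: le_trans (gM 0).
wlog xy : x y / y <= x.
  move=> W; case: (leP y x) => [|/ltW] xy; first exact: W.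
  by rewrite distrC [X in _ * X]distrC W.
rewrite prim_sub// [X in _ * X]ger0_norm ?subr_ge0//.
have it := itgM (itv_indic_bmeas y x) ig.
have {}it : itg (fun t => g t * (y < t <= x)%R%:R).
  by apply: eq_integrable it => // t _; rewrite /= mulrC.
apply: (le_trans (integ_norm it)).
apply: (@le_trans _ _ (integ (fun t => M * (y < t <= x)%R%:R))).
  apply: integ_le; [exact: itg_norm|exact/itgZ/bmeas_itg/itv_indic_bmeas|].
  by move=> t; rewrite normrM (ger0_norm (ler0n _ _)) ler_wpM2r.
rewrite integZ; last exact/bmeas_itg/itv_indic_bmeas.
by apply: ler_wpM2l => //; exact: integ_itv.
Qed.

Lemma coprim_lipschitz g M x y : measurable_fun setT g -> (forall t, `|g t| <= M) ->
  `|coprim g x - coprim g y| <= M * `|x - y|.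
Proof.
move=> mg gM; have -> : coprim g x - coprim g y = - (prim g x - prim g y).
  by rewrite /coprim; ring.
by rewrite normrN; exact: prim_lipschitz.
Qed.

Lemma prim_left g x : itg g -> x <= a -> prim g x = 0.
Proof.
move=> ig xa; rewrite /prim (@integ_ae _ _ _ _ (fun=> 0)).
- by rewrite -[RHS](mul0r (integ g)) -integZ//; apply: integ_eq => t; rewrite mul0r.
- exact: itg_meas (itg_indic x ig).
- exact: measurable_cst.
- apply: filterS ae_leb_itv => t; rewrite in_itv/= => /andP[at_ _].
  by rewrite leNgt (le_lt_trans xa at_) mulr0.
Qed.

Lemma prim_lt g x : itg g ->
  prim g x = integ (fun t => g t * (t < x)%R%:R).
Proof.
move=> ig; apply: integ_ae.
- exact: itg_meas (itg_indic x ig).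
- by apply: measurable_funM; [exact: itg_meas ig|case: (gt_indic_bmeas x)].
- by apply: filterS (ae_leb_neq x) => t tx; rewrite lt_neqAle tx.
Qed.

Lemma coprim_gt k x : itg k -> coprim k x = integ (fun t => k t * (x < t)%R%:R).
Proof.
move=> ik; rewrite /coprim /prim -integB//; last exact: itg_indic.
by apply: integ_eq => t; rewrite ltNge; case: (t <= x)%R; rewrite !(mulr1,mulr0) ?subrr ?subr0.
Qed.

(** Integration by parts without boundary terms, as [prim h] vanishes at a and [coprim k] at b:
    Fubini for [k y * h x] on the triangle x < y. [h] is merely integrable because it will also be
    the derivative of an arbitrary element of X. *)
Lemma coprim_prim_dual k h : bmeas k -> itg h ->
  integ (fun x => coprim k x * h x) = integ (fun x => k x * prim h x).
Proof.
move=> bk ih; have ik := bmeas_itg a b bk.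
pose F (z : R * R) : \bar R := (k z.2 * (z.1 < z.2)%R%:R * h z.1)%:E.
have mF : measurable_fun setT F.
  apply/measurable_EFinP; apply: measurable_funM; last first.
    by apply: measurableT_comp; [exact: itg_meas ih|exact: measurable_fst].
  apply: measurable_funM.
    by apply: measurableT_comp; [case: bk|exact: measurable_snd].
  have -> : (fun z : R * R => (z.1 < z.2)%R%:R) =
      (\1_[set z : R * R | z.1 < z.2] : R * R -> R).
    by apply/funext => z; rewrite indicE mem_setE.
  apply: measurable_indic.
  have := @measurable_fun_ltr _ (R * R)%type R setT fst snd measurable_fst measurable_snd
    measurableT [set true] I.
  by rewrite setTI.
have [_ [M kM]] := bk.
have M0 : 0 <= M by exact: le_trans (kM 0).
have intF : (lebf a b \x lebf a b)%E.-integrable setT F.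
  apply/(@integrable12ltyP _ _ _ _ R (lebf a b) (lebf a b) F mF).
  (* Since M bounds [k], the inner integral is at most a constant times [|h x|]. *)
  apply: (@le_lt_trans _ _ (\int[lebf a b]_x (M * integ (fun=> 1) * `|h x|)%:E)%E).
    apply: ge0_le_integral => //.
    - by move=> x _; exact: integral_ge0.
    - apply: (@measurable_fun_fubini_tonelli_F _ _ _ _ R (lebf a b) (abse \o F)).
        exact: measurableT_comp.
      by move=> z; exact: abse_ge0.
    - apply/measurable_EFinP; apply: measurable_funM => //.
      by apply: measurableT_comp => //; exact: itg_meas ih.
    - move=> x _.
      have bx : bmeas (fun y => `|k y * (x < y)%R%:R|).
        exact/bmeas_norm/bmeasM/lt_indic_bmeas.
      have -> : (fun y => `|F (x, y)|%E) =
          (EFin \o (fun y => `|h x| * `|k y * (x < y)%R%:R|)).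
        by apply/funext => y; rewrite /F /= normrM mulrC.
      rewrite integ_EFin; last exact/itgZ/bmeas_itg.
      rewrite lee_fin integZ; last exact: bmeas_itg.
      rewrite [leRHS]mulrC; apply: ler_wpM2l => //.
      rewrite -integZ; last exact/bmeas_itg/bmeas_cst.
      apply: integ_le; [exact: bmeas_itg|exact/itgZ/bmeas_itg/bmeas_cst|].
      move=> y; rewrite normrM; apply: ler_pM => //.
      by case: (x < y)%R; rewrite ?normr1 ?normr0.
  rewrite integ_EFin ?ltry//; exact/itgZ/itg_norm.
have := Fubini intF.
under [X in X = _ -> _]eq_integral => x _.
  have -> : (fun y => F (x, y)) = (EFin \o (fun y => h x * (k y * (x < y)%R%:R))).
    by apply/funext => y; rewrite /F /= mulrC.
  have bx : bmeas (fun y => k y * (x < y)%R%:R) by exact/bmeasM/lt_indic_bmeas.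
  rewrite integ_EFin; last exact/itgZ/bmeas_itg.
  rewrite integZ; last exact: bmeas_itg.
  rewrite -coprim_gt// mulrC.
  over.
under [X in _ = X -> _]eq_integral => y _.
  have -> : (fun x => F (x, y)) = (EFin \o (fun x => k y * (h x * (x < y)%R%:R))).
    by apply/funext => x; rewrite /F /=; congr EFin; ring.
  have ix : itg (fun x => h x * (x < y)%R%:R).
    have := itgM (gt_indic_bmeas y) ih.
    by apply: eq_integrable => // t _; rewrite /= mulrC.
  rewrite integ_EFin; last exact/itgZ.
  rewrite integZ// -prim_lt//.
  over.
rewrite integ_EFin; last first.
  by apply: itgM => //; exact: coprim_bmeas.
rewrite integ_EFin; first by move=> -[].
exact/bmeas_itg/bmeasM/prim_bmeas.
Qed.

End primitive.

Local Notation prim_def := prim.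
Local Notation coprim_def := coprim.

Lemma bmeas_prim (R : realType) (a b : R) g : bmeas g -> bmeas (prim a b g).
Proof. by move=> bg; exact/prim_bmeas/bmeas_itg. Qed.

Lemma bmeas_coprim (R : realType) (a b : R) g : bmeas g -> bmeas (coprim a b g).
Proof. by move=> bg; exact/coprim_bmeas/bmeas_itg. Qed.

(** [bm] proves [bmeas] goals by following the syntax of the function; [bm_leaf] is its hook for
    atoms, redefined in each section with the functions known there. *)
Ltac bm_leaf := fail.

Ltac bm :=
  try (lazymatch goal with |- itg _ _ _ => apply: bmeas_itg end);
  first [ assumption | bm_leaf |
  match goal with
  | |- bmeas (fun _ => ?c) => apply: bmeas_cst
  | |- bmeas (fun x => @?f x + @?g x) => apply: (@bmeasD _ f g); bm
  | |- bmeas (fun x => - @?f x) => apply: (@bmeasN _ f); bm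
  | |- bmeas (fun x => @?f x * @?g x) => apply: (@bmeasM _ f g); bm
  | |- bmeas (fun x => @?f x ^+ ?n) => apply: (@bmeasX _ f n); bm
  | |- bmeas (fun x => `|@?f x|) => apply: (@bmeas_norm _ f); bm
  | |- bmeas (fun x => prim _ _ ?g x) => apply: (@bmeas_prim _ _ _ g); bm
  | |- bmeas (fun x => coprim _ _ ?g x) => apply: (@bmeas_coprim _ _ _ g); bm
  | |- bmeas (prim _ _ ?g) => apply: (@bmeas_prim _ _ _ g); bm
  | |- bmeas (coprim _ _ ?g) => apply: (@bmeas_coprim _ _ _ g); bm
  end ].

(** The bounds are required everywhere. The given coefficients satisfy them only almost everywhere
    and are replaced by clamped versions in [clamped_coefficients]. *)
Record coefficients (R : realType) (p q : R -> R) (p0 P Q : R) : Prop :=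
  Coefficients {
    coef_p_meas : measurable_fun setT p;
    coef_q_meas : measurable_fun setT q;
    coef_p0_gt0 : 0 < p0;
    coef_p_bound : forall x, p0 <= p x <= P;
    coef_q_bound : forall x, 0 <= q x <= Q }.

(** * The quadratic part of the energy *)

Section quadratic.
Context (R : realType) (a b : R) (hab : a < b).
Variables (p q : R -> R) (p0 P Q : R).
Hypothesis coef : coefficients p q p0 P Q.
Let p_meas := coef_p_meas coef.
Let q_meas := coef_q_meas coef.
Let p0_gt0 := coef_p0_gt0 coef.
Let p_bound := coef_p_bound coef.
Let q_bound := coef_q_bound coef.
Implicit Types (g h k u : R -> R).
Local Notation integ := (integ a b).
Local Notation prim := (prim a b).
Local Notation coprim := (coprim a b).

Let ba0 : 0 < b - a. Proof. by rewrite subr_gt0. Qed.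

Lemma P_gt0 : 0 < P.
Proof. by have /andP[h1 h2] := p_bound 0; exact: lt_le_trans (le_trans h1 h2). Qed.

Lemma Q_ge0 : 0 <= Q.
Proof. by have /andP[h1 h2] := q_bound 0; exact: le_trans h2. Qed.

Lemma p_bmeas : bmeas p.
Proof.
split => //; exists P => x; have /andP[h1 h2] := p_bound x.
by rewrite ger0_norm ?(le_trans (ltW p0_gt0)).
Qed.

Lemma q_bmeas : bmeas q.
Proof.
by split => //; exists Q => x; have /andP[h1 h2] := q_bound x; rewrite ger0_norm.
Qed.

Lemma invp_bmeas : bmeas (fun x => (p x)^-1).
Proof.
have [_ [M pM]] := p_bmeas.
have := bmeas_divr p0_gt0 (bmeas_cst (1 : R)) p_bmeas.
have -> : (fun x => 1 / p x) = (fun x => (p x)^-1).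
  by apply/funext => x; rewrite mul1r.
by apply => x; have /andP[] := p_bound x.
Qed.

Ltac bm_leaf ::= first [exact: p_bmeas | exact: q_bmeas | exact: invp_bmeas].

Definition sqn g : R := integ (fun x => g x ^+ 2).

Lemma sqn_ge0 g : 0 <= sqn g.
Proof. by apply: integ_ge0 => x; exact: sqr_ge0. Qed.

Lemma prim_sqr_le h x : bmeas h -> prim h x ^+ 2 <= (b - a) * sqn h.
Proof.
move=> bh; apply: cauchy_schwarz_le1 => //; first exact: bmeas_le_indic.
by move=> t; case: (t <= x); rewrite ?normr1 ?normr0.
Qed.

Lemma sqn_prim_le h : bmeas h -> sqn (prim h) <= (b - a) ^+ 2 * sqn h.
Proof.
move=> bh.
have -> : (b - a) ^+ 2 * sqn h = integ (fun=> (b - a) * sqn h).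
  by rewrite integ_cst ?ltW//; ring.
apply: integ_le; [by bm..|] => x; exact: prim_sqr_le.
Qed.

Definition Phi g : R :=
  integ (fun x => 2^-1 * (p x * g x ^+ 2 + q x * prim g x ^+ 2)).

Lemma Phi_ge g : bmeas g -> p0 / 2 * sqn g <= Phi g.
Proof.
move=> bg; rewrite -integZ; last by bm.
apply: integ_le; [by bm..|] => x.
have /andP[p1 _] := p_bound x; have /andP[q1 _] := q_bound x.
have h1 : p0 * g x ^+ 2 <= p x * g x ^+ 2 by rewrite ler_wpM2r ?sqr_ge0.
have h2 : 0 <= q x * prim g x ^+ 2 by rewrite mulr_ge0 ?sqr_ge0.
by lra.
Qed.

(** This embedding fixes the radius of the sphere: for Phi = p0 c^2 / (2(b-a)) the right-hand side
    is c^2. *)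
Lemma prim_sqr_le_Phi g x : bmeas g ->
  prim g x ^+ 2 <= 2 * (b - a) / p0 * Phi g.
Proof.
move=> bg; apply: (le_trans (prim_sqr_le x bg)).
have h := Phi_ge bg.
have -> : (b - a) * sqn g = 2 * (b - a) / p0 * (p0 / 2 * sqn g) by field; exact: lt0r_neq0.
by rewrite ler_wpM2l// divr_ge0 ?mulr_ge0// ltW.
Qed.

Definition Phi_cst : R := P + Q * (b - a) ^+ 2.

Lemma Phi_cst_ge0 : 0 <= Phi_cst.
Proof. by rewrite addr_ge0 ?mulr_ge0 ?sqr_ge0 ?Q_ge0// ltW ?P_gt0. Qed.

(** Young's inequality 2 y z <= eta y^2 + z^2 / eta with [eta] free: it is chosen small against
    [sqn g] first, and [h] small afterwards. The term in [q] is bounded through [sqn_prim_le], hence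
    the form of [Phi_cst]. *)
Lemma Phi_close g h eta : bmeas g -> bmeas h -> 0 < eta ->
  `|Phi (fun x => g x + h x) - Phi g| <=
  Phi_cst / 2 * (eta * sqn g + (eta^-1 + 1) * sqn h).
Proof.
move=> bg bh eta0.
have ei0 : 0 < eta^-1 by rewrite invr_gt0.
have bgh : bmeas (fun x => g x + h x) by bm.
have bw : bmeas (fun x => prim g x + prim h x) by bm.
have pE x : prim (fun x => g x + h x) x = prim g x + prim h x.
  by rewrite primD//; bm.
rewrite /Phi -integB; [|by bm..].
apply: (le_trans (integ_norm _)); first by bm.
set A := fun x : R => 2^-1 * P * (eta * g x ^+ 2 + (eta^-1 + 1) * h x ^+ 2).
set B := fun x : R => 2^-1 * Q * (eta * prim g x ^+ 2 + (eta^-1 + 1) * prim h x ^+ 2).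
have bA : bmeas A by rewrite /A; bm.
have bB : bmeas B by rewrite /B; bm.
apply: (@le_trans _ _ (integ (fun x => A x + B x))).
  apply: integ_le; [by bm..|by bm|].
  move=> x; rewrite pE /A /B.
  have /andP[p1 p2] := p_bound x; have /andP[q1 q2] := q_bound x.
  have amgm (m M y z : R) : 0 <= m -> m <= M ->
      `|2^-1 * (m * ((y + z) ^+ 2 - y ^+ 2))| <=
      2^-1 * M * (eta * y ^+ 2 + (eta^-1 + 1) * z ^+ 2).
    move=> m0 mM.
    have yz : `|(y + z) ^+ 2 - y ^+ 2| <= eta * y ^+ 2 + (eta^-1 + 1) * z ^+ 2.
      have e1 : eta * eta^-1 = 1 by rewrite mulfV// gt_eqF.
      have s1 : 0 <= eta^-1 * (eta * y - z) ^+ 2 by rewrite mulr_ge0 ?sqr_ge0 ?ltW.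
      have s2 : 0 <= eta^-1 * (eta * y + z) ^+ 2 by rewrite mulr_ge0 ?sqr_ge0 ?ltW.
      have e2 : eta^-1 * (eta * y - z) ^+ 2 = eta * y ^+ 2 - 2 * y * z + eta^-1 * z ^+ 2.
        by field; lra.
      have e3 : eta^-1 * (eta * y + z) ^+ 2 = eta * y ^+ 2 + 2 * y * z + eta^-1 * z ^+ 2.
        by field; lra.
      have z2 := sqr_ge0 z.
      by rewrite ler_norml; apply/andP; split; nra.
    rewrite !normrM (ger0_norm m0) (@ger0_norm _ 2^-1)// -mulrA.
    by rewrite ler_wpM2l// ler_pM// (le_trans m0).
  have -> : 2^-1 * (p x * (g x + h x) ^+ 2 + q x * (prim g x + prim h x) ^+ 2) -
     2^-1 * (p x * g x ^+ 2 + q x * prim g x ^+ 2) =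
     2^-1 * (p x * ((g x + h x) ^+ 2 - g x ^+ 2)) +
     2^-1 * (q x * ((prim g x + prim h x) ^+ 2 - prim g x ^+ 2)) by ring.
  have pp : 0 <= p x := le_trans (ltW p0_gt0) p1.
  by apply: (le_trans (ler_normD _ _)); apply: lerD; apply: amgm.
have eA : integ A = 2^-1 * P * (eta * sqn g + (eta^-1 + 1) * sqn h).
  rewrite /A integZ; last by bm.
  by rewrite integD ?integZ//; bm.
have eB : integ B = 2^-1 * Q * (eta * sqn (prim g) + (eta^-1 + 1) * sqn (prim h)).
  rewrite /B integZ; last by bm.
  by rewrite integD ?integZ//; bm.
rewrite integD; [|by bm..]; rewrite eA eB /Phi_cst.
have -> : (P + Q * (b - a) ^+ 2) / 2 * (eta * sqn g + (eta^-1 + 1) * sqn h) =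
  2^-1 * P * (eta * sqn g + (eta^-1 + 1) * sqn h) +
  2^-1 * Q * (eta * ((b - a) ^+ 2 * sqn g) + (eta^-1 + 1) * ((b - a) ^+ 2 * sqn h)).
  by ring.
have ei1 : 0 <= eta^-1 + 1 by rewrite addr_ge0// ltW.
rewrite lerD2l ler_wpM2l ?mulr_ge0 ?Q_ge0//.
by apply: lerD; rewrite ler_wpM2l ?sqn_prim_le// ltW.
Qed.

Lemma sqn_le_sup h e : bmeas h -> (forall x, `|h x| <= e) -> sqn h <= e ^+ 2 * (b - a).
Proof.
move=> bh he; rewrite -integ_cst; last exact: ltW.
apply: integ_le; [by bm..|] => x.
by rewrite -real_normK ?num_real// lerXn2r ?nnegrE// (le_trans _ (he x)).
Qed.

Lemma Phi_curve_continuous (c : R -> R -> R) (L : R) :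
  (forall s, bmeas (c s)) ->
  (forall s t x, `|c s x - c t x| <= L * `|s - t|) ->
  continuous (fun s => Phi (c s)).
Proof.
move=> bc cL s.
have L0 : 0 <= L by have := cL 1 0 0; rewrite subr0 normr1 mulr1; exact: le_trans.
apply/cvgrPdist_le => /= e e0.
set C := Phi_cst; have C0 : 0 <= C := Phi_cst_ge0.
have D0 := sqn_ge0 (c s).
(* This [eta] makes the term in [sqn (c s)] small before t is chosen; the large factor [eta^-1 + 1]
   is then compensated by taking t close to s. *)
pose eta := e / (C * sqn (c s) + 1).
have den0 : 0 < C * sqn (c s) + 1 by rewrite ltr_wpDl// mulr_ge0.
have eta0 : 0 < eta by rewrite divr_gt0.
have ei0 : 0 < eta^-1 by rewrite invr_gt0.
pose M := C * (eta^-1 + 1) * (L ^+ 2 * (b - a)).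
have ba := ltW ba0.
have M0 : 0 <= M by rewrite !mulr_ge0 ?sqr_ge0//; lra.
have dlt0 : 0 < Num.min 1 (e / (M + 1)).
  by rewrite lt_min ltr01 divr_gt0// ltr_wpDl.
exists (Num.min 1 (e / (M + 1))) => //= t /=; rewrite lt_min => /andP[t1 t2].
have -> : c t = (fun x => c s x + (c t x - c s x)) by apply/funext => x; ring.
have bct := bc t; have bcs := bc s.
have bd : bmeas (fun x => c t x - c s x) by bm.
rewrite distrC; apply: (le_trans (Phi_close (bc s) bd eta0)).
have h1 : C * (eta * sqn (c s)) <= e.
  have -> : C * (eta * sqn (c s)) = e * (C * sqn (c s) / (C * sqn (c s) + 1)).
    by rewrite /eta; field; rewrite gt_eqF.
  by rewrite ler_piMr ?(ltW e0)// ler_pdivrMr// mul1r lerDl.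
have hd : sqn (fun x => c t x - c s x) <= (L * `|s - t|) ^+ 2 * (b - a).
  by apply: sqn_le_sup => // x; rewrite distrC.
have hd2 : sqn (fun x => c t x - c s x) <= L ^+ 2 * (b - a) * `|s - t|.
  have n2 : `|s - t| ^+ 2 <= `|s - t| by rewrite expr2 ler_piMl// ltW.
  apply: (le_trans hd); rewrite exprMn mulrAC ler_wpM2l//.
  by rewrite mulr_ge0 ?sqr_ge0.
have h2 : C * ((eta^-1 + 1) * sqn (fun x => c t x - c s x)) <= e.
  apply: (@le_trans _ _ (M * `|s - t|)).
    rewrite /M -!mulrA ler_wpM2l// ler_wpM2l//; first by lra.
    by rewrite !mulrA.
  apply: (@le_trans _ _ (M * (e / (M + 1)))); first by rewrite ler_wpM2l// ltW.
  by rewrite mulrCA ler_piMr ?(ltW e0)// ler_pdivrMr ?mul1r ?lerDl// ltr_wpDl.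
by rewrite -/C; lra.
Qed.

Lemma Phi_crossing (c : R -> R -> R) (L r s0 s1 : R) :
  (forall s, bmeas (c s)) ->
  (forall s t x, `|c s x - c t x| <= L * `|s - t|) ->
  s0 <= s1 -> (Phi (c s0) - r) * (Phi (c s1) - r) <= 0 ->
  exists2 s, s0 <= s <= s1 & Phi (c s) = r.
Proof.
move=> bc cL s01 sgn.
have between (u v : R) : (u - r) * (v - r) <= 0 -> Num.min u v <= r <= Num.max u v.
  move=> uv; rewrite ge_min le_max; case: (leP u r) => h1; case: (leP v r) => h2 //=.
  - by case: (leP r u) => //= h3; case: (leP r v) => //= h4; nra.
  - by rewrite (ltW h2) orbT.
  - by rewrite (ltW h1).
  - by exfalso; nra.
have mid := between _ _ sgn.
have [s ss sr] := IVT s01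
  (continuous_subspaceT (Phi_curve_continuous bc cL)) mid.
by exists s => //; move: ss; rewrite in_itv.
Qed.

End quadratic.

(** The relation G' = f enters as a second-order Taylor bound, which is the form the descent
    estimate consumes. *)
Record nonlinearity (R : realType) (f G : R -> R) (ell : R) : Prop :=
  Nonlinearity {
    nl_ell : 0 <= ell;
    nl_lipschitz : forall x y, `|f x - f y| <= ell * `|x - y|;
    nl_taylor : forall x y, `|G y - G x - f x * (y - x)| <= ell * (y - x) ^+ 2 }.

Section nonlinearity_theory.
Context (R : realType) (f G : R -> R) (ell : R).
Hypothesis nl : nonlinearity f G ell.
Let l0 : 0 <= ell := nl_ell nl.

Lemma nl_f_continuous : continuous f.
Proof.
move=> x; apply/cvgrPdist_le => /= e e0.
have d0 : 0 < e / (ell + 1) by rewrite divr_gt0// ltr_wpDl.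
exists (e / (ell + 1)) => //= y /=; rewrite ltr_pdivlMr ?ltr_wpDl// => xy.
apply: (le_trans (nl_lipschitz nl x y)).
have := normr_ge0 (x - y); have := l0; nra.
Qed.

Lemma nl_G_increment x y :
  `|G y - G x| <= (`|f x| + ell * `|y - x|) * `|y - x|.
Proof.
have -> : G y - G x = (G y - G x - f x * (y - x)) + f x * (y - x) by ring.
apply: (le_trans (ler_normD _ _)); rewrite normrM.
have := nl_taylor nl x y; rewrite -[(y - x) ^+ 2]real_normK ?num_real//.
by lra.
Qed.

Lemma nl_G_continuous : continuous G.
Proof.
move=> x; apply/cvgrPdist_le => /= e e0.
set M := `|f x| + ell; have M0 : 0 <= M by rewrite addr_ge0.
have d0 : 0 < e / (M + 1) by rewrite divr_gt0// ltr_wpDl.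
exists (Num.min 1 (e / (M + 1))); first by rewrite /= lt_min ltr01.
move=> /= y; rewrite lt_min ltr_pdivlMr ?ltr_wpDl// => /andP[xy1 xy].
rewrite distrC; apply: (le_trans (nl_G_increment x y)); rewrite distrC in xy1 xy.
have n0 := normr_ge0 (y - x).
apply: (@le_trans _ _ (M * `|y - x|)); last by nra.
rewrite ler_wpM2r// lerD2l; have := l0; nra.
Qed.

Lemma nl_f_bmeas u : bmeas u -> bmeas (fun x => f (u x)).
Proof.
move=> [mu [M uM]]; split.
  exact: (measurableT_comp (continuous_measurable_fun nl_f_continuous) mu).
exists (`|f 0| + ell * M) => x.
have -> : f (u x) = f 0 + (f (u x) - f 0) by ring.
apply: (le_trans (ler_normD _ _)); rewrite lerD2l.
apply: (le_trans (nl_lipschitz nl _ _)); rewrite subr0.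
by rewrite ler_wpM2l.
Qed.

Lemma nl_G_bmeas u : bmeas u -> bmeas (fun x => G (u x)).
Proof.
move=> [mu [M uM]]; split.
  exact: (measurableT_comp (continuous_measurable_fun nl_G_continuous) mu).
exists (`|G 0| + (`|f 0| + ell * M) * M) => x.
have -> : G (u x) = G 0 + (G (u x) - G 0) by ring.
apply: (le_trans (ler_normD _ _)); rewrite lerD2l.
apply: (le_trans (nl_G_increment _ _)); rewrite subr0.
have := uM x; have := normr_ge0 (u x); have := normr_ge0 (f 0) => f0 u0 uxM.
apply: ler_pM => //; first by rewrite addr_ge0 ?mulr_ge0.
by rewrite lerD2l ler_wpM2l.
Qed.

End nonlinearity_theory.

(** * Steepest descent *)

Section abstract_descent.
Context (R : realType) (M : Type) (S : M -> Prop).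
Variables (E Phi rho : M -> R) (T : M -> M) (tau r dl : R).
Hypothesis tau_gt0 : 0 < tau.
Hypothesis S_T : forall g, S g -> S (T g).
Hypothesis rho_ge0 : forall g, 0 <= rho g.
Hypothesis descent : forall g, S g -> E (T g) <= E g - tau * rho g.
Hypothesis same_side : forall g, S g -> E g < dl ->
  0 < (Phi g - r) * (Phi (T g) - r).
Hypothesis barrier : forall g, S g -> Phi g = r -> dl <= E g.

Lemma descent_le g : S g -> E (T g) <= E g.
Proof.
by move=> Sg; apply: (le_trans (descent Sg)); rewrite gerBl mulr_ge0// ltW.
Qed.

Lemma iter_S n g : S g -> S (iter n T g).
Proof. by move=> Sg; elim: n => //= n IH; exact: S_T. Qed.

Lemma iter_le n g : S g -> E (iter n T g) <= E g.
Proof.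
move=> Sg; elim: n => //= n IH; apply: le_trans IH.
exact/descent_le/iter_S.
Qed.

Lemma iter_same_side n g : S g -> E g < dl -> Phi g != r ->
  0 < (Phi g - r) * (Phi (iter n T g) - r).
Proof.
move=> Sg Eg gr; elim: n => [|n IH].
  by rewrite -expr2 exprn_even_gt0//= subr_eq0.
have Si := iter_S n Sg.
have Ei : E (iter n T g) < dl := le_lt_trans (iter_le n Sg) Eg.
have := same_side Si Ei; rewrite -iterS.
move: (Phi g - r) (Phi (iter n T g) - r) (Phi (iter n.+1 T g) - r) IH => x y z IH.
move=> yz; have y2 : 0 < y ^+ 2.
  rewrite exprn_even_gt0//=; apply/eqP => y0.
  by move: IH; rewrite y0 mulr0 ltxx.
have : 0 < (x * y) * (y * z) by exact: mulr_gt0.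
have -> : x * y * (y * z) = y ^+ 2 * (x * z) by ring.
by rewrite pmulr_rgt0.
Qed.

(** Otherwise every step lowers [E] by at least [tau * eps], and after N steps the value is below
    [Emin]. *)
Lemma descent_approx Emin g eps : (forall h, S h -> Emin <= E h) ->
  S g -> 0 < eps -> exists n, rho (iter n T g) <= eps.
Proof.
move=> Ege Sg eps0; apply: contrapT => no.
have te : 0 < tau * eps by rewrite mulr_gt0.
have big n : tau * eps <= tau * rho (iter n T g).
  rewrite ler_wpM2l//; first exact: ltW.
  by rewrite leNgt; apply/negP => h; apply: no; exists n; exact: ltW.
have dec n : E (iter n T g) <= E g - n%:R * (tau * eps).
  elim: n => [|n IH]; first by rewrite mul0r subr0.
  have := descent (iter_S n Sg); have := big n.
  by rewrite iterS -(@natr1 R n) mulrDl mul1r; lra.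
pose N := (Num.truncn ((E g - Emin) / (tau * eps))).+1.
have := le_trans (Ege _ (iter_S N Sg)) (dec N).
have : (E g - Emin) / (tau * eps) < N%:R by exact: truncnS_gt.
by rewrite ltr_pdivrMr//; lra.
Qed.

(* Let the descent act on the whole path c: without almost critical points above
   the level dl', the path would eventually lie below dl', although its ends
   stay on opposite sides of the barrier. *)
Lemma mountain_pass (c : R -> M) eps E0 dl' : 0 < eps -> dl' < dl ->
  (forall th, S (c th)) ->
  (forall th, 0 <= th <= 1 -> E (c th) <= E0) ->
  (forall n, (Phi (iter n T (c 0)) - r) * (Phi (iter n T (c 1)) - r) <= 0 ->
     exists2 th, 0 <= th <= 1 & Phi (iter n T (c th)) = r) ->
  E (c 0) < dl -> E (c 1) < dl -> Phi (c 0) < r -> r < Phi (c 1) ->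
  exists g, [/\ S g, rho g <= eps, dl' <= E g & E g <= E0].
Proof.
move=> eps0 dd Sc EE cross e0 e1 f0 f1; apply: contrapT => no.
have te : 0 < tau * eps by rewrite mulr_gt0.
have big g : S g -> dl' <= E g -> E g <= E0 -> tau * eps <= tau * rho g.
  move=> Sg h1 h2; rewrite ler_wpM2l//; first exact: ltW.
  by rewrite leNgt; apply/negP => h; apply: no; exists g; split => //; exact: ltW.
(* Either the point has already fallen below dl', where the descent keeps it, or each of the n steps
   has gained [tau * eps]. *)
have dec n th : 0 <= th <= 1 -> E (iter n T (c th)) < dl' \/
    E (iter n T (c th)) <= E0 - n%:R * (tau * eps).
  move=> th01; elim: n => [|n IH]; first by right; rewrite mul0r subr0; exact: EE.
  have Si := iter_S n (Sc th).
  case: (ltP (E (iter n T (c th))) dl') => h.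
    by left; apply: le_lt_trans h; exact: descent_le.
  case: IH => [|IH]; first by rewrite ltNge h.
  right; have h2 : E (iter n T (c th)) <= E0.
    by apply: (le_trans (iter_le n (Sc th))); exact: EE.
  have := descent Si; have := big _ Si h h2.
  by rewrite iterS -(@natr1 R n) mulrDl mul1r; lra.
pose N := (Num.truncn ((E0 - dl') / (tau * eps))).+1.
have low th : 0 <= th <= 1 -> E (iter N T (c th)) < dl'.
  move=> th01; case: (dec N th th01) => // h; apply: (le_lt_trans h).
  have : (E0 - dl') / (tau * eps) < N%:R by exact: truncnS_gt.
  by rewrite ltr_pdivrMr//; lra.
have [] := cross N.
  have := iter_same_side N (Sc 0) e0 (negbT (lt_eqF f0)).
  have := iter_same_side N (Sc 1) e1 (negbT (gt_eqF f1)).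
  rewrite pmulr_rgt0 ?subr_gt0// nmulr_rgt0 ?subr_lt0// => h1 h0.
  by rewrite ltW// nmulr_rlt0 ?subr_lt0// subr_gt0.
move=> th th01 /(barrier (iter_S N (Sc th))); rewrite leNgt => /negP; apply.
exact: lt_trans (low th th01) dd.
Qed.

End abstract_descent.

Section energy.
Context (R : realType) (a b : R) (hab : a < b).
Variables (p q : R -> R) (p0 P Q lam : R).
Hypothesis coef : coefficients p q p0 P Q.
Hypothesis lam0 : 0 <= lam.
Variables (f G : R -> R) (ell : R).
Hypothesis nl : nonlinearity f G ell.
Implicit Types (g h k u : R -> R).
Local Notation integ := (integ a b).
Local Notation prim := (prim a b).
Local Notation coprim := (coprim a b).
Local Notation Phi := (Phi a b p q).
Local Notation sqn := (sqn a b).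
Let ba0 : 0 < b - a. Proof. by rewrite subr_gt0. Qed.
Let p0_gt0 := coef_p0_gt0 coef.
Let p_bound := coef_p_bound coef.
Let q_bound := coef_q_bound coef.
Let l0 : 0 <= ell := nl_ell nl.
Let p_pos x : 0 < p x.
Proof. by have /andP[h _] := p_bound x; exact: lt_le_trans h. Qed.
Let P_pos := P_gt0 coef.
Let Q_nneg := Q_ge0 coef.

(* The derivative of the energy at g in the direction h is
   integ (residual g * h). *)
Definition source g x : R := q x * prim g x - lam * f (prim g x).
Definition residual g x : R := p x * g x + coprim (source g) x.
(** [residual g / p] is the gradient of the energy for the inner product int p g h; this is its
    squared norm in that inner product, and [step] is the corresponding gradient step. *)
Definition resnorm g : R := integ (fun x => residual g x ^+ 2 * (p x)^-1).
Definition energy g : R := Phi g - lam * integ (fun x => G (prim g x)).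
Definition step (t : R) g x : R := g x - t * (residual g x * (p x)^-1).

Ltac bm_leaf ::= first [exact: (p_bmeas coef) | exact: (q_bmeas coef) |
  exact: (invp_bmeas coef) |
  lazymatch goal with
  | |- bmeas (fun x => f (@?u x)) => apply: (@nl_f_bmeas _ _ _ _ nl u); bm
  | |- bmeas (fun x => G (@?u x)) => apply: (@nl_G_bmeas _ _ _ _ nl u); bm
  end].

Lemma source_bmeas g : bmeas g -> bmeas (source g).
Proof. by move=> bg; rewrite /source; bm. Qed.

Lemma residual_bmeas g : bmeas g -> bmeas (residual g).
Proof. by move=> bg; have bs := source_bmeas bg; rewrite /residual; bm. Qed.

Lemma step_bmeas t g : bmeas g -> bmeas (step t g).
Proof. by move=> bg; have br := residual_bmeas bg; rewrite /step; bm. Qed.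

Lemma resnorm_ge0 g : 0 <= resnorm g.
Proof. by apply: integ_ge0 => x; rewrite mulr_ge0 ?sqr_ge0 ?invr_ge0 ?ltW. Qed.

(** Bounds the second-order terms coming from [q] and from [G], converted from [sqn (prim h)] to
    [sqn h] by the factor (b-a)^2. *)
Definition descent_cst : R := (Q / 2 + lam * ell) * (b - a) ^+ 2.

(** Along h = - t residual / p the first variation is - t [resnorm g], the quadratic term in [p] is
    exactly t^2 / 2 [resnorm g], and the other second-order terms are at most [descent_cst / p0] t^2
    [resnorm g]. Smallness of t lets the last two consume only half of the first. *)
Lemma step_descent t g : bmeas g -> 0 <= t ->
  t * (2^-1 + descent_cst / p0) <= 2^-1 ->
  energy (step t g) <= energy g - t / 2 * resnorm g.
Proof.
move=> bg t0 tsmall.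
have br := residual_bmeas bg; have bs := source_bmeas bg.
pose h x := - t * (residual g x * (p x)^-1).
have bh : bmeas h by rewrite /h; bm.
have sE : step t g = (fun x => g x + h x).
  by apply/funext => x; rewrite /step /h; ring.
have pE x : prim (step t g) x = prim g x + prim h x.
  by rewrite sE primD//; bm.
have bst := step_bmeas t bg.
have v2 : sqn (prim h) <= (b - a) ^+ 2 * sqn h := sqn_prim_le hab bh.
have h2 : sqn h <= t ^+ 2 / p0 * resnorm g.
  rewrite -integZ; last by bm.
  apply: integ_le; [by bm..|] => x; rewrite /h.
  have -> : (- t * (residual g x * (p x)^-1)) ^+ 2 =
    t ^+ 2 * (residual g x ^+ 2 * (p x)^-1) * (p x)^-1 by ring.
  have -> : t ^+ 2 / p0 * (residual g x ^+ 2 * (p x)^-1) =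
    t ^+ 2 * (residual g x ^+ 2 * (p x)^-1) * p0^-1 by ring.
  rewrite ler_wpM2l//; first by rewrite mulr_ge0 ?sqr_ge0// mulr_ge0 ?sqr_ge0// invr_ge0 ltW.
  by rewrite lef_pV2 ?posrE//; have /andP[] := p_bound x.
pose A x := residual g x * h x.
pose B x := 2^-1 * (p x * h x ^+ 2).
pose C x := (Q / 2 + lam * ell) * prim h x ^+ 2.
have bA : bmeas A by rewrite /A; bm.
have bB : bmeas B by rewrite /B; bm.
have bC : bmeas C by rewrite /C; bm.
(* Integration by parts turns the first variation, written with [prim h], into the pairing of the
   residual with [h]. *)
have dual : integ A = integ (fun x => p x * g x * h x + source g x * prim h x).
  rewrite integD; [|by bm..].
  rewrite -(coprim_prim_dual bs); last by bm.
  rewrite -integD; [|by bm..].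
  by apply: integ_eq => x; rewrite /A /residual; ring.
have eA : integ A = - t * resnorm g.
  rewrite -integZ; last by bm.
  by apply: integ_eq => x; rewrite /A /h; ring.
have eB : integ B = 2^-1 * (t ^+ 2 * resnorm g).
  rewrite /B integZ; last by bm.
  rewrite -[t ^+ 2 * _]integZ; last by bm.
  congr (_ * _); apply: integ_eq => x; rewrite /h.
  by field; exact: lt0r_neq0.
have eC : integ C = (Q / 2 + lam * ell) * sqn (prim h).
  by rewrite /C integZ//; bm.
have key : energy (step t g) - energy g <= integ A + integ B + integ C.
  have -> : energy (step t g) - energy g = integ (fun x =>
      2^-1 * (p x * step t g x ^+ 2 + q x * prim (step t g) x ^+ 2)
      - lam * G (prim (step t g) x)
      - (2^-1 * (p x * g x ^+ 2 + q x * prim g x ^+ 2) - lam * G (prim g x))).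
    rewrite integB; [|by bm..].
    rewrite integB; [|by bm..].
    rewrite integB; [|by bm..].
    have eZ w : bmeas w -> integ (fun x => lam * G (prim w x)) =
        lam * integ (fun x => G (prim w x)) by move=> bw; rewrite integZ//; bm.
    by rewrite !eZ.
  rewrite dual -integD; [|by bm..].
  rewrite -integD; [|by bm..].
  apply: integ_le; [by bm..|] => x.
  rewrite pE sE /B /C /source.
  set v := prim h x; set u := prim g x.
  have /andP[q1 q2] := q_bound x.
  have T := nl_taylor nl u (u + v).
  have {}T : - (G (u + v) - G u - f u * v) <= ell * v ^+ 2.
    move: T; have -> : u + v - u = v by ring.
    by rewrite ler_norml => /andP[T _]; rewrite lerNl.
  have T' := ler_wpM2l lam0 T.
  have qv : q x * v ^+ 2 <= Q * v ^+ 2 by rewrite ler_wpM2r ?sqr_ge0.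
  by move: T' qv; rewrite !sqrrD; lra.
have r0 := resnorm_ge0 g.
set K1 := descent_cst / p0 in tsmall *.
have hC : integ C <= K1 * t ^+ 2 * resnorm g.
  rewrite eC; have c0 : 0 <= Q / 2 + lam * ell.
    by rewrite addr_ge0 ?mulr_ge0// divr_ge0.
  apply: (le_trans (ler_wpM2l c0 v2)).
  apply: (@le_trans _ _ ((Q / 2 + lam * ell) * ((b - a) ^+ 2 * (t ^+ 2 / p0 * resnorm g)))).
    by rewrite ler_wpM2l// ler_wpM2l ?sqr_ge0.
  rewrite /K1 /descent_cst le_eqVlt; apply/orP; left; apply/eqP.
  by field; exact: lt0r_neq0.
have tr : 0 <= t * resnorm g by rewrite mulr_ge0.
have fin := ler_wpM2r tr tsmall.
rewrite -lerBlDl; apply: (le_trans key); rewrite eA eB.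
by lra.
Qed.

Lemma integ_norm_sup h e : bmeas h -> (forall x, `|h x| <= e) ->
  integ (fun x => `|h x|) <= e * (b - a).
Proof.
move=> bh he; rewrite -integ_cst; last exact: ltW.
by apply: integ_le; [bm|bm|].
Qed.

Lemma prim_sup h e x : bmeas h -> (forall x, `|h x| <= e) ->
  `|prim h x| <= e * (b - a).
Proof.
move=> bh he; apply: le_trans (integ_norm_sup bh he).
by apply: prim_bound; bm.
Qed.

Lemma coprim_sup h e x : bmeas h -> (forall x, `|h x| <= e) ->
  `|coprim h x| <= e * (b - a).
Proof.
move=> bh he; apply: le_trans (integ_norm_sup bh he).
have bl := lt_indic_bmeas x.
rewrite coprim_gt; last by bm.
apply: (le_trans (integ_norm _)); first by bm.
apply: integ_le; [by bm..|] => t.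
rewrite normrM ler_piMr//; case: (x < t)%R; by rewrite ?normr1 ?normr0.
Qed.

(** Needed for the mountain pass: a path that is Lipschitz in the sup norm must remain so after any
    number of descent steps, in order to apply the intermediate value theorem to it. *)
Lemma step_sup_lipschitz t : exists2 L, 0 <= L &
  forall g k e, bmeas g -> bmeas k -> (forall x, `|g x - k x| <= e) ->
  forall x, `|step t g x - step t k x| <= L * e.
Proof.
pose S := (Q + lam * ell) * (b - a).
have ba := ltW ba0.
have S0 : 0 <= S by rewrite mulr_ge0// addr_ge0// mulr_ge0.
have L0 : 0 <= (P + S * (b - a)) * p0^-1.
  apply: mulr_ge0; last by rewrite invr_ge0 ltW.
  by apply: addr_ge0; [exact: ltW|exact: mulr_ge0].
exists (1 + `|t| * ((P + S * (b - a)) * p0^-1)); first by rewrite addr_ge0// mulr_ge0.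
move=> g k e bg bk gk.
have e0 : 0 <= e by exact: le_trans (gk 0).
have bsg := source_bmeas bg; have bsk := source_bmeas bk.
have bgk : bmeas (fun x => g x - k x) by bm.
have src x : `|source g x - source k x| <= S * e.
  have pgk : `|prim g x - prim k x| <= e * (b - a).
    by rewrite -primB; [exact: prim_sup|bm|bm].
  have /andP[q1 q2] := q_bound x.
  have -> : source g x - source k x =
    q x * (prim g x - prim k x) - lam * (f (prim g x) - f (prim k x)).
    by rewrite /source; ring.
  apply: (le_trans (ler_normB _ _)); rewrite !normrM (ger0_norm q1) (ger0_norm lam0).
  have -> : S * e = Q * (e * (b - a)) + lam * (ell * (e * (b - a))) by rewrite /S; ring.
  apply: lerD; first by rewrite ler_pM.
  rewrite ler_wpM2l//; apply: (le_trans (nl_lipschitz nl _ _)).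
  by rewrite ler_wpM2l.
have bs : bmeas (fun x => source g x - source k x) by bm.
have res x : `|residual g x - residual k x| <= (P + S * (b - a)) * e.
  have cE : coprim (source g) x - coprim (source k) x =
      coprim (fun x => source g x - source k x) x.
    rewrite /coprim_def primB; [|by bm..].
    rewrite integB; [|by bm..].
    move: (integ _) (integ _) (prim_def _ _ _ _) (prim_def _ _ _ _) => i1 i2 i3 i4.
    by ring.
  have -> : residual g x - residual k x = p x * (g x - k x) +
      coprim (fun x => source g x - source k x) x.
    rewrite -cE /residual.
    by move: (coprim (source g) x) (coprim (source k) x) => c1 c2; ring.
  apply: (le_trans (ler_normD _ _)).
  have -> : (P + S * (b - a)) * e = P * e + S * e * (b - a) by ring.
  apply: lerD; last exact: coprim_sup.
  rewrite normrM (ger0_norm (ltW (p_pos x))) ler_pM// ?(ltW (p_pos x))//.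
  by have /andP[] := p_bound x.
move=> x.
have -> : step t g x - step t k x =
    (g x - k x) - t * ((residual g x - residual k x) * (p x)^-1).
  by rewrite /step; move: (residual g x) (residual k x) => r1 r2; ring.
apply: (le_trans (ler_normB _ _)); rewrite [leRHS]mulrDl mul1r lerD//.
rewrite normrM -mulrA ler_wpM2l// normrM mulrAC ler_pM//.
rewrite ger0_norm ?invr_ge0 ?(ltW (p_pos x))// lef_pV2 ?posrE//.
by have /andP[] := p_bound x.
Qed.

Variable tau : R.
Hypothesis tau_gt0 : 0 < tau.
Hypothesis tau_small : tau * (2^-1 + descent_cst / p0) <= 2^-1.

Let K0 : 0 <= descent_cst / p0.
Proof.
by rewrite divr_ge0 ?(ltW p0_gt0)// mulr_ge0 ?sqr_ge0// addr_ge0 ?mulr_ge0//.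
Qed.

Lemma stepE t g x : step t g x = g x - t * (residual g x * (p x)^-1).
Proof. by []. Qed.

Lemma step_energy_le t g : bmeas g -> 0 <= t <= tau -> energy (step t g) <= energy g.
Proof.
move=> bg /andP[t0 tt].
have : t * (2^-1 + descent_cst / p0) <= 2^-1.
  by apply: le_trans tau_small; rewrite ler_wpM2r// addr_ge0.
move=> /(step_descent bg t0) /le_trans; apply.
by rewrite gerBl mulr_ge0 ?resnorm_ge0// divr_ge0.
Qed.

Lemma step_tau_descent g : bmeas g ->
  energy (step tau g) <= energy g - tau / 2 * resnorm g.
Proof. by move=> bg; apply: step_descent => //; exact: ltW. Qed.

Variables (r dl : R).
Hypothesis barrier : forall g, bmeas g -> Phi g = r -> dl <= energy g.

(* A segment of descent that starts below the barrier height cannot cross the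
   sphere Phi = r. *)
Lemma step_same_side g : bmeas g -> energy g < dl ->
  0 < (Phi g - r) * (Phi (step tau g) - r).
Proof.
move=> bg Eg; rewrite ltNge; apply/negP => sgn.
have br := residual_bmeas bg.
have bw : bmeas (fun x => residual g x * (p x)^-1) by bm.
have [_ [L wL]] := bw.
have [] := @Phi_crossing _ _ _ hab _ _ _ _ _ coef (fun s => step s g) L r 0 tau.
- by move=> s; exact: step_bmeas.
- move=> s t x.
  have -> : step s g x - step t g x = (t - s) * (residual g x * (p x)^-1).
    by rewrite !stepE; move: (residual g x) => r1; ring.
  by rewrite normrM distrC mulrC ler_wpM2r.
- exact: ltW.
- by have -> : step 0 g = g by apply/funext => x; rewrite stepE mul0r subr0.
move=> s st /(barrier (step_bmeas s bg)); rewrite leNgt => /negP; apply.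
exact: le_lt_trans (step_energy_le bg st) Eg.
Qed.

(** The segment from 0 to [gbar] is Lipschitz with constant M in the sup norm, and each step
    multiplies the constant by [Ls]. *)
Lemma iter_crossing gbar n : bmeas gbar ->
  (Phi (iter n (step tau) (fun x => 0 * gbar x)) - r) *
    (Phi (iter n (step tau) (fun x => 1 * gbar x)) - r) <= 0 ->
  exists2 th, 0 <= th <= 1 & Phi (iter n (step tau) (fun x => th * gbar x)) = r.
Proof.
move=> bg; have [_ [M gM]] := bg.
have [Ls Ls0 stepL] := step_sup_lipschitz tau.
have bc th : bmeas (fun x => th * gbar x) by bm.
have bi m th : bmeas (iter m (step tau) (fun x => th * gbar x)).
  by elim: m => [|m IH]; [exact: bc|rewrite iterS; exact: step_bmeas].
apply: (@Phi_crossing _ _ _ hab _ _ _ _ _ coef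
    (fun s => iter n (step tau) (fun x => s * gbar x)) (Ls ^+ n * M) r 0 1) => //.
move=> s t; elim: n => [|n IH] x.
  by rewrite expr0 mul1r /= -mulrBl normrM mulrC ler_wpM2r.
rewrite exprS -!mulrA !iterS; apply: stepL; [exact: bi..|].
by move=> z; rewrite mulrA; exact: IH.
Qed.

End energy.

Local Notation energy_def := energy.

(** * Limits along an ultrafilter *)

Section ultralimit.
Context (R : realType) (U : set_system nat) (UU : UltraFilter U).
Implicit Types s : nat -> R.

Let lower s : set R := [set x | \forall n \near U, x <= s n].

Definition ulim s : R := sup (lower s).

(** The ultrafilter contains the set where [s n < ulim s + e] or its complement, and the complement
    would contradict the choice of the supremum. Bounded sequences thus converge without extraction
    of subsequences. *)
Lemma ulim_cvg s M : (forall n, `|s n| <= M) -> s n @[n --> U] --> ulim s.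
Proof.
move=> sM.
have sM' n : - M <= s n <= M by rewrite -ler_norml.
have hs : has_sup (lower s).
  split; first by exists (- M); apply: nearW => n; have /andP[] := sM' n.
  exists M => x lx; have [n xn] := filter_ex lx.
  by apply: (le_trans xn); have /andP[] := sM' n.
apply/cvgrPdist_le => /= e e0.
have [x lx xl] := sup_adherent e0 hs.
have up : U [set n | s n < ulim s + e].
  have [//|UA] := in_ultra_setVsetC [set n | s n < ulim s + e] UU.
  have : lower s (ulim s + e).
    by apply: filterS UA => n /= /negP; rewrite -leNgt.
  by move/(ub_le_sup hs.2); rewrite /ulim gerDl leNgt e0.
apply: filterS2 lx up => n /= h1 h2.
by rewrite ler_norml; apply/andP; split; move: xl h1 h2; rewrite /ulim; lra.
Qed.

Lemma ulim_ge0 s : (forall n, 0 <= s n) -> 0 <= ulim s.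
Proof.
move=> s0; have l0 : lower s 0 by apply: nearW.
(* [sup] takes the default value 0 on a set without supremum. *)
have [[_ ub]|no] := pselect (has_sup (lower s)); last by rewrite /ulim sup_out.
exact: ub_le_sup.
Qed.

End ultralimit.

(** * Lebesgue differentiation on (a, b) *)

Section leb_differentiation.
Context (R : realType) (a b : R).

Lemma leb_restrE (f : R -> R) : measurable_fun setT f ->
  (\int[leb a b]_x (f x)%:E = \int[@lebesgue_measure R]_(x in `]a, b[) (f x)%:E)%E.
Proof.
move=> mf.
transitivity (\int[leb a b]_(x in `]a, b[) (f x)%:E)%E; last first.
  apply: eq_measure_integral => A mA Aab.
  by rewrite /leb /= /mrestr setIidl.
rewrite [RHS]integral_mkcond.
apply: ae_eq_integral => //.
- exact/measurable_EFinP.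
- apply/(measurable_restrictT _ _).1 => //.
  exact/measurable_EFinP/measurable_funTS.
- apply: filterS (ae_leb_itv a b) => x xab _.
  by rewrite patchE mem_set.
Qed.

Lemma itg_lebesgue (w : R -> R) : itg a b w ->
  (@lebesgue_measure R).-integrable `]a, b[ (EFin \o w) /\
  (@lebesgue_measure R).-integrable setT (EFin \o (w \_ `]a, b[)).
Proof.
move=> iw; have mw := itg_meas iw.
have iab : (@lebesgue_measure R).-integrable `]a, b[ (EFin \o w).
  apply/integrableP; split; first exact/measurable_EFinP/measurable_funTS.
  have := leb_restrE (measurableT_comp (@normr_measurable R setT) mw).
  move=> /= E; rewrite [ltLHS](_ : _ = (\int[leb a b]_x (`|w x|)%:E)%E); last by rewrite E.
  by move/integrableP: iw => [].
split => //.
have := @integrable_mkcond _ _ R (@lebesgue_measure R) `]a, b[%classic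
  (EFin \o w) (measurable_itv _).
by move=> [/(_ iab)] + _; rewrite restrict_EFin.
Qed.

(** Lebesgue's differentiation theorem, applied to [w] extended by zero outside (a, b). *)
Lemma prim_derivable (w : R -> R) : itg a b w ->
  \forall x \ae leb a b, derivable (prim a b w) x 1 /\ derive1 (prim a b w) x = w x.
Proof.
move=> iw; have [iab ih] := itg_lebesgue iw.
have FE : (fun x => \int[@lebesgue_measure R]_(t in `]-oo, x]) (w \_ `]a, b[) t) =
    prim a b w.
  apply/funext => x; rewrite /prim /integ /Rintegral leb_restrE; last first.
    exact: itg_meas (itg_indic x iw).
  congr fine; rewrite integral_mkcond [RHS]integral_mkcond.
  apply: eq_integral => t _; rewrite !patchE.
  case: ifPn; rewrite mem_setE/= in_itv/= => tx; case: ifPn => // _.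
  - by rewrite tx mulr1.
  - by rewrite (negbTE tx) mulr0.
have := @FTC1Ny R (w \_ `]a, b[) _ (integrable_locally_restrict (measurable_itv _) iab).
rewrite FE => F1.
have {}F1 := ae_leb_lebesgue a b (F1 _).
have F2 : \forall x \ae leb a b, derivable (prim a b w) x 1 /\
    derive1 (prim a b w) x = (w \_ `]a, b[) x.
  by apply: F1 => y; apply: integrableS ih.
apply: filterS2 F2 (ae_leb_itv a b) => x [h1 h2] xab; split => //.
by rewrite h2 patchE mem_set.
Qed.

(** Right increments suffice for a derivable function, so that averages over intervals []x, x + h]]
    control the value of a density at x. *)
Lemma derive1_itv (phi : R -> R) (x al be e : R) : 0 < e -> derivable phi x 1 ->
  (forall h, 0 < h < e -> al * h <= phi (x + h) - phi x <= be * h) ->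
  al <= derive1 phi x <= be.
Proof.
move=> e0 dphi H.
have dr : h^-1 *: (phi (h + x) - phi x) @[h --> 0^'+] --> derive1 phi x.
  apply: cvg_dnbhs_at_right; rewrite derive1E.
  move: dphi; rewrite /derivable /derive /=.
  by under eq_fun do rewrite /GRing.scale/= mulr1.
have near0 : \forall h \near 0^'+, al <= h^-1 *: (phi (h + x) - phi x) <= be.
  near=> h.
  have h0 : 0 < h by near: h; exact: nbhs_right_gt.
  have he : h < e by near: h; exact: nbhs_right_lt.
  have /andP[k1 k2] : al * h <= phi (x + h) - phi x <= be * h by rewrite H ?h0.
  by rewrite [h + x]addrC /GRing.scale/= mulrC ler_pdivlMr// ler_pdivrMr// k1.
apply/andP; split.
- by apply: (cvgr_to_ge dr); apply: filterS near0 => h /andP[].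
- by apply: (cvgr_to_le dr); apply: filterS near0 => h /andP[].
Unshelve. all: by end_near. Qed.

End leb_differentiation.

(** * Weak limits of bounded sequences *)

Section weak_limit.
Context (R : realType) (a b : R).
Context (U : set_system nat) (UU : UltraFilter U).
Variables (s : nat -> R -> R) (L : R).
Hypothesis s_meas : forall n, measurable_fun setT (s n).
Hypothesis s_bound : forall n x, 0 <= s n x <= L.
Local Notation integ := (integ a b).

Let sb n : bmeas (s n).
Proof.
split => //; exists L => x; have /andP[h1 h2] := s_bound n x.
by rewrite ger0_norm.
Qed.

Let L0 : 0 <= L.
Proof. by have /andP[h1 h2] := s_bound 0%N 0; exact: le_trans h2. Qed.

Lemma indic_bmeas (A : set (measurableTypeR R)) : measurable A -> bmeas (\1_A : R -> R).
Proof.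
move=> mA; split; first exact: measurable_indic.
by exists 1 => x; rewrite indicE; case: (_ \in _); rewrite ?normr1 ?normr0.
Qed.

Definition mass (A : set (measurableTypeR R)) n : R :=
  integ (fun x => s n x * \1_A x).

(** These limits form a finite measure, bounded by L times [leb a b]; its Radon-Nikodym density is
    the weak limit of the sequence. *)
Definition mass_lim A : R := ulim U (mass A).

Definition mass_measure A : \bar R := (mass_lim A)%:E.

Lemma mass_le (A : set (measurableTypeR R)) n : measurable A ->
  0 <= mass A n <= L * fine (leb a b A).
Proof.
move=> mA; have bA := indic_bmeas mA; have bs := sb n.
rewrite integ_ge0/=; last first.
  by move=> x; have /andP[h _] := s_bound n x; rewrite mulr_ge0.
rewrite -integ_indic// -integZ; last by bm.
apply: integ_le; [by bm..|] => x.
by have /andP[_ h] := s_bound n x; rewrite ler_wpM2r.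
Qed.

Lemma mass_bounded (A : set (measurableTypeR R)) : measurable A ->
  forall n, `|mass A n| <= L * fine (leb a b A).
Proof. by move=> mA n; have /andP[h1 h2] := mass_le n mA; rewrite ger0_norm. Qed.

Lemma mass_cvg (A : set (measurableTypeR R)) : measurable A ->
  mass A n @[n --> U] --> mass_lim A.
Proof. by move=> mA; apply: ulim_cvg; exact: mass_bounded. Qed.

Lemma mass_lim_le (A : set (measurableTypeR R)) : measurable A ->
  mass_lim A <= L * fine (leb a b A).
Proof.
move=> mA; apply: (cvgr_to_le (mass_cvg mA)).
by apply: nearW => n; have /andP[] := mass_le n mA.
Qed.

Lemma mass_limU (A B : set (measurableTypeR R)) : measurable A -> measurable B ->
  A `&` B = set0 -> mass_lim (A `|` B) = mass_lim A + mass_lim B.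
Proof.
move=> mA mB AB0.
have mAB : measurable (A `|` B) by exact: measurableU.
have E n : mass (A `|` B) n = mass A n + mass B n.
  have bA := indic_bmeas mA; have bB := indic_bmeas mB; have bs := sb n.
  rewrite -integD; [|by bm..].
  apply: integ_eq => x; rewrite -mulrDr; congr (_ * _).
  rewrite !indicE in_setU.
  case: (boolP (x \in A)) => [/set_mem xA|_]; rewrite ?add0r//=.
  case: (boolP (x \in B)) => [/set_mem xB|_]; rewrite ?addr0//=.
  by have : (A `&` B) x by []; rewrite AB0.
have h1 := mass_cvg mAB.
have h2 : mass A n + mass B n @[n --> U] --> mass_lim A + mass_lim B.
  by apply: cvgD; exact: mass_cvg.
rewrite -(cvg_lim (@Rhausdorff R) h1) -(cvg_lim (@Rhausdorff R) h2).
by congr (lim (_ @ U)); apply/funext => n; rewrite E.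
Qed.

Lemma mass_measure0 : mass_measure set0 = 0%E.
Proof.
rewrite /mass_measure; congr EFin; apply/eqP; rewrite eq_le ulim_ge0 ?andbT.
  by apply: (le_trans (mass_lim_le measurable0)); rewrite measure0 mulr0.
move=> n; apply: integ_ge0 => x; rewrite mulr_ge0//.
by have /andP[] := s_bound n x.
Qed.

Lemma mass_measure_ge0 A : (0 <= mass_measure A)%E.
Proof.
rewrite lee_fin; apply: ulim_ge0 => n; apply: integ_ge0 => x; rewrite mulr_ge0//.
by have /andP[] := s_bound n x.
Qed.

(** Finite additivity passes to the limit, and the tail left after n sets has mass at most L times
    its Lebesgue measure, which tends to 0. *)
Lemma mass_measure_sigma_additive : semi_sigma_additive mass_measure.
Proof.
move=> F mF tF mUF.
pose V n := \big[setU/set0]_(i < n) F i.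
have mV n : measurable (V n) by exact: bigsetU_measurable.
have VS n : V n.+1 = V n `|` F n by rewrite /V big_ord_recr.
have VF n : V n `&` F n = set0.
  by apply: (@trivIset_bigsetUI _ predT) => //; rewrite /predT /= trueE.
have sumE n : (\sum_(0 <= i < n) mass_measure (F i))%E = (mass_lim (V n))%:E.
  elim: n => [|n IH]; first by rewrite big_geq// /V big_ord0; exact: esym mass_measure0.
  by rewrite big_nat_recr//= IH VS mass_limU// EFinD.
have sumL n : (\sum_(0 <= i < n) leb a b (F i))%E = leb a b (V n).
  elim: n => [|n IH]; first by rewrite big_geq// /V big_ord0 measure0.
  by rewrite big_nat_recr//= IH VS measureU.
set W := \bigcup_k F k.
have Vsub n : V n `<=` W by exact: bigsetU_bigcup.
have lebcvg : fine (leb a b (V n)) @[n --> \oo] --> fine (leb a b W).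
  apply/fine_cvg; rewrite fineK; last exact: leb_fin.
  have := @measure_semi_sigma_additive _ _ _ (leb a b) F mF tF mUF.
  by under eq_fun do rewrite sumL.
have mWV n : measurable (W `\` V n) by exact: measurableD.
have lebD n : fine (leb a b (W `\` V n)) = fine (leb a b W) - fine (leb a b (V n)).
  have : leb a b W = (leb a b (V n) + leb a b (W `\` V n))%E.
    rewrite -measureU//; first by rewrite setDUK.
    by rewrite setDIK.
  by move=> ->; rewrite fineD ?leb_fin// addrC addKr.
under eq_fun do rewrite sumE.
apply: cvg_EFin; first by apply: nearW.
rewrite /comp /=; apply/cvgrPdist_le => /= e e0.
have e1 : 0 < e / (L + 1) by rewrite divr_gt0// ltr_wpDl.
move/cvgrPdist_le : lebcvg => /(_ _ e1); apply: filterS => n /=.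
rewrite -lebD => hn.
have -> : W = V n `|` (W `\` V n) by rewrite setDUK.
rewrite mass_limU ?setDIK// addrC addKr.
rewrite ger0_norm; last first.
  by rewrite -lee_fin; exact: mass_measure_ge0.
apply: (le_trans (mass_lim_le (mWV n))).
apply: (le_trans (ler_wpM2l L0 (le_trans (ler_norm _) hn))).
by rewrite mulrCA ler_piMr ?(ltW e0)// ler_pdivrMr ?ltr_wpDl// mul1r lerDl.
Qed.

HB.instance Definition _ := isMeasure.Build _ _ _ mass_measure
  mass_measure0 mass_measure_ge0 mass_measure_sigma_additive.

Lemma mass_measure_fin : fin_num_fun mass_measure.
Proof. by []. Qed.

HB.instance Definition _ := Measure_isFinite.Build _ _ _ mass_measure
  mass_measure_fin.

Lemma mass_measure_dominated : mass_measure `<< leb a b.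
Proof.
apply/null_content_dominatesP => A mA A0.
apply/eqP; rewrite eq_le measure_ge0 andbT lee_fin.
by apply: (le_trans (mass_lim_le mA)); rewrite A0 mulr0.
Qed.

Lemma mass_lim_density : exists2 w0 : R -> R, itg a b w0 &
  forall A : set (measurableTypeR R), measurable A ->
    mass_lim A = integ (fun x => w0 x * \1_A x).
Proof.
have [f [f0 ffin fint fE]] := @radon_nikodym_sigma_finite _ _ _ (lebf a b)
  mass_measure mass_measure_dominated.
have fK : EFin \o (fine \o f) = f by apply/funext => x /=; rewrite fineK.
exists (fine \o f); first by rewrite /itg fK.
move=> A mA; have := fE A mA.
rewrite integral_mkcond => E.
have iA : itg a b (fun x => (fine \o f) x * \1_A x).
  have ig : itg a b (fine \o f) by rewrite /itg fK.
  have := itgM (indic_bmeas mA) ig.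
  by apply: eq_integrable => // x _ /=; rewrite mulrC.
apply: EFin_inj; rewrite -integ_EFin// -/(mass_measure A) E.
apply: eq_integral => x _; rewrite patchE indicE.
by case: (x \in A); rewrite ?mulr1 ?mulr0 //= fineK.
Qed.

Lemma prim_indic_itv (w : R -> R) x y : itg a b w -> x <= y ->
  prim a b w y - prim a b w x = integ (fun t => w t * \1_(`]x, y]) t).
Proof.
move=> iw xy; rewrite prim_sub//; apply: integ_eq => t; congr (_ * _).
by rewrite indicE mem_setE/= in_itv.
Qed.

Lemma mass_lim_itv_le x h : 0 < h -> 0 <= mass_lim `]x, x + h] <= L * h.
Proof.
move=> h0; apply/andP; split; first by rewrite -lee_fin; exact: mass_measure_ge0.
apply: (le_trans (mass_lim_le (measurable_itv _))).
rewrite ler_wpM2l// -integ_indic; last exact: measurable_itv.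
have -> : \1_`]x, x + h] = (fun t => (x < t <= x + h)%R%:R : R).
  by apply/funext => t; rewrite indicE mem_setE/= in_itv.
apply: (le_trans (integ_itv a b (ltW _))); first by rewrite ltrDl.
by rewrite addrAC subrr add0r.
Qed.

Theorem weak_limit_density : exists w : R -> R,
  [/\ bmeas w, (forall x, 0 <= w x <= L) &
    forall A : set (measurableTypeR R), measurable A ->
      mass A n @[n --> U] --> integ (fun x => w x * \1_A x)].
Proof.
have [w0 iw0 w0E] := mass_lim_density.
have mw0 := itg_meas iw0.
(* Truncation makes the bounds hold at every point. It changes nothing almost everywhere, because
   the difference quotients of [prim a b w0] are limits of averages of the s n and lie in [0, L]. *)
pose w x := Num.max 0 (Num.min (w0 x) L).
have wb x : 0 <= w x <= L.
  by rewrite /w le_max lexx/= ge_max L0 ge_min lexx orbT.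
have mw : measurable_fun setT w.
  apply: measurable_maxr; first exact: measurable_cst.
  by apply: measurable_minr => //; exact: measurable_cst.
have bw : bmeas w.
  by split => //; exists L => x; have /andP[h1 h2] := wb x; rewrite ger0_norm.
exists w; split => // A mA; have bA := indic_bmeas mA.
have -> : integ (fun x => w x * \1_A x) = mass_lim A; last exact: mass_cvg.
rewrite w0E//; apply: integ_ae.
- by apply: measurable_funM => //; case: bA.
- by apply: measurable_funM => //; case: bA.
- apply: filterS (prim_derivable iw0) => x [dx dE]; congr (_ * _).
  have : 0 <= derive1 (prim a b w0) x <= L.
    apply: (derive1_itv (e := 1)) => // h /andP[h0 _].
    rewrite prim_indic_itv//; last by rewrite lerDl ltW.
    by rewrite -w0E// mul0r; exact: mass_lim_itv_le.
  by rewrite dE /w => /andP[h1 h2]; rewrite min_l// max_r.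
Qed.

End weak_limit.

Lemma integ_indic_itv (R : realType) (a b x y : R) : a <= x -> x <= y -> y < b ->
  integ a b \1_`]x, y] = y - x.
Proof.
move=> ax xy yb; rewrite integ_indic; last exact: measurable_itv.
rewrite /leb /= /mrestr setIidl; last first.
  move=> t /=; rewrite !in_itv/= => /andP[xt ty].
  by rewrite (le_lt_trans ax xt) (le_lt_trans ty yb).
rewrite lebesgue_measure_itv/= lte_fin.
by move: xy; rewrite le_eqVlt => /orP[/eqP ->|->//]; rewrite ltxx subrr.
Qed.

(** * Compactness of almost critical sequences *)

Section limit.
Context (R : realType) (a b : R) (hab : a < b).
Variables (p q : R -> R) (p0 P Q lam : R).
Hypothesis coef : coefficients p q p0 P Q.
Hypothesis lam0 : 0 <= lam.
Context (U : set_system nat) (UU : UltraFilter U).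
Variables (f_ G_ g_ : nat -> R -> R) (ell_ : nat -> R) (S0 L : R).
Hypothesis nl_ : forall n, nonlinearity (f_ n) (G_ n) (ell_ n).
Hypothesis g_bmeas : forall n, bmeas (g_ n).
Hypothesis prim_g_bound : forall n x, `|prim a b (g_ n) x| <= S0.
Hypothesis f_bound : forall n t, `|t| <= S0 -> 0 <= f_ n t <= L.
Hypothesis resnorm_cvg :
  resnorm a b p q lam (f_ n) (g_ n) @[n --> U] --> (0 : R).
Local Notation integ := (integ a b).
Local Notation prim := (prim a b).
Local Notation coprim := (coprim a b).
Local Notation sqn := (sqn a b).

Let ba0 : 0 < b - a. Proof. by rewrite subr_gt0. Qed.
Let p0_gt0 := coef_p0_gt0 coef.
Let p_bound := coef_p_bound coef.
Let q_bound := coef_q_bound coef.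
Let p_pos x : 0 < p x.
Proof. by have /andP[h _] := p_bound x; exact: lt_le_trans h. Qed.
Let S00 : 0 <= S0.
Proof. exact: le_trans (prim_g_bound 0%N 0). Qed.
Let L0 : 0 <= L.
Proof. have /andP[h1 h2] := f_bound 0%N (t := 0) ltac:(by rewrite normr0); exact: le_trans h2. Qed.

Let s n x : R := f_ n (prim (g_ n) x).
Let sb n : bmeas (s n).
Proof. by apply: (nl_f_bmeas (nl_ n)); exact: bmeas_prim. Qed.
Let s_bound n x : 0 <= s n x <= L. Proof. exact: f_bound. Qed.

Ltac bm_leaf ::= first [exact: (p_bmeas coef) | exact: (q_bmeas coef) |
  exact: (invp_bmeas coef) | exact: g_bmeas | exact: sb].

Let k n x : R := lam * s n x - q x * prim (g_ n) x.
Let kb n : bmeas (k n). Proof. by rewrite /k; bm. Qed.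
Ltac bm_leaf ::= first [exact: (p_bmeas coef) | exact: (q_bmeas coef) |
  exact: (invp_bmeas coef) | exact: g_bmeas | exact: sb | exact: kb].

(** The residual is [p g_n - y n]. As integrals of functions bounded by [Kb], the y n are
    equi-Lipschitz, and this is the source of compactness. *)
Let y n := coprim (k n).
Let Kb : R := lam * L + Q * S0.
Let Kb0 : 0 <= Kb.
Proof. by rewrite addr_ge0 ?mulr_ge0// (Q_ge0 coef). Qed.

Let k_bound n x : `|k n x| <= Kb.
Proof.
have /andP[s1 s2] := s_bound n x; have /andP[q1 q2] := q_bound x.
apply: (le_trans (ler_normB _ _)); rewrite !normrM (ger0_norm lam0) (ger0_norm q1).
by rewrite (ger0_norm s1) lerD// ?ler_wpM2l// ler_pM.
Qed.

Let y_bound n x : `|y n x| <= Kb * (b - a).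
Proof. exact: coprim_sup. Qed.

Let y_lip n x x' : `|y n x - y n x'| <= Kb * `|x - x'|.
Proof. by apply: coprim_lipschitz; [case: (kb n)|exact: k_bound]. Qed.

Let ylim x : R := ulim U (y ^~ x).

Let y_cvg x : y n x @[n --> U] --> ylim x.
Proof. by apply: ulim_cvg => n; exact: y_bound. Qed.

Let ylim_lip x x' : `|ylim x - ylim x'| <= Kb * `|x - x'|.
Proof.
have h : `|y n x - y n x'| @[n --> U] --> `|ylim x - ylim x'|.
  by apply: cvg_norm; apply: cvgB; exact: y_cvg.
by apply: (cvgr_to_le h); apply: nearW => n; exact: y_lip.
Qed.

Let ylim_bmeas : bmeas ylim.
Proof.
split.
  apply: continuous_measurable_fun => x; apply/cvgrPdist_le => /= e e0.
  exists (e / (Kb + 1)); first by rewrite /= divr_gt0// ltr_wpDl.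
  move=> z /=; rewrite ltr_pdivlMr ?ltr_wpDl// => xz.
  apply: (le_trans (ylim_lip x z)).
  have := normr_ge0 (x - z); have := Kb0; nra.
exists (Kb * (b - a)) => x.
have h : `|y n x| @[n --> U] --> `|ylim x| by apply: cvg_norm; exact: y_cvg.
by apply: (cvgr_to_le h); apply: nearW => n; exact: y_bound.
Qed.

Let y_left n x : x <= a -> y n x = y n a.
Proof.
by move=> xa; rewrite /y /coprim_def !prim_left//; bm.
Qed.

Let y_right n x : b <= x -> y n x = y n b.
Proof.
have y0 z : b <= z -> y n z = 0.
  move=> bz; rewrite /y coprim_gt; last by bm.
  have bz0 := bmeas_cst (0 : R).
  rewrite -[RHS](mul0r (b - a)) -(integ_cst 0 (ltW hab)).
  apply: integ_ae.
  - by apply: measurable_funM; [case: (kb n)|case: (lt_indic_bmeas z)].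
  - by case: bz0.
  - apply: filterS (ae_leb_itv a b) => t; rewrite in_itv/= => /andP[_ tb].
    by rewrite ltNge (le_trans (ltW tb) bz) mulr0.
by move=> bx; rewrite !y0.
Qed.

(** Arzela-Ascoli along the ultrafilter: convergence holds simultaneously at the finitely many
    points of a net, and the common Lipschitz constant carries it to [a, b]. Outside, the functions
    are constant on each side. *)
Let y_unif e : 0 < e -> \forall n \near U, forall x, `|y n x - ylim x| <= e.
Proof.
move=> e0; have e30 : 0 < e / 3 by rewrite divr_gt0.
pose N := (Num.truncn (Kb * (b - a) / (e / 3))).+1.
have N0 : (0 : R) < N%:R by rewrite ltr0n.
have Nbig : Kb * ((b - a) / N%:R) <= e / 3.
  rewrite mulrA ler_pdivrMr// [leRHS]mulrC -ler_pdivrMr//; apply: ltW.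
  exact: truncnS_gt.
pose z (i : 'I_N.+1) : R := a + i%:R * ((b - a) / N%:R).
have net x : a <= x <= b -> exists i, `|x - z i| <= (b - a) / N%:R.
  move=> /andP[ax xb].
  pose m := Num.truncn ((x - a) / ((b - a) / N%:R)).
  have bN0 : 0 < (b - a) / N%:R by rewrite divr_gt0.
  have d0 : 0 <= (x - a) / ((b - a) / N%:R) by rewrite divr_ge0 ?subr_ge0// ltW.
  have /andP[m1 m2] := truncn_itv d0.
  have mN : (m < N.+1)%N.
    rewrite ltnS -(ler_nat R); apply: (le_trans m1).
    rewrite ler_pdivrMr// mulrCA divff ?mulr1 ?gt_eqF//; lra.
  exists (Ordinal mN); rewrite /z /=.
  move: m1 m2; rewrite -/m ler_pdivlMr// ltr_pdivrMr// -natr1 => m1 m2.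
  by rewrite ler_norml; apply/andP; split; lra.
have : \forall n \near U, forall i, `|y n (z i) - ylim (z i)| <= e / 3.
  apply: filter_forall => i.
  have /cvgrPdist_le/(_ _ e30) := @y_cvg (z i).
  by apply: filterS => n; rewrite distrC.
apply: filterS => n hn.
have inside x : a <= x <= b -> `|y n x - ylim x| <= e.
  move=> /net[i xi].
  have -> : y n x - ylim x = (y n x - y n (z i)) + (y n (z i) - ylim (z i))
      + (ylim (z i) - ylim x) by ring.
  have h1 : `|y n x - y n (z i)| <= e / 3.
    by apply: (le_trans (y_lip n _ _)); apply: le_trans Nbig; rewrite ler_wpM2l.
  have h2 : `|ylim (z i) - ylim x| <= e / 3.
    apply: (le_trans (ylim_lip _ _)); apply: le_trans Nbig; rewrite ler_wpM2l//.
    by rewrite distrC.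
  apply: (le_trans (ler_normD _ _)); apply: (le_trans (lerD (ler_normD _ _) h2)).
  by have := hn i; lra.
have ylim_ext x x' : (forall n, y n x = y n x') -> ylim x = ylim x'.
  by move=> E; rewrite /ylim; congr ulim; apply/funext => m; exact: E.
move=> x; case: (leP x a) => [xa|ax].
  rewrite y_left// (ylim_ext x a); last by move=> m; exact: y_left.
  by apply: inside; rewrite lexx ltW.
case: (leP x b) => [xb|bx]; first by apply: inside; rewrite (ltW ax).
rewrite y_right ?(ltW bx)// (ylim_ext x b); last by move=> m; apply: y_right; exact: ltW.
by apply: inside; rewrite lexx ltW.
Qed.

Let g x : R := ylim x * (p x)^-1.
Let gb : bmeas g.
Proof. exact: (bmeasM ylim_bmeas (invp_bmeas coef)). Qed.

(** [g_n - g] is [(residual + (y n - ylim)) / p], where the first summand tends to 0 in L^2 by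
    [resnorm_cvg] and the second uniformly; [D] and [C] collect the factors of the two
    contributions. *)
Let sqn_cvg e : 0 < e -> \forall n \near U, sqn (fun x => g_ n x - g x) <= e.
Proof.
move=> e0.
pose C := 2 * (b - a) / p0 ^+ 2; pose D := 2 / p0.
have C0 : 0 < C by apply: divr_gt0; [exact: mulr_gt0|exact: exprn_gt0].
have D0 : 0 < D by apply: divr_gt0.
pose e1 := Num.min 1 (e / 2 / C).
have e10 : 0 < e1 by rewrite lt_min ltr01; apply: divr_gt0 => //; exact: divr_gt0.
have e1C : C * e1 ^+ 2 <= e / 2.
  have h : e1 ^+ 2 <= e1.
    by rewrite expr2 ler_piMr ?(ltW e10)// ge_min lexx.
  apply: (@le_trans _ _ (C * e1)); first by rewrite ler_wpM2l ?(ltW C0).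
  by rewrite mulrC -ler_pdivlMr// ge_min lexx orbT.
have r0 : 0 < e / 2 / D by apply: divr_gt0 => //; exact: divr_gt0.
move/cvgrPdist_le : resnorm_cvg => /(_ _ r0).
apply: filterS2 (y_unif e10) => n yn; rewrite sub0r normrN => rn.
have {}rn : resnorm a b p q lam (f_ n) (g_ n) <= e / 2 / D.
  exact: le_trans (ler_norm _) rn.
set r := residual a b p q lam (f_ n) (g_ n).
have br : bmeas r by exact: (residual_bmeas _ _ _ coef (nl_ n) (g_bmeas n)).
have bsrc : bmeas (source a b q lam (f_ n) (g_ n)).
  exact: (source_bmeas _ _ _ coef (nl_ n) (g_bmeas n)).
have rE x : r x = p x * g_ n x - y n x.
  rewrite /r /residual /y; congr (_ + _).
  have -> : k n = (fun x => (-1) * source a b q lam (f_ n) (g_ n) x).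
    by apply/funext => t; rewrite /k /source mulN1r opprB.
  rewrite /coprim_def primZ; last by bm.
  rewrite integZ; last by bm.
  by rewrite !mulN1r opprD !opprK.
pose A x := 2 * p0^-1 * (r x ^+ 2 * (p x)^-1).
have bA : bmeas A by rewrite /A; bm.
have bgn := g_bmeas n.
have bg := gb.
apply: (@le_trans _ _ (integ (fun x => A x + 2 * e1 ^+ 2 / p0 ^+ 2))).
  apply: integ_le; [by bm..|] => x.
  have pp := p_pos x; have ip : (p x)^-1 <= p0^-1.
    by rewrite lef_pV2 ?posrE//; have /andP[] := p_bound x.
  have ip0 : 0 < (p x)^-1 by rewrite invr_gt0.
  have -> : g_ n x - g x = (p x)^-1 * (r x + (y n x - ylim x)).
    by rewrite rE /g; field; exact: lt0r_neq0.
  have d2 : (y n x - ylim x) ^+ 2 <= e1 ^+ 2.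
    rewrite -real_normK ?num_real// lerXn2r ?nnegrE// ltW//.
  rewrite /A exprMn.
  move: (r x) (y n x - ylim x) d2 => rx d d2.
  have h1 : (rx + d) ^+ 2 <= 2 * rx ^+ 2 + 2 * d ^+ 2.
    by have := sqr_ge0 (rx - d); rewrite !expr2; lra.
  have h2 : (p x)^-1 ^+ 2 <= p0^-1 ^+ 2 by rewrite lerXn2r ?nnegrE// ltW// invr_gt0.
  have h3 : (p x)^-1 ^+ 2 <= p0^-1 * (p x)^-1 by rewrite expr2 ler_wpM2r// ltW.
  apply: (le_trans (ler_wpM2l (sqr_ge0 _) h1)); rewrite mulrDr; apply: lerD.
    have -> : 2 * p0^-1 * (rx ^+ 2 * (p x)^-1) = p0^-1 * (p x)^-1 * (2 * rx ^+ 2) by ring.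
    by rewrite ler_wpM2r// mulr_ge0// sqr_ge0.
  rewrite [leRHS]mulrC -exprVn; apply: ler_pM => //; first exact: sqr_ge0.
    by rewrite mulr_ge0// sqr_ge0.
  by rewrite ler_wpM2l.
rewrite integD; [|by bm..]; rewrite integ_cst; last exact: ltW.
have -> : integ A = D * resnorm a b p q lam (f_ n) (g_ n).
  by rewrite /A integZ//; bm.
have -> : 2 * e1 ^+ 2 / p0 ^+ 2 * (b - a) = C * e1 ^+ 2 by rewrite /C; ring.
have := ler_wpM2l (ltW D0) rn.
have -> : D * (e / 2 / D) = e / 2 by field; exact: lt0r_neq0.
move: (D * _) e1C => X; lra.
Qed.

Let u := prim g.

Let u_unif e : 0 < e -> \forall n \near U, forall x, `|prim (g_ n) x - u x| <= e.
Proof.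
move=> e0.
have e2 : 0 < e ^+ 2 / (b - a) by rewrite divr_gt0// exprn_gt0.
apply: filterS (sqn_cvg e2) => n hn x.
have bgn := g_bmeas n; have bg := gb.
have bd : bmeas (fun x => g_ n x - g x) by bm.
rewrite -(ler_pXn2r (ltn0Sn 1)) ?nnegrE ?(ltW e0)//.
rewrite real_normK ?num_real// -primB; [|by bm..].
apply: (le_trans (prim_sqr_le hab x bd)).
by rewrite mulrC -ler_pdivlMr.
Qed.

Variable F : R -> set R.
(** The form in which convexity and upper semicontinuity of [F] enter: a value outside [F t] is
    separated from all f_n(t'), t' near t and n large, by a fixed interval. *)
Hypothesis separation : forall t v, ~ F t v -> exists al be,
  (v < al \/ be < v) /\ exists2 dl, 0 < dl & exists N, forall n, (N <= n)%N ->
    forall t', `|t' - t| < dl -> al <= f_ n t' <= be.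
Hypothesis U_oo : forall N, \forall n \near U, (N <= n)%N.

Theorem approximate_limit : exists g w : R -> R,
  [/\ bmeas g, bmeas w,
    forall x, p x * g x = coprim (fun t => lam * w t - q t * prim g t) x,
    \forall x \ae leb a b, F (prim g x) (w x) &
    forall e, 0 < e -> \forall n \near U, sqn (fun x => g_ n x - g x) <= e].
Proof.
have sm n : measurable_fun setT (s n) by case: (sb n).
have [w [bw wb wlim]] := weak_limit_density a b UU sm s_bound.
have bg := gb; have bu : bmeas u by exact: bmeas_prim.
exists g, w; split => //.
- move=> x.
  have -> : p x * g x = ylim x by rewrite /g mulrCA divff ?mulr1// gt_eqF.
  have e1 : coprim (fun t => lam * w t - q t * prim g t) x =
      lam * coprim w x - coprim (fun t => q t * u t) x.
    rewrite /coprim_def primB; [|by bm..].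
    rewrite primZ; last by bm.
    rewrite integB; [|by bm..].
    rewrite integZ; last by bm.
    move: (integ w) (integ _) (prim w x) (prim _ x) => i1 i2 i3 i4.
    by ring.
  have e2 n : y n x = lam * coprim (s n) x - coprim (fun t => q t * prim (g_ n) t) x.
    rewrite /y /k /coprim_def primB; [|by bm..].
    rewrite primZ; last by bm.
    rewrite integB; [|by bm..].
    rewrite integZ; last by bm.
    move: (integ (s n)) (integ _) (prim (s n) x) (prim _ x) => i1 i2 i3 i4.
    by ring.
  (* Weak convergence of [s n], tested on the half-line beyond x. *)
  have c1 : coprim (s n) x @[n --> U] --> coprim w x.
    have h := wlim `]x, +oo[%classic (measurable_itv _).
    have E v : bmeas v -> coprim v x = integ (fun t => v t * \1_(`]x, +oo[) t).
      move=> bv; rewrite coprim_gt; last by bm.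
      by apply: integ_eq => t; rewrite indicE mem_setE/= in_itv/= andbT.
    rewrite E//.
    by have -> : (fun n => coprim (s n) x) = mass a b s `]x, +oo[%classic;
      [apply/funext => n; exact: E|exact: h].
  have c2 : coprim (fun t => q t * prim (g_ n) t) x @[n --> U] -->
      coprim (fun t => q t * u t) x.
    apply/cvgrPdist_le => e e0.
    have Qb : 0 <= Q * (b - a) by rewrite mulr_ge0 ?(Q_ge0 coef)// ltW.
    have Qb1 : 0 < Q * (b - a) + 1 by rewrite ltr_wpDl.
    have e3 : 0 < e / (Q * (b - a) + 1) by rewrite divr_gt0.
    apply: filterS (u_unif e3) => n hn.
    have -> : coprim (fun t => q t * u t) x - coprim (fun t => q t * prim (g_ n) t) x =
        coprim (fun t => q t * u t - q t * prim (g_ n) t) x.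
      rewrite /coprim_def primB; [|by bm..].
      rewrite integB; [|by bm..].
      move: (integ _) (integ _) (prim _ x) (prim _ x) => i1 i2 i3 i4.
      by ring.
    apply: (@le_trans _ _ (Q * (e / (Q * (b - a) + 1)) * (b - a))).
      apply: coprim_sup => //; first by bm.
      move=> t; rewrite -mulrBr normrM distrC.
      have /andP[q1 q2] := q_bound t; rewrite (ger0_norm q1).
      by rewrite ler_pM.
    have -> : Q * (e / (Q * (b - a) + 1)) * (b - a) = e * (Q * (b - a) / (Q * (b - a) + 1)).
      by field; rewrite gt_eqF.
    by rewrite ler_piMr ?(ltW e0)// ler_pdivrMr// mul1r lerDl.
  have c3 : y n x @[n --> U] --> lam * coprim w x - coprim (fun t => q t * u t) x.
    have -> : (fun n => y n x) = (fun n => lam * coprim (s n) x -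
        coprim (fun t => q t * prim (g_ n) t) x) by apply/funext => n; exact: e2.
    by apply: cvgB => //; apply: cvgMr; exact: c1.
  rewrite e1 -(cvg_lim (@Rhausdorff R) c3).
  by rewrite -(cvg_lim (@Rhausdorff R) (@y_cvg x)).
- have iw := bmeas_itg a b bw.
  apply: filterS2 (prim_derivable iw) (ae_leb_itv a b) => x [dx dE].
  rewrite in_itv/= => /andP[ax xb].
  (* If [w x] were outside F(u(x)), then [s n t] would lie in [al, be] for t near x and n large. The
     averages of [w] over []x, x + h]] would lie there too, and at a point of differentiation so
     would [w x]. *)
  apply: contrapT => /separation[al [be [out [dl dl0 [N sep]]]]].
  have [mg [M gM]] := bg.
  have M0 : 0 <= M by exact: le_trans (gM 0).
  have M1 : 0 < M + 1 by rewrite ltr_wpDl.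
  have d20 : 0 < dl / 2 by rewrite divr_gt0.
  (* For h < e, the point x + h stays below b and u varies by less than dl / 2 on [x, x + h], as M
     bounds its derivative. The uniform distance dl / 4 between u_n and u still fits into dl. *)
  pose e := Num.min (b - x) (dl / 2 / (M + 1)).
  have e0 : 0 < e by rewrite lt_min subr_gt0 xb divr_gt0.
  suff : al <= w x <= be by case: out => h; rewrite leNgt ?[w x <= be]leNgt h ?andbF.
  rewrite -dE; apply: (derive1_itv e0 dx) => h /andP[h0].
  rewrite lt_min ltr_pdivlMr// => /andP[hb hM].
  have xh : x <= x + h by rewrite lerDl ltW.
  have xhb : x + h < b by rewrite addrC -ltrBrDr.
  rewrite prim_indic_itv//.
  have bI := @indic_bmeas R `]x, x + h]%classic (measurable_itv _).
  have near_n : \forall n \near U,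
      al * h <= integ (fun t => s n t * \1_`]x, x + h] t) <= be * h.
    apply: filterS2 (U_oo N) (u_unif (divr_gt0 d20 (ltr0Sn R 1))) => n Nn un.
    have range t : x < t <= x + h -> al <= s n t <= be.
      move=> /andP[xt txh]; apply: sep => //.
      have -> : prim (g_ n) t - prim g x = (prim (g_ n) t - u t) + (u t - u x) by rewrite /u; ring.
      apply: (le_lt_trans (ler_normD _ _)).
      have := prim_lipschitz a b t x mg gM; rewrite -/u => lip.
      have tx : `|t - x| <= h by rewrite ger0_norm ?subr_ge0 ?(ltW xt)// lerBlDl.
      have := ler_wpM2l M0 tx; have := un t; move: lip.
      move: `|u t - u x| `|prim (g_ n) t - u t| => A B.
      have := normr_ge0 (t - x); nra.
    rewrite -[X in al * X](_ : integ \1_`]x, x + h] = h); last first.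
      by rewrite integ_indic_itv ?(ltW ax)// addrC addKr.
    rewrite -[X in be * X](_ : integ \1_`]x, x + h] = h); last first.
      by rewrite integ_indic_itv ?(ltW ax)// addrC addKr.
    have bIt : bmeas (fun t : R => \1_`]x, x + h] t : R) by exact: bI.
    rewrite -!integZ; [|by apply: bmeas_itg..].
    apply/andP; split; apply: integ_le; [by bm|by bm| |by bm|by bm|];
      move=> t; rewrite indicE mem_setE/= in_itv/=;
      by case: (boolP (x < t <= x + h)) => [/range/andP[h1 h2]|_];
        rewrite ?mulr1 ?mulr0.
  have hw := wlim `]x, x + h]%classic (measurable_itv _).
  apply/andP; split.
  - by apply: (cvgr_to_ge hw); apply: filterS near_n => n /andP[].
  - by apply: (cvgr_to_le hw); apply: filterS near_n => n /andP[].
Qed.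

End limit.

(** * Lipschitz regularization of the minimal selection *)

Section usc_compact_convex.
Context (R : realType) (F : R -> set R).
Hypothesis usc : upper_semicontinuous F.
Hypothesis F_ne : forall t, F t !=set0.
Hypothesis F_compact : forall t, compact (F t).
Hypothesis F_convex : forall t, convex_set (F t : set R^o).
Hypothesis min_ge0 : forall t, 0 <= set_min (F t).
Local Notation m t := (set_min (F t)).

Lemma set_minP t : F t (m t) /\ forall v, F t v -> m t <= v.
Proof.
have [c cF cmin] := @compact_EVT_min _ R id (F t) (F_ne t) (@F_compact t)
  (continuous_subspaceT (fun x => cvg_id)).
rewrite /set_min; case: xgetP => [x _ [Fx lx] //|/(_ c) []].
by split; [exact: set_mem|move=> v Fv; apply: cmin; exact: mem_set].
Qed.

Lemma set_maxP t : exists2 M, F t M & forall v, F t v -> v <= M.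
Proof.
have [c cF cmax] := @compact_EVT_max _ R id (F t) (F_ne t) (@F_compact t)
  (continuous_subspaceT (fun x => cvg_id)).
by exists c; [exact: set_mem|move=> v Fv; apply: cmax; exact: mem_set].
Qed.

Lemma convex_between t x y v : F t x -> F t y -> x <= v <= y -> F t v.
Proof.
move=> Fx Fy /andP[xv vy].
have [xy|yx] := ltP x y; last first.
  by have -> : v = x by apply/eqP; rewrite eq_le xv (le_trans vy yx).
have d0 : 0 < y - x by rewrite subr_gt0.
pose l : R := (y - v) / (y - x).
have l0 : 0 <= l by rewrite divr_ge0 ?subr_ge0// ltW.
have l1 : l <= 1 by rewrite ler_pdivrMr// mul1r lerD2l lerN2.
have := @F_convex t x y (Itv01 l0 l1) (mem_set Fx) (mem_set Fy).
move/set_mem; congr (F t _); transitivity (l * x + (1 - l) * y); first by [].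
by rewrite /l; field; rewrite gt_eqF.
Qed.

Lemma usc_near t al be : (forall v, F t v -> al < v < be) ->
  exists2 dl, 0 < dl & forall t', `|t' - t| < dl -> al < m t' < be.
Proof.
move=> h; have := usc (itv_open al be).
rewrite openE => /(_ t); have Ft : F t `<=` `]al, be[.
  by move=> v /h; rewrite /= in_itv.
move=> /(_ Ft) [dl /= dl0 H]; exists dl => // t' tt'.
have := H t'; rewrite /ball_/= distrC => /(_ tt') H'.
by have := H' _ (set_minP t').1; rewrite /= in_itv.
Qed.

Lemma set_min_lsc t y : y < m t ->
  exists2 dl, 0 < dl & forall t', `|t' - t| < dl -> y < m t'.
Proof.
move=> ym; have [M FM Mmax] := set_maxP t.
(* The open interval must contain all of [F t]; any upper end beyond its maximum serves. *)
have [|dl dl0 H] := @usc_near t y (M + 1).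
  move=> v Fv; rewrite (lt_le_trans ym ((set_minP t).2 v Fv))/=.
  by rewrite (le_lt_trans (Mmax v Fv))// ltrDl.
by exists dl => // t' /H /andP[].
Qed.

Lemma set_min_measurable : measurable_fun setT (fun t => m t).
Proof.
apply/measurable_EFinP; apply: lower_semicontinuous_measurable => t y.
rewrite lte_fin => /set_min_lsc[dl dl0 H].
exists (ball t dl); first exact: nbhsx_ballx.
by move=> t'; rewrite /ball/= /ball_ distrC => /H; rewrite lte_fin.
Qed.

(** The Pasch-Hausdorff envelope, that is, the inf-convolution of min F with n|.|: the largest
    n-Lipschitz function below min F. Lying below min F, it inherits the growth bound uniformly in
    n. *)
Definition yosida (n : nat) (t : R) : R :=
  inf (range (fun s => m s + n%:R * `|t - s|)).

Lemma yosida_has_inf n t : has_inf (range (fun s => m s + n%:R * `|t - s|)).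
Proof.
split; first by exists (m 0 + n%:R * `|t - 0|); exists 0.
by exists 0 => _ [s _ <-]; rewrite addr_ge0// mulr_ge0.
Qed.

Lemma yosida_le_at n t s : yosida n t <= m s + n%:R * `|t - s|.
Proof. by apply: ge_inf; [exact: (yosida_has_inf n t).2|exists s]. Qed.

Lemma yosida_ge n t y : (forall s, y <= m s + n%:R * `|t - s|) -> y <= yosida n t.
Proof.
move=> h; apply: lb_le_inf; first exact: (yosida_has_inf n t).1.
by move=> _ [s _ <-].
Qed.

Lemma yosida_le n t : yosida n t <= m t.
Proof. by have := yosida_le_at n t t; rewrite subrr normr0 mulr0 addr0. Qed.

Lemma yosida_ge0 n t : 0 <= yosida n t.
Proof. by apply: yosida_ge => s; rewrite addr_ge0// mulr_ge0. Qed.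

Lemma yosida_lipschitz n t t' : `|yosida n t - yosida n t'| <= n%:R * `|t - t'|.
Proof.
have h x x' : yosida n x - n%:R * `|x - x'| <= yosida n x'.
  apply: yosida_ge => s; rewrite lerBlDr -addrA -mulrDr.
  apply: (le_trans (yosida_le_at n x s)); rewrite lerD2l ler_wpM2l//.
  have -> : x - s = (x' - s) + (x - x') by ring.
  exact: ler_normD.
have h1 := h t t'; have h2 := h t' t; rewrite distrC in h2.
by rewrite ler_norml; apply/andP; split; lra.
Qed.

(* A competitor s with |t - s| >= dl costs at least n dl. *)
Lemma yosida_ge_near n t dl y : (forall s, `|t - s| < dl -> y <= m s) ->
  y <= n%:R * dl -> y <= yosida n t.
Proof.
move=> near far; apply: yosida_ge => s; case: (ltP `|t - s| dl) => h.
  by apply: (le_trans (near s h)); rewrite lerDl mulr_ge0.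
apply: (le_trans far); apply: (@le_trans _ _ (n%:R * `|t - s|)).
  by rewrite ler_wpM2l.
by rewrite lerDr.
Qed.

Lemma yosida_cvg t : yosida n t @[n --> \oo] --> m t.
Proof.
apply/cvgrPdist_le => /= e e0.
have [|dl dl0 H] := @set_min_lsc t (m t - e); first by rewrite ltrBlDr ltrDl.
pose N := (Num.truncn (m t / dl)).+1.
have Nb : m t < N%:R * dl by rewrite -ltr_pdivrMr//; exact: truncnS_gt.
exists N => // n /= Nn.
rewrite ger0_norm ?subr_ge0 ?yosida_le// lerBlDr addrC -lerBlDr.
apply: (@yosida_ge_near _ _ dl) => [s ts|].
  by apply/ltW/H; rewrite distrC.
have : N%:R * dl <= n%:R * dl by rewrite ler_wpM2r ?ler_nat // ltW.
lra.
Qed.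

(** Compactness and convexity make [F t] the segment from its minimum to M, so v lies strictly on
    one side of it. The bound facing v is taken halfway, the other with slack 1. Upper
    semicontinuity puts min F in []al, be[] near t; the upper bound passes to the envelope, which is
    smaller, and the lower one by [yosida_ge_near]. *)
Lemma yosida_separation t v : ~ F t v -> exists al be,
  (v < al \/ be < v) /\ exists2 dl, 0 < dl & exists N, forall n, (N <= n)%N ->
    forall t', `|t' - t| < dl -> al <= yosida n t' <= be.
Proof.
move=> nF; have [Fm mmin] := set_minP t; have [M FM Mmax] := set_maxP t.
suff [al [be [out bnd]]] : exists al be, (v < al \/ be < v) /\
    forall v', F t v' -> al < v' < be.
  exists al, be; split => //; have [dl dl0 H] := usc_near bnd.
  (* The other half of dl is reserved for the competitors s in the infimum, which then stay within
     dl of t. *)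
  exists (dl / 2); first by rewrite divr_gt0.
  pose N := (Num.truncn (al / (dl / 2))).+1; exists N => n Nn t' tt'.
  have d2 : 0 < dl / 2 by rewrite divr_gt0.
  apply/andP; split; last first.
    apply: (le_trans (yosida_le n t')).
    by have /andP[_ /ltW//] : al < m t' < be by apply: H; lra.
  apply: (@yosida_ge_near _ _ (dl / 2)) => [s ts|].
    suff /andP[/ltW//] : al < m s < be.
    apply: H; have -> : s - t = (t' - t) - (t' - s) by ring.
    by apply: (le_lt_trans (ler_normB _ _)); lra.
  have : al < N%:R * (dl / 2) by rewrite -ltr_pdivrMr//; exact: truncnS_gt.
  have : N%:R * (dl / 2) <= n%:R * (dl / 2) by rewrite ler_wpM2r ?ler_nat // ltW.
  lra.
have [vm|mv] := ltP v (m t).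
  exists ((v + m t) / 2), (M + 1); split; first by left; lra.
  by move=> v' Fv'; have := mmin _ Fv'; have := Mmax _ Fv'; move=> h1 h2; apply/andP; split; lra.
have Mv : M < v.
  by rewrite ltNge; apply/negP => vM; apply: nF; apply: (convex_between Fm FM); rewrite mv.
exists (m t - 1), ((M + v) / 2); split; first by right; lra.
by move=> v' Fv'; have := mmin _ Fv'; have := Mmax _ Fv'; move=> h1 h2; apply/andP; split; lra.
Qed.

End usc_compact_convex.

(** * Primitives vanishing at 0 *)

Section primitive_at0.
Context (R : realType).
Implicit Types (f : R -> R) (x y z t : R).
Local Notation lam := (@lebesgue_measure R).

Definition itv_int f x y : R := \int[lam]_(t in `[x, y]) f t.

(** For t < 0 the interval [0, t] is empty, and for t > 0 the interval [t, 0] is: the difference is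
    the oriented integral from 0 to t. *)
Definition primitive0 f t : R := itv_int f 0 t - itv_int f t 0.

Lemma continuous_itv_integrable f x y : continuous f ->
  lam.-integrable `[x, y] (EFin \o f).
Proof.
move=> cf; apply: continuous_compact_integrable; first exact: segment_compact.
exact: continuous_subspaceT.
Qed.

Lemma itv_int0 f x : itv_int f x x = 0.
Proof. by rewrite /itv_int set_itv1 Rintegral_set1. Qed.

Lemma itv_int_gt f x y : y < x -> itv_int f x y = 0.
Proof. by move=> yx; rewrite /itv_int set_itv_ge ?Rintegral_set0// bnd_simp -ltNge. Qed.

Lemma itv_int_chasles f x y z : continuous f -> x <= y -> y <= z ->
  itv_int f x z = itv_int f x y + itv_int f y z.
Proof.
move=> cf xy yz; have ixz := continuous_itv_integrable x z cf.
have := @Rintegral_itvB _ f (BLeft x) (BRight z) y ixz.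
rewrite !bnd_simp => /(_ xy yz) E.
rewrite /itv_int -(@Rintegral_itv_obnd_cbnd _ y); last first.
  apply: integrableS (continuous_itv_integrable y z cf) => //.
  by apply: subset_itvr; rewrite bnd_simp.
by rewrite -E addrC subrK.
Qed.

Lemma primitive0_sub f x y : continuous f -> x <= y ->
  primitive0 f y - primitive0 f x = itv_int f x y.
Proof.
move=> cf xy; rewrite /primitive0.
have neg t : 0 <= t -> itv_int f t 0 = 0.
  by rewrite le_eqVlt => /orP[/eqP <-|]; [exact: itv_int0|exact: itv_int_gt].
have pos t : t <= 0 -> itv_int f 0 t = 0.
  by rewrite le_eqVlt => /orP[/eqP ->|]; [exact: itv_int0|exact: itv_int_gt].
have [x0|x0] := leP 0 x.
  rewrite !neg//; last exact: le_trans xy.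
  by rewrite (itv_int_chasles cf x0 xy); ring.
have [y0|y0] := leP 0 y.
  by rewrite (neg y)// (pos x) ?ltW// (itv_int_chasles cf (ltW x0) y0); ring.
rewrite !pos ?ltW//.
by rewrite (itv_int_chasles cf xy (ltW y0)); ring.
Qed.

Lemma primitive0_at0 f : primitive0 f 0 = 0.
Proof. by rewrite /primitive0 subrr. Qed.

Lemma primitive0_pos f t : 0 <= t -> primitive0 f t = itv_int f 0 t.
Proof.
rewrite /primitive0 le_eqVlt => /orP[/eqP <-|t0]; first by rewrite itv_int0 subrr.
by rewrite (itv_int_gt _ t0) subr0.
Qed.

Lemma itv_int_cst M x y : x <= y -> \int[lam]_(t in `[x, y]) M = M * (y - x).
Proof.
move=> xy; rewrite Rintegral_cst; last exact: measurable_itv.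
have E : lam `[x, y]%classic = (y - x)%:E.
  rewrite lebesgue_measure_itv/= lte_fin.
  by move: xy; rewrite le_eqVlt => /orP[/eqP ->|->//]; rewrite ltxx subrr.
by congr (_ * _); transitivity (fine (lam `[x, y]%classic)); [by []|rewrite E].
Qed.

Lemma itv_int_bound f x y lo hi : continuous f -> x <= y ->
  (forall t, x <= t <= y -> lo <= f t <= hi) ->
  lo * (y - x) <= itv_int f x y <= hi * (y - x).
Proof.
move=> cf xy b; rewrite -!itv_int_cst// /itv_int.
have cc (M : R) : continuous (cst M : R -> R) by move=> z; exact: cvg_cst.
have ic (M : R) := continuous_itv_integrable x y (cc M).
have iff := continuous_itv_integrable x y cf.
apply/andP; split; apply: le_Rintegral => //; try exact: ic.
- by move=> t /=; rewrite in_itv/= => /b /andP[].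
- by move=> t /=; rewrite in_itv/= => /b /andP[].
Qed.

Lemma lipschitz_continuous f (ell : R) : 0 <= ell ->
  (forall x y, `|f x - f y| <= ell * `|x - y|) -> continuous f.
Proof.
move=> l0 lip x; apply/cvgrPdist_le => /= e e0.
exists (e / (ell + 1)); first by rewrite /= divr_gt0// ltr_wpDl.
move=> y /=; rewrite ltr_pdivlMr ?ltr_wpDl// => xy.
by apply: (le_trans (lip x y)); have := normr_ge0 (x - y); nra.
Qed.

Lemma primitive0_nonlinearity f ell : 0 <= ell ->
  (forall x y, `|f x - f y| <= ell * `|x - y|) -> nonlinearity f (primitive0 f) ell.
Proof.
move=> l0 lip; have cf := lipschitz_continuous l0 lip.
(* [c] is any point of [x, y], so that either end can be the base point of the expansion. *)
have W x y c : x <= y -> x <= c <= y ->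
    `|itv_int f x y - f c * (y - x)| <= ell * (y - x) ^+ 2.
  move=> xy /andP[xc cy].
  have : (f c - ell * (y - x)) * (y - x) <= itv_int f x y <=
         (f c + ell * (y - x)) * (y - x).
    apply: itv_int_bound => // t /andP[xt ty].
    have tc : `|t - c| <= y - x by rewrite ler_norml; apply/andP; split; lra.
    have := le_trans (lip t c) (ler_wpM2l l0 tc).
    by rewrite ler_norml => /andP[h1 h2]; apply/andP; split; lra.
  by move=> /andP[h1 h2]; rewrite ler_norml; apply/andP; split; lra.
split => // x y.
have [xy|/ltW yx] := leP x y.
  by rewrite primitive0_sub//; apply: W => //; rewrite lexx.
have -> : primitive0 f y - primitive0 f x - f x * (y - x) =
    - (itv_int f y x - f x * (x - y)) by rewrite -primitive0_sub//; ring.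
rewrite normrN -[(y - x) ^+ 2]sqrrN opprB.
by apply: W => //; rewrite lexx yx.
Qed.

Lemma primitive0_nd f : continuous f -> (forall t, 0 <= f t) ->
  nondecreasing (primitive0 f).
Proof.
move=> cf f0 x y xy; rewrite -subr_ge0 primitive0_sub//.
by apply: Rintegral_ge0 => t _.
Qed.

Lemma primitive0_le f M t : continuous f -> 0 <= t ->
  (forall t', 0 <= t' <= t -> 0 <= f t' <= M) -> primitive0 f t <= M * t.
Proof.
move=> cf t0 fM; rewrite primitive0_pos//.
by have /andP[_] := itv_int_bound cf t0 fM; rewrite subr0.
Qed.

Lemma itv_int_cvg (f_ : nat -> R -> R) f M x y : x <= y ->
  (forall n, continuous (f_ n)) -> measurable_fun setT f ->
  (forall n t, x <= t <= y -> 0 <= f_ n t <= M) ->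
  (forall t, f_ n t @[n --> \oo] --> f t) ->
  itv_int (f_ n) x y @[n --> \oo] --> itv_int f x y.
Proof.
move=> xy cf_ mf b cvgf.
have cM : continuous (cst M : R -> R) by move=> z; exact: cvg_cst.
have iM := continuous_itv_integrable x y cM.
have mI := measurable_itv `[x, y] : measurable (`[x, y]%classic : set (measurableTypeR R)).
have mfn n : measurable_fun `[x, y] (EFin \o f_ n).
  exact: measurable_int (continuous_itv_integrable x y (cf_ n)).
have mf' : measurable_fun `[x, y] (EFin \o f).
  exact/measurable_EFinP/measurable_funTS.
have c1 : {ae lam, forall t, `[x, y]%classic t ->
    (EFin \o f_ n) t @[n --> \oo] --> (EFin \o f) t}.
  by apply: aeW => t _; apply: cvg_EFin; [exact: nearW|exact: cvgf].
have c2 : {ae lam, forall t n, `[x, y]%classic t ->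
    (`|(EFin \o f_ n) t| <= (EFin \o cst M) t)%E}.
  apply: aeW => t n /=; rewrite in_itv/= => /(b n)/andP[h1 h2].
  by rewrite lee_fin ger0_norm.
have [i1 _ i2] := @dominated_convergence _ _ R lam `[x, y]%classic mI
  (fun n => EFin \o f_ n) (EFin \o f) (EFin \o cst M) mfn mf' c1 iM c2.
apply/fine_cvg; rewrite fineK; first exact: i2.
exact: integrable_fin_num i1.
Qed.

End primitive_at0.

(** * Fundamental theorem of calculus and continuous cut-offs *)

Section calculus.
Context (R : realType).
Implicit Types (f k phi psi : R -> R) (x y t : R).

Lemma primitive0_derive f x : continuous f ->
  derivable (primitive0 f) x 1 /\ derive1 (primitive0 f) x = f x.
Proof.
move=> cf.
have dq : h^-1 *: (primitive0 f (h + x) - primitive0 f x) @[h --> 0^'] --> f x.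
  apply/cvgrPdist_le => /= e e0.
  have /cvgrPdist_le/(_ _ e0)[dl /= dl0 H] := cf x.
  exists dl => //= h /=; rewrite sub0r normrN => hd h0.
  have fb t : `|t - x| <= `|h| -> f x - e <= f t <= f x + e.
    move=> tx; have : `|f x - f t| <= e.
      by apply: H; rewrite /= distrC; exact: le_lt_trans tx hd.
    by rewrite ler_norml => /andP[h1 h2]; apply/andP; split; lra.
  have [hp|hn|/eqP] := ltgtP 0 h; last by rewrite eq_sym (negbTE h0).
    have xh : x <= h + x by rewrite lerDr ltW.
    have : (f x - e) * (h + x - x) <= itv_int f x (h + x) <= (f x + e) * (h + x - x).
      apply: itv_int_bound => // t /andP[t1 t2]; apply: fb; rewrite (ger0_norm (ltW hp)).
      by rewrite ger0_norm ?subr_ge0// lerBlDr.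
    rewrite -primitive0_sub//.
    have -> : h + x - x = h by ring.
    move: (primitive0 f _ - _) => D /andP[d1 d2].
    rewrite -ler_pdivrMr// in d2; rewrite -ler_pdivlMr// in d1.
    rewrite /GRing.scale/= [h^-1 * D]mulrC ler_norml.
    by apply/andP; split; lra.
  have xh : h + x <= x by rewrite gerDr ltW.
  have : (f x - e) * (x - (h + x)) <= itv_int f (h + x) x <= (f x + e) * (x - (h + x)).
    apply: itv_int_bound => // t /andP[t1 t2]; apply: fb; rewrite (ler0_norm (ltW hn)).
    by rewrite ler0_norm ?subr_le0//; lra.
  rewrite -primitive0_sub//.
  have -> : x - (h + x) = - h by ring.
  have -> : primitive0 f (h + x) - primitive0 f x =
    - (primitive0 f x - primitive0 f (h + x)) by ring.
  move: (primitive0 f _ - _) => D /andP[d1 d2].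
  have -> : h^-1 *: - D = D / - h by rewrite /GRing.scale/=; field; rewrite lt_eqF.
  have hn' : 0 < - h by rewrite oppr_gt0.
  rewrite -ler_pdivrMr// in d2; rewrite -ler_pdivlMr// in d1.
  by rewrite ler_norml; apply/andP; split; lra.
have dG : derivable (primitive0 f) x 1.
  apply/cvg_ex; exists (f x).
  by move: dq; under [in X in _ -> X]eq_fun do rewrite /GRing.scale/= mulr1.
split => //; rewrite /derive1.
exact: (cvg_lim (@Rhausdorff R) dq).
Qed.

Lemma ftc_derivable phi x y : (forall t, derivable phi t 1) ->
  continuous (derive1 phi) -> x <= y -> itv_int (derive1 phi) x y = phi y - phi x.
Proof.
move=> dphi cphi; rewrite le_eqVlt => /orP[/eqP ->|xy].
  by rewrite itv_int0 subrr.
have cp t : {for t, continuous phi}.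
  by apply: differentiable_continuous; apply/derivable1_diffP.
have doo : derivable_oo_LRcontinuous phi x y.
  split; first by move=> t _; exact: dphi.
  + by apply: cvg_at_right_filter; exact: cp.
  + by apply: cvg_at_left_filter; exact: cp.
by rewrite /itv_int /Rintegral (continuous_FTC2 xy (continuous_subspaceT cphi) doo).
Qed.

(** For al <= be these functions vanish off []al, be[] and increase to its indicator. They are
    continuous, so that primitives of their combinations are C^1 and can serve as test functions. *)
Definition tent (n : nat) (al be x : R) : R :=
  Num.min 1 (n%:R * Num.max 0 ((x - al) * (be - x))).

Lemma tent_continuous n al be : continuous (tent n al be).
Proof.
have c1 : continuous (fun x => (x - al) * (be - x)).
  move=> x; apply: cvgM; apply: cvgB; try exact: cvg_cst; exact: cvg_id.
have c2 : continuous (fun x => n%:R * Num.max 0 ((x - al) * (be - x))).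
  move=> x; apply: cvgM; first exact: cvg_cst.
  have k0 : {for x, continuous (cst 0 : R -> R^o)} by exact: cvg_cst.
  have := continuous_max k0 (c1 x); exact.
move=> x; have k1 : {for x, continuous (cst 1 : R -> R^o)} by exact: cvg_cst.
have := continuous_min k1 (c2 x); exact.
Qed.

Lemma tent_bound n al be x : 0 <= tent n al be x <= 1.
Proof.
by rewrite /tent le_min ler01 ge_min lexx !mulr_ge0//= le_max lexx.
Qed.

Lemma tent_out n al be x : al <= be -> ~~ (al < x < be) -> tent n al be x = 0.
Proof.
move=> ab; rewrite negb_and -!leNgt => out.
rewrite /tent (_ : Num.max _ _ = 0) ?mulr0 ?min_r//.
by rewrite max_l//; case/orP: out => h; nra.
Qed.

Lemma tent_cvg al be x : al <= be ->
  tent n al be x @[n --> \oo] --> ((al < x < be)%R%:R : R).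
Proof.
move=> ab; case: (boolP (al < x < be)) => [|out]; last first.
  apply/cvgrPdist_le => /= e e0; apply: nearW => n.
  by rewrite (tent_out _ ab out) subr0 normr0 ltW.
move=> /andP[ax xb].
have d0 : 0 < (x - al) * (be - x) by rewrite mulr_gt0 ?subr_gt0.
apply/cvgrPdist_le => /= e e0.
exists (Num.truncn (((x - al) * (be - x))^-1)).+1 => // n /= Nn.
rewrite /tent min_l ?subrr ?normr0 ?(ltW e0)//.
rewrite max_r ?(ltW d0)// -ler_pdivrMr// mul1r ltW//.
apply: lt_le_trans (truncnS_gt _) _.
by rewrite ler_nat.
Qed.

End calculus.

(** * Weak derivatives *)

Section test_functions.
Context (R : realType) (a b : R) (hab : a < b).
Implicit Types (f k phi psi g h : R -> R) (x y t : R).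
Local Notation integ := (integ a b).
Local Notation prim := (prim a b).
Local Notation coprim := (coprim a b).

Lemma integ_itv_int k : continuous k -> integ k = itv_int k a b.
Proof.
move=> ck; have ik := continuous_itv_integrable a b ck.
rewrite /integ_def /Rintegral leb_restrE; last exact: continuous_measurable_fun.
rewrite /itv_int -(@Rintegral_itv_obnd_cbnd _ a); last first.
  by apply: integrableS ik => //; apply: subset_itvr; rewrite bnd_simp.
rewrite -Rintegral_itv_bndo_bndc//.
by apply: integrableS ik => //; exact: subset_itv_oo_cc.
Qed.

Lemma prim_itv_int k x : continuous k -> a < x < b -> prim k x = itv_int k a x.
Proof.
move=> ck /andP[ax xb]; have ik := continuous_itv_integrable a x ck.
have mk := continuous_measurable_fun ck.
rewrite /prim_def /integ_def /Rintegral leb_restrE; last first.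
  by apply: measurable_funM => //; case: (bmeas_le_indic x).
rewrite /itv_int -(@Rintegral_itv_obnd_cbnd _ a); last first.
  by apply: integrableS ik => //; apply: subset_itvr; rewrite bnd_simp.
rewrite /Rintegral; congr fine; rewrite [LHS]integral_mkcond [RHS]integral_mkcond.
apply: eq_integral => t _; rewrite !patchE.
case: ifPn; rewrite mem_setE/= in_itv/= => tab; case: ifPn; rewrite mem_setE/= in_itv/= => tax.
- by case/andP: tax => _ ->; rewrite mulr1.
- case/andP: tab => at_ _; move: tax; rewrite at_/= => /negbTE ->.
  by rewrite mulr0.
- case/andP: tax => at_ tx; move: tab; rewrite at_/=.
  by rewrite (le_lt_trans tx xb).
- by [].
Qed.

Lemma test_out phi x : test_function a b phi -> ~~ (a < x < b) ->
  phi x = 0 /\ derive1 phi x = 0.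
Proof.
move=> [dphi cphi supp] out.
have near0 : \forall y \near x, phi y = 0.
  have ncl : (~` closure [set x | phi x != 0]) x.
    by move=> /supp; rewrite /= in_itv/= (negbTE out).
  have op : open (~` closure [set x | phi x != 0]) by exact/closed_openC/closed_closure.
  move: op; rewrite openE => /(_ x ncl); apply: filterS => y nc.
  by apply/eqP; apply: contrapT => /negP y0; apply: nc; exact: subset_closure.
split; first exact: nbhs_singleton near0.
rewrite derive1E (near_eq_derive (g := cst 0)) ?derive_cst//.
Qed.

Lemma test_bmeas phi : test_function a b phi -> bmeas phi /\ bmeas (derive1 phi).
Proof.
move=> tphi; have [dphi cphi supp] := tphi.
have cont_phi : continuous phi.
  by move=> t; apply: differentiable_continuous; apply/derivable1_diffP.
have bnd k : continuous k -> (forall x, ~~ (a < x < b) -> k x = 0) -> bmeas k.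
  move=> ck k0; split; first exact: continuous_measurable_fun.
  have [M _ MH] := @EVT_max R (fun x => `|k x|) a b (ltW hab)
    (continuous_subspaceT (fun x => cvg_norm (ck x))).
  exists `|k M| => x; case: (boolP (a < x < b)) => [/andP[ax xb]|/k0 ->]; last by rewrite normr0.
  by apply: MH; rewrite in_itv/= !ltW.
by split; apply: bnd => // x /(test_out tphi)[].
Qed.

Lemma test_prim phi x : test_function a b phi -> a < x < b -> prim (derive1 phi) x = phi x.
Proof.
move=> tphi xab; have [dphi cphi supp] := tphi.
rewrite prim_itv_int// (ftc_derivable dphi cphi); last by case/andP: xab => /ltW.
have [|-> _] := @test_out phi a tphi; first by rewrite ltxx.
by rewrite subr0.
Qed.

Lemma test_integ phi : test_function a b phi -> integ (derive1 phi) = 0.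
Proof.
move=> tphi; have [dphi cphi supp] := tphi.
rewrite integ_itv_int// (ftc_derivable dphi cphi) ?(ltW hab)//.
have [|-> _] := @test_out phi a tphi; first by rewrite ltxx.
have [|-> _] := @test_out phi b tphi; first by rewrite ltxx andbF.
by rewrite subr0.
Qed.

(** A test function has int phi' = 0, so [coprim] of phi' is - phi on (a, b), and [coprim_prim_dual]
    is the required integration by parts. *)
Lemma prim_weak_derivative g : itg a b g -> is_weak_derivative a b (prim g) g.
Proof.
move=> ig phi tphi; have [bphi bphi'] := test_bmeas tphi.
have E : integ (fun x => prim g x * derive1 phi x) = - integ (fun x => g x * phi x).
  transitivity (integ (fun x => derive1 phi x * prim g x)).
    by apply: integ_eq => x; rewrite mulrC.
  rewrite -coprim_prim_dual//.
  rewrite -[RHS]mulN1r -integZ; last first.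
    have := itgM bphi ig; by apply: eq_integrable => // t _; rewrite /= mulrC.
  have mg := itg_meas ig.
  have [mphi _] := bphi; have [mc _] := coprim_bmeas (bmeas_itg a b bphi').
  apply: integ_ae.
  - exact: measurable_funM.
  - apply: measurable_funM; first exact: measurable_cst.
    exact: measurable_funM.
  - apply: filterS (ae_leb_itv a b) => x; rewrite in_itv/= => xab.
    by rewrite /coprim_def test_integ// test_prim// sub0r mulN1r mulNr mulrC.
exact: E.
Qed.

End test_functions.

(** * The lemma of du Bois-Reymond *)

Section du_bois_reymond.
Context (R : realType) (a b : R) (hab : a < b).
Implicit Types (f k phi psi g h : R -> R) (x y t : R).
Local Notation integ := (integ a b).
Local Notation prim := (prim a b).

Lemma itv_int_zero psi x y : continuous psi -> x <= y ->
  (forall t, x <= t <= y -> psi t = 0) -> itv_int psi x y = 0.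
Proof.
move=> cp xy p0; have := @itv_int_bound _ psi x y 0 0 cp xy.
rewrite !mul0r => H; apply/eqP; rewrite eq_le andbC; apply: H.
by move=> t /p0 ->; rewrite lexx.
Qed.

(** The primitive of [psi] normalized at a vanishes up to [al] and is constant beyond [be]; the
    constant is the integral of [psi], hence 0. *)
Lemma test_of_null psi al be : continuous psi -> a < al -> al <= be -> be < b ->
  (forall t, ~~ (al < t < be) -> psi t = 0) -> integ psi = 0 ->
  exists2 phi, test_function a b phi & derive1 phi = psi.
Proof.
move=> cp aal albe beb out; rewrite integ_itv_int// => int0.
pose c := primitive0 psi a.
pose phi : R -> R := fun x => primitive0 psi x - c.
have dphi x : derivable phi x 1 /\ derive1 phi x = psi x.
  have [d e] := primitive0_derive x cp.
  have dc : derivable (cst c : R -> R) x 1 by exact: derivable_cst.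
  split; first by have := derivableB d dc; exact.
  by rewrite derive1E; have := deriveB d dc; rewrite derive_cst subr0 -!derive1E e.
have E : derive1 phi = psi by apply/funext => x; case: (dphi x).
exists phi => //; split; first by move=> x; case: (dphi x).
  by rewrite E.
have left x : x <= al -> phi x = 0.
  move=> xal; rewrite /phi /c; have [xa|ax] := leP x a.
    rewrite -[LHS]opprK opprB primitive0_sub// itv_int_zero ?oppr0//.
    move=> t /andP[_ ta]; apply: out; rewrite negb_and -!leNgt.
    by rewrite (le_trans ta (ltW aal)).
  rewrite primitive0_sub ?(ltW ax)// itv_int_zero ?(ltW ax)//.
  move=> t /andP[_ tx]; apply: out; rewrite negb_and -!leNgt.
  by rewrite (le_trans tx xal).
have phib : phi b = 0 by rewrite /phi /c primitive0_sub// ltW.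
have right x : be <= x -> phi x = 0.
  move=> bex.
  have zero y z : be <= y -> y <= z -> primitive0 psi z - primitive0 psi y = 0.
    move=> bey yz; rewrite primitive0_sub// itv_int_zero//.
    move=> t /andP[yt _]; apply: out; rewrite negb_and -!leNgt.
    by rewrite (le_trans bey yt) orbT.
  have : primitive0 psi x = primitive0 psi b.
    have [xb|/ltW bx] := leP x b; apply/eqP.
      by rewrite eq_sym -subr_eq0 zero.
    by rewrite -subr_eq0 zero// ltW.
  by rewrite /phi => ->.
apply: (@subset_trans _ `[al, be]%classic).
  rewrite [X in _ `<=` X](closure_id _).1; last exact: itv_closed.
  apply: closure_subset => x /= /eqP px; rewrite in_itv/=.
  by apply/andP; split; rewrite leNgt; apply/negP => h; apply: px;
    [apply: left|apply: right]; exact: ltW.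
move=> x /=; rewrite !in_itv/= => /andP[h1 h2].
by rewrite (lt_le_trans aal h1) (le_lt_trans h2 beb).
Qed.

Lemma tent_bmeas n (al be : R) : bmeas (tent n al be).
Proof.
split; first by apply: continuous_measurable_fun; exact: tent_continuous.
by exists 1 => x; have /andP[h1 h2] := tent_bound n al be x; rewrite ger0_norm.
Qed.

Lemma integ_tent_cvg h al be : itg a b h -> al <= be ->
  integ (fun x => h x * tent n al be x) @[n --> \oo] -->
  integ (fun x => h x * (al < x < be)%R%:R).
Proof.
move=> ih albe; have mh := itg_meas ih.
have it n : itg a b (fun x => h x * tent n al be x).
  by have := itgM (tent_bmeas n al be) ih; apply: eq_integrable => // t _; rewrite /= mulrC.
have mi : measurable_fun setT (fun x : R => (al < x < be)%R%:R : R).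
  have -> : (fun x : R => (al < x < be)%R%:R) = (\1_`]al, be[ : R -> R).
    by apply/funext => t; rewrite indicE mem_setE/= in_itv.
  exact: measurable_indic.
have mfn n : measurable_fun setT (EFin \o (fun x => h x * tent n al be x)).
  by apply/measurable_EFinP; exact: itg_meas (it n).
have mf : measurable_fun setT (EFin \o (fun x => h x * (al < x < be)%R%:R)).
  exact/measurable_EFinP/measurable_funM.
have c1 : {ae leb a b, forall t, setT t ->
    (EFin \o (fun x => h x * tent n al be x)) t @[n --> \oo] -->
    (EFin \o (fun x => h x * (al < x < be)%R%:R)) t}.
  apply: aeW => t _; apply: cvg_EFin; first exact: nearW.
  by apply: cvgMr; exact: tent_cvg.
have c2 : {ae leb a b, forall t n, setT t ->
    (`|(h t * tent n al be t)%:E| <= (EFin \o (fun x => `|h x|)%R) t)%E}.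
  apply: aeW => t n _ /=; rewrite lee_fin normrM ler_piMr//.
  by have /andP[h1 h2] := tent_bound n al be t; rewrite ger0_norm.
have [i1 _ i2] := @dominated_convergence _ _ R (leb a b) setT measurableT
  (fun n => EFin \o (fun x => h x * tent n al be x)) _ _ mfn mf c1 (itg_norm ih) c2.
apply/fine_cvg; rewrite fineK; first exact: i2.
exact: integrable_fin_num i1.
Qed.

Lemma integ_open_itv (al be : R) : a <= al -> al <= be -> be < b ->
  integ (fun x => (al < x < be)%R%:R) = be - al.
Proof.
move=> aal albe beb; rewrite -(integ_indic_itv aal albe beb).
apply: integ_ae.
- have -> : (fun x : R => (al < x < be)%R%:R) = (\1_`]al, be[ : R -> R).
    by apply/funext => t; rewrite indicE mem_setE/= in_itv.
  exact: measurable_indic.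
- exact: measurable_indic.
- apply: filterS (ae_leb_neq a b be) => x xbe.
  by rewrite indicE mem_setE/= in_itv/= [x < be]lt_neqAle xbe.
Qed.

Lemma integ_itv_zero_ae h : itg a b h ->
  (forall al be, a < al -> al < be -> be < b ->
     integ (fun x => h x * (al < x < be)%R%:R) = 0) ->
  \forall x \ae leb a b, h x = 0.
Proof.
move=> ih H; have mh := itg_meas ih.
apply: filterS2 (prim_derivable ih) (ae_leb_itv a b) => x [dx dE].
rewrite in_itv/= => /andP[ax xb].
have e0 : 0 < b - x by rewrite subr_gt0.
have := @derive1_itv R (prim h) x 0 0 (b - x) e0 dx.
rewrite dE => D; apply/eqP; rewrite eq_le andbC; apply: D => d /andP[d0 db].
have xd : x < x + d by rewrite ltrDl.
have xdb : x + d < b by lra.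
rewrite prim_sub ?(ltW xd)// (_ : integ _ = 0) ?mul0r ?lexx//.
rewrite -(H x (x + d))//; apply: integ_ae.
- by apply: measurable_funM => //; case: (itv_indic_bmeas x (x + d)).
- apply: measurable_funM => //.
  have -> : (fun t : R => (x < t < x + d)%R%:R) = (\1_`]x, (x + d)[ : R -> R).
    by apply/funext => t; rewrite indicE mem_setE/= in_itv.
  exact: measurable_indic.
- by apply: filterS (ae_leb_neq a b (x + d)) => t td; rewrite [t < x + d]lt_neqAle td.
Qed.

(** Subtracting from a tent t1 a multiple of a fixed tent t0 yields mean zero, hence the derivative
    of a test function; so int h t1 = c int t1 with c independent of t1. Sharpening the tents shows
    that h - c integrates to 0 over every interval. *)
Lemma du_bois_reymond h : itg a b h ->
  (forall phi, test_function a b phi -> integ (fun x => h x * derive1 phi x) = 0) ->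
  exists c, \forall x \ae leb a b, h x = c.
Proof.
move=> ih H.
pose al0 := a + (b - a) / 3; pose be0 := a + (b - a) / 3 * 2.
have ba : 0 < (b - a) / 3 by rewrite divr_gt0// subr_gt0.
have aal0 : a < al0 by rewrite /al0 ltrDl.
have al0be0 : al0 < be0 by rewrite /al0 /be0; lra.
have be0b : be0 < b by rewrite /be0; move: hab; lra.
have itent n al be : itg a b (fun x => h x * tent n al be x).
  by have := itgM (tent_bmeas n al be) ih; apply: eq_integrable => // t _; rewrite /= mulrC.
have [N rpos] : exists N, 0 < integ (tent N al0 be0).
  have i1 : itg a b (fun=> 1) by exact/bmeas_itg/bmeas_cst.
  have := integ_tent_cvg i1 (ltW al0be0).
  have E n : integ (fun x => 1 * tent n al0 be0 x) = integ (tent n al0 be0).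
    by apply: integ_eq => x; rewrite mul1r.
  have -> : integ (fun x => 1 * (al0 < x < be0)%R%:R) = be0 - al0.
    rewrite -integ_open_itv ?(ltW aal0) ?(ltW al0be0)//.
    by apply: integ_eq => x; rewrite mul1r.
  have d0 : 0 < be0 - al0 by rewrite subr_gt0.
  move=> /cvgr_gt => /(_ _ d0) [N _ HN]; exists N.
  by rewrite -E; exact: (HN N (leqnn N)).
pose r := integ (tent N al0 be0).
pose c := integ (fun x => h x * tent N al0 be0 x) / r.
have key n al be : a < al -> al < be -> be < b ->
    integ (fun x => h x * tent n al be x) = c * integ (tent n al be).
  move=> aal albe beb.
  pose t1 := tent n al be; pose t0 := tent N al0 be0.
  have b1 : bmeas t1 by exact: tent_bmeas.
  have b0 : bmeas t0 by exact: tent_bmeas.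
  pose l := integ t1 / r.
  pose psi : R -> R := fun x => t1 x - l * t0 x.
  have cpsi : continuous psi.
    move=> x; apply: cvgB; first exact: tent_continuous.
    by apply: cvgMr; exact: tent_continuous.
  have ilt0 : itg a b (fun x => l * t0 x) by exact/itgZ/bmeas_itg.
  have psi0 : integ psi = 0.
    rewrite integB//; last exact: bmeas_itg.
    rewrite integZ; last exact: bmeas_itg.
    by rewrite /l divfK ?subrr// gt_eqF.
  have [||||phi tphi phiE] := @test_of_null psi (Num.min al al0) (Num.max be be0) cpsi _ _ _ _ psi0.
  - by rewrite lt_min aal.
  - by rewrite le_max ge_min (ltW albe).
  - by rewrite gt_max beb.
  - move=> t; rewrite gt_min lt_max negb_and !negb_or => out.
    rewrite /psi /t1 /t0 !tent_out ?mulr0 ?subr0 ?(ltW albe) ?(ltW al0be0)//.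
    + by rewrite negb_and; case/orP: out => /andP[h1 h2]; rewrite ?h1 ?h2 ?orbT.
    + by rewrite negb_and; case/orP: out => /andP[h1 h2]; rewrite ?h1 ?h2 ?orbT.
  have := H phi tphi; rewrite phiE.
  have -> : integ (fun x => h x * psi x) =
      integ (fun x => h x * t1 x) - l * integ (fun x => h x * t0 x).
    rewrite -integZ; last exact: itent.
    rewrite -integB; [|exact: itent|exact/itgZ/itent].
    by apply: integ_eq => x; rewrite /psi; ring.
  move/eqP; rewrite subr_eq0 => /eqP ->.
  by rewrite /l /c -/t0 -/t1; move: (integ t1) (integ _) => A B; ring.
exists c.
have ic : itg a b (fun=> c) by exact/bmeas_itg/bmeas_cst.
suff : \forall x \ae leb a b, h x - c = 0.
  by apply: filterS => x /eqP; rewrite subr_eq0 => /eqP.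
apply: integ_itv_zero_ae; first exact: itgB.
move=> al be aal albe beb.
have c1 := integ_tent_cvg (itgB ih ic) (ltW albe).
have z n : integ (fun x => (h x - c) * tent n al be x) = 0.
  have ict : itg a b (fun x => c * tent n al be x) by exact/itgZ/bmeas_itg/tent_bmeas.
  have -> : integ (fun x => (h x - c) * tent n al be x) =
      integ (fun x => h x * tent n al be x) - c * integ (tent n al be).
    rewrite -integZ; last exact/bmeas_itg/tent_bmeas.
    rewrite -integB//.
    by apply: integ_eq => x; ring.
  by rewrite key// subrr.
rewrite -(cvg_lim (@Rhausdorff R) c1).
under eq_fun do rewrite z.
exact: lim_cst.
Qed.

End du_bois_reymond.

(** * Elements of X as primitives of their weak derivatives *)

Section sobolev.
Context (R : realType) (a b : R) (hab : a < b).
Implicit Types (f k phi psi g h u v : R -> R) (x y t : R).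
Local Notation integ := (integ a b).
Local Notation prim := (prim a b).

Lemma Lfun2_itg g : g \in Lfun (leb a b) 2%:E -> itg a b g.
Proof.
move=> g2; apply/Lfun1_integrable; apply: Lfun_subset12 g2.
exact: leb_fin.
Qed.

Lemma bmeas_Lfun2 g : bmeas g -> g \in Lfun (leb a b) 2%:E.
Proof.
move=> bg; have [mg [M gM]] := bg.
rewrite inE; apply/andP; split; rewrite inE/=; first exact: mg.
rewrite /finite_norm unlock /Lnorm.
apply: poweR_lty.
have E : (\int[leb a b]_x (`|g x| `^ 2)%:E)%E = (integ (fun x => g x ^+ 2))%:E.
  rewrite -integ_EFin; last exact/bmeas_itg/bmeasX.
  by apply: eq_integral => x _; rewrite powR_mulrn// real_normK ?num_real.
have := ltry (integ (fun x => g x ^+ 2)); rewrite -E; apply: le_lt_trans.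
rewrite le_eqVlt; apply/orP; left; apply/eqP; apply: eq_integral => x _.
by [].
Qed.

Lemma prim_within_continuous g : itg a b g -> {within `[a, b], continuous (prim g)}.
Proof.
move=> ig; have mg := itg_meas ig.
have [_ ih] := itg_lebesgue ig.
have E : prim g = fun x => parameterized_integral lebesgue_measure a x (g \_ `]a, b[).
  apply/funext => x; rewrite /parameterized_integral /prim_def /integ_def /Rintegral.
  rewrite leb_restrE; last exact: itg_meas (itg_indic x ig).
  congr fine; rewrite [LHS]integral_mkcond [RHS]integral_mkcond.
  apply: eq_integral => t _; rewrite !patchE.
  rewrite /= ?patchE !mem_setE /= !in_itv/=.
  case: (boolP (a < t < b)) => [/andP[at_ _]|_]; last by case: ifP.
  by rewrite (ltW at_)/=; case: (t <= x)%R; rewrite ?mulr1 ?mulr0.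
rewrite E; apply: parameterized_integral_continuous; first exact: ltW.
exact: integrableS ih.
Qed.

Lemma ae_zero_continuous f : {within `[a, b], continuous f} ->
  (\forall x \ae leb a b, f x = 0) -> forall x, a < x < b -> f x = 0.
Proof.
move=> cf [N [mN N0 fN]] x /andP[ax xb]; apply/eqP/negPn/negP => fx0.
have cx : {for x, continuous f}.
  have /(continuous_within_itvP _ hab)[+ _ _] := cf.
  by apply; rewrite in_itv/= ax.
have n0 : 0 < `|f x| by rewrite normr_gt0.
have /cvgrPdist_lt/(_ _ n0)[dl /= dl0 H] := cx.
pose e := Num.min dl (b - x).
have e0 : 0 < e by rewrite lt_min dl0 subr_gt0.
have sub : `]x, x + e[%classic `<=` N.
  move=> t /=; rewrite in_itv/= => /andP[xt te]; apply: fN => /= ft.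
  have := H t; rewrite /= ft subr0 ltxx => Hf; apply: (notF (Hf _)).
  rewrite ltr0_norm ?subr_lt0// opprB ltrBlDl; apply: (lt_le_trans te).
  by rewrite lerD2l ge_min lexx.
have : (leb a b `]x, (x + e)%R[%classic <= 0)%E.
  by rewrite -N0; apply: le_measure; rewrite ?inE//; exact: measurable_itv.
rewrite /leb /= /mrestr setIidl; last first.
  move=> t /=; rewrite !in_itv/= => /andP[xt te].
  rewrite (lt_trans ax xt); apply: (lt_le_trans te).
  by rewrite -lerBrDl ge_min lexx orbT.
by rewrite lebesgue_measure_itv/= lte_fin ltrDl e0 -EFinB lee_fin addrC addKr leNgt e0.
Qed.

(** [prim] of the difference is orthogonal to all phi', hence constant almost everywhere by du
    Bois-Reymond and everywhere on (a, b) by continuity; it remains to differentiate it. *)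
Lemma weak_derivative_unique u g1 g2 : itg a b g1 -> itg a b g2 ->
  is_weak_derivative a b u g1 -> is_weak_derivative a b u g2 ->
  \forall x \ae leb a b, g1 x = g2 x.
Proof.
move=> i1 i2 w1 w2.
have id := itgB i1 i2.
have tst phi : test_function a b phi ->
    integ (fun x => prim (fun x => g1 x - g2 x) x * derive1 phi x) = 0.
  move=> tphi; have [bphi _] := test_bmeas hab tphi.
  have := prim_weak_derivative hab id tphi; rewrite -/(integ _) => ->.
  have ig g : itg a b g -> itg a b (fun x => g x * phi x).
    by move=> ig; have := itgM bphi ig; apply: eq_integrable => // t _; rewrite /= mulrC.
  have E : integ (fun x => g1 x * phi x) = integ (fun x => g2 x * phi x).
    apply: oppr_inj; rewrite /integ_def -w1//.
    exact: w2.
  have -> : \int[leb a b]_x ((g1 x - g2 x) * phi x) =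
      integ (fun x => g1 x * phi x) - integ (fun x => g2 x * phi x).
    rewrite -integB; [|exact: ig..].
    by apply: integ_eq => x; rewrite mulrBl.
  by rewrite E subrr oppr0.
have ip : itg a b (prim (fun x => g1 x - g2 x)) by exact/bmeas_itg/prim_bmeas.
have [c cE] := du_bois_reymond hab ip tst.
have zero x : a < x < b -> prim (fun x => g1 x - g2 x) x - c = 0.
  apply: (@ae_zero_continuous (fun x => prim (fun x => g1 x - g2 x) x - c)).
    move=> z; apply: cvgB; last exact: cvg_cst.
    exact: prim_within_continuous.
  by apply: filterS cE => z ->; rewrite subrr.
have : \forall x \ae leb a b, g1 x - g2 x = 0.
  apply: filterS2 (prim_derivable id) (ae_leb_itv a b) => x [dx <-].
  rewrite in_itv/= => xab.
  rewrite derive1E (near_eq_derive (g := cst c)) ?derive_cst//.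
  near=> z; apply/eqP; rewrite -subr_eq0; apply/eqP; apply: zero.
  near: z; have : open `]a, b[%classic by exact: itv_open.
  rewrite openE => /(_ x); apply; by rewrite /= in_itv.
by apply: filterS => x /eqP; rewrite subr_eq0 => /eqP.
Unshelve. all: by end_near. Qed.

Lemma prim_X g : bmeas g -> X a b (prim g).
Proof.
move=> bg; split; first split.
- exact/bmeas_Lfun2/bmeas_prim.
- exists g; first exact: bmeas_Lfun2.
  exact/prim_weak_derivative/bmeas_itg.
- exists (prim g); split; first exact/prim_within_continuous/bmeas_itg.
    by apply: filterE.
  by apply: prim_left => //; exact: bmeas_itg.
Qed.

Lemma weak_derivativeP u : H1 a b u ->
  weak_derivative a b u \in Lfun (leb a b) 2%:E /\
  is_weak_derivative a b u (weak_derivative a b u).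
Proof.
move=> [_ [g g2 wg]]; rewrite /weak_derivative.
by case: xgetP => [h _ []//|/(_ g)[]].
Qed.

Lemma weak_derivative_prim g : bmeas g ->
  \forall x \ae leb a b, weak_derivative a b (prim g) x = g x.
Proof.
move=> bg; have [Hp _] := prim_X bg; have [w2 ww] := weak_derivativeP Hp.
apply: (weak_derivative_unique (u := prim g)) => //.
- exact: Lfun2_itg.
- exact: bmeas_itg.
- exact/prim_weak_derivative/bmeas_itg.
Qed.

(** By du Bois-Reymond, v minus the primitive of its weak derivative is a constant almost
    everywhere, and the continuous representative with value 0 at a forces this constant to be 0. *)
Lemma X_prim v : X a b v -> itg a b (weak_derivative a b v) /\
  \forall x \ae leb a b, v x = prim (weak_derivative a b v) x.
Proof.
move=> [Hv [v0 [cv0 vv0 v0a]]]; have [w2 ww] := weak_derivativeP Hv.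
set g := weak_derivative a b v in w2 ww *.
have ig := Lfun2_itg w2; have iv := Lfun2_itg Hv.1.
have bp := prim_bmeas ig.
have id := itgB iv (bmeas_itg a b bp).
split => //.
have tst phi : test_function a b phi ->
    integ (fun x => (v x - prim g x) * derive1 phi x) = 0.
  move=> tphi; have [_ bphi'] := test_bmeas hab tphi.
  have im h : itg a b h -> itg a b (fun x => h x * derive1 phi x).
    by move=> ihh; have := itgM bphi' ihh; apply: eq_integrable => // t _; rewrite /= mulrC.
  have -> : integ (fun x => (v x - prim g x) * derive1 phi x) =
      integ (fun x => v x * derive1 phi x) - integ (fun x => prim g x * derive1 phi x).
    rewrite -integB; [|exact: im|exact/im/bmeas_itg].
    by apply: integ_eq => x; rewrite mulrBl.
  have := prim_weak_derivative hab ig tphi; rewrite -/(integ _) => ->.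
  have := ww phi tphi; rewrite -/(integ _) => ->.
  by rewrite subrr.
have [c cE] := du_bois_reymond hab id tst.
pose z x := v0 x - prim g x - c.
have cz : {within `[a, b], continuous z}.
  move=> x; apply: cvgB; last exact: cvg_cst.
  by apply: cvgB; [exact: cv0|exact: prim_within_continuous].
have z0 : forall x, a < x < b -> z x = 0.
  apply: (ae_zero_continuous cz).
  by apply: filterS2 vv0 cE => x vx e; rewrite /z -(vx I) e subrr.
have /(continuous_within_itvP _ hab)[_ za _] := cz.
(* [z] is 0 on (a, b) and right-continuous at a, where its value is - c. *)
have c0 : c = 0.
  have za0 : z @ a^'+ --> (0 : R).
    apply/cvgrPdist_le => /= e e0.
    near=> t; rewrite z0 ?subrr ?normr0 ?(ltW e0)//; apply/andP; split.
      by near: t; exact: nbhs_right_gt.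
    by near: t; exact: nbhs_right_lt.
  have : z a = 0.
    by rewrite -(cvg_lim (@Rhausdorff R) za) -(cvg_lim (@Rhausdorff R) za0).
  rewrite /z v0a prim_left// subrr sub0r => /eqP.
  by rewrite oppr_eq0 => /eqP.
by apply: filterS cE => x; rewrite c0 => /eqP; rewrite subr_eq0 => /eqP.
Unshelve. all: by end_near. Qed.

End sobolev.

(** * Replacing the coefficients by versions bounded everywhere *)

Section clamped_coefficients.
Context (R : realType) (a b : R) (hab : a < b).
Implicit Types (f k phi psi g h u v : R -> R) (x y t : R).

Definition clamp (lo hi y : R) : R := Num.max lo (Num.min y hi).

Lemma clamp_bound lo hi y : lo <= hi -> lo <= clamp lo hi y <= hi.
Proof. by move=> lh; rewrite /clamp le_max lexx/= ge_max lh ge_min lexx orbT. Qed.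

Lemma clamp_id lo hi y : lo <= y -> y <= hi -> clamp lo hi y = y.
Proof. by move=> h1 h2; rewrite /clamp min_l// max_r. Qed.

Lemma clamp_measurable lo hi f : measurable_fun setT f ->
  measurable_fun setT (fun x => clamp lo hi (f x)).
Proof.
move=> mf; apply: measurable_maxr; first exact: measurable_cst.
by apply: measurable_minr => //; exact: measurable_cst.
Qed.

Lemma leb_gt0 : (0 < leb a b setT)%E.
Proof. by rewrite leb_total ?ltW// lte_fin subr_gt0. Qed.

Lemma norm_oo_ae f : f \in Lfun (leb a b) +oo%E ->
  \forall x \ae leb a b, `|f x| <= norm_oo a b f.
Proof.
rewrite inE => /andP[]; rewrite !inE/= => mf.
rewrite /finite_norm /norm_oo unlock /Lnorm leb_gt0 => fin.
have := ess_sup_ge (leb a b) (abse \o (EFin \o f)).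
apply: filterS => x; set S := ess_sup _ _ in fin *.
move=> h; have S0 : (0 <= S)%E by apply: (le_trans _ h); rewrite /= lee_fin.
by rewrite -lee_fin fineK// ge0_fin_numE.
Qed.

Lemma ae_exists (Q : R -> Prop) : (\forall x \ae leb a b, Q x) -> exists x, Q x.
Proof.
move=> [N [mN N0 sub]]; apply: contrapT => no.
have : leb a b setT = 0%E.
  apply/eqP; rewrite eq_le measure_ge0 andbT -N0; apply: le_measure; rewrite ?inE//.
  by move=> x _; apply: sub => /= Qx; apply: no; exists x.
by move=> E; have := leb_gt0; rewrite E ltxx.
Qed.

Lemma clamped_coefficients (p q : R -> R) (p0 : R) :
  p \in Lfun (leb a b) +oo%E -> q \in Lfun (leb a b) +oo%E ->
  ess_inf (leb a b) (EFin \o p) = p0%:E -> 0 < p0 ->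
  (0 <= ess_inf (leb a b) (EFin \o q))%E ->
  exists p' q', [/\ coefficients p' q' p0 (norm_oo a b p) (norm_oo a b q),
    \forall x \ae leb a b, p x = p' x & \forall x \ae leb a b, q x = q' x].
Proof.
move=> hp hq ep p00 eq.
have mp : measurable_fun setT p.
  by move: hp; rewrite inE => /andP[]; rewrite !inE.
have mq : measurable_fun setT q.
  by move: hq; rewrite inE => /andP[]; rewrite !inE.
have pP : \forall x \ae leb a b, p0 <= p x <= norm_oo a b p.
  have pi := ess_inf_le (leb a b) (EFin \o p); rewrite ep in pi.
  apply: filterS2 pi (norm_oo_ae hp) => x; rewrite lee_fin => h1 h2.
  by rewrite h1 (le_trans (ler_norm _) h2).
have qQ : \forall x \ae leb a b, 0 <= q x <= norm_oo a b q.
  have qi := ess_inf_le (leb a b) (EFin \o q).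
  apply: filterS2 qi (norm_oo_ae hq) => x h1 h2.
  by rewrite -lee_fin (le_trans eq h1) (le_trans (ler_norm _) h2).
(* A point where the bounds hold shows that the lower clamping level does not exceed the upper
   one. *)
have [x0 /andP[h1 h2]] := ae_exists pP.
have [x1 /andP[h3 h4]] := ae_exists qQ.
exists (fun x => clamp p0 (norm_oo a b p) (p x)), (fun x => clamp 0 (norm_oo a b q) (q x)).
split.
- split => //; try exact: clamp_measurable.
  + by move=> x; apply: clamp_bound; exact: le_trans h2.
  + by move=> x; apply: clamp_bound; exact: le_trans h4.
- by apply: filterS pP => x /andP[k1 k2]; rewrite clamp_id.
- by apply: filterS qQ => x /andP[k1 k2]; rewrite clamp_id.
Qed.

End clamped_coefficients.

Section weak_solution_of_limit.
Context (R : realType) (a b : R) (hab : a < b).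
Variables (p q p' q' : R -> R) (p0 P Q lam : R) (F : R -> set R).
Hypothesis p_meas : measurable_fun setT p.
Hypothesis q_meas : measurable_fun setT q.
Hypothesis coef : coefficients p' q' p0 P Q.
Hypothesis pE : \forall x \ae leb a b, p x = p' x.
Hypothesis qE : \forall x \ae leb a b, q x = q' x.

(** The integrated equation is substituted for p u' in the inner product and integrated by parts
    against the derivative of v; the terms in [q] then cancel. *)
Lemma limit_weak_solution g w : bmeas g -> bmeas w ->
  (forall x, p' x * g x = coprim a b (fun t => lam * w t - q' t * prim a b g t) x) ->
  (\forall x \ae leb a b, F (prim a b g x) (w x)) ->
  weak_solution a b p q F lam (prim a b g).
Proof.
move=> bg bw eqn incl; split; first exact: prim_X.
(* [w] is bounded, so the exponent 2 is available. *)
exists 2, w; split => //; [by rewrite ltr1n|exact: bmeas_Lfun2|].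
move=> v Xv; have [ih vE] := X_prim hab Xv.
set h := weak_derivative a b v in ih vE.
have [H1u _] := prim_X hab bg.
have [wd2 _] := weak_derivativeP H1u.
have wdE := weak_derivative_prim hab bg.
have bu := bmeas_prim a b bg; have bph := prim_bmeas ih.
have bp := p_bmeas coef; have bq := q_bmeas coef.
have mv : measurable_fun setT v by have := itg_meas (Lfun2_itg Xv.1.1).
have mwd := itg_meas (Lfun2_itg wd2).
have mh := itg_meas ih; have [mu _] := bu; have [mph _] := bph.
have [mp' _] := bp; have [mq' _] := bq; have [mg _] := bg; have [mw _] := bw.
rewrite /inner.
pose k t := lam * w t - q' t * prim a b g t.
have bk : bmeas k by rewrite /k; bm.
have bck := bmeas_coprim a b bk.
transitivity (integ a b (fun x => coprim a b k x * h x + q' x * prim a b g x * prim a b h x)).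
  apply: integ_ae.
  - apply: measurable_funD; first by apply: measurable_funM => //; exact: measurable_funM.
    by apply: measurable_funM => //; exact: measurable_funM.
  - apply: measurable_funD; first by apply: measurable_funM => //; case: bck.
    by apply: measurable_funM => //; exact: measurable_funM.
  - apply: filterS2 (filterI pE qE) (filterI wdE vE) => x [-> ->] [-> vx].
    by rewrite eqn -/h vx.
have i1 : itg a b (fun x => coprim a b k x * h x) by exact: itgM.
rewrite integD//; last by bm.
rewrite coprim_prim_dual// -integD; [|by bm..].
transitivity (integ a b (fun x => lam * (w x * prim a b h x))).
  by apply: integ_eq => x; rewrite /k; ring.
rewrite integZ; last by bm.
congr (_ * _); apply: integ_ae.
- exact: measurable_funM.
- exact: measurable_funM.
- by apply: filterS vE => x ->.
Qed.

End weak_solution_of_limit.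

(** * Energy levels *)

Section energy_estimates.
Context (R : realType) (a b : R) (hab : a < b).
Variables (p q : R -> R) (p0 P Q lam : R).
Hypothesis coef : coefficients p q p0 P Q.
Hypothesis lam0 : 0 <= lam.
Variables (f G : R -> R) (ell : R).
Hypothesis nl : nonlinearity f G ell.
Hypothesis G_nd : nondecreasing G.
Hypothesis G0 : G 0 = 0.
Implicit Types (g h k u : R -> R).
Local Notation integ := (integ a b).
Local Notation prim := (prim a b).
Local Notation Phi := (Phi a b p q).
Local Notation sqn := (sqn a b).
Local Notation energy := (energy a b p q lam G).
Let ba0 : 0 < b - a. Proof. by rewrite subr_gt0. Qed.
Let p0_gt0 := coef_p0_gt0 coef.
Let p_bound := coef_p_bound coef.
Let q_bound := coef_q_bound coef.

Ltac bm_leaf ::= first [exact: (p_bmeas coef) | exact: (q_bmeas coef) |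
  exact: (invp_bmeas coef) |
  lazymatch goal with
  | |- bmeas (fun x => f (@?u x)) => apply: (@nl_f_bmeas _ _ _ _ nl u); bm
  | |- bmeas (fun x => G (@?u x)) => apply: (@nl_G_bmeas _ _ _ _ nl u); bm
  end].

(** By [prim_sqr_le_Phi] the functions in the ball take values in [-c, c], where G <= gc. On the
    sphere this is the barrier; inside, it bounds Phi through the energy. *)
Lemma energy_barrier c gc g : bmeas g -> 0 <= c -> G c <= gc ->
  Phi g <= p0 * c ^+ 2 / (2 * (b - a)) -> Phi g - lam * (gc * (b - a)) <= energy g.
Proof.
move=> bg c0 Gc Phic; rewrite /energy_def lerD2l lerN2 ler_wpM2l//.
rewrite -integ_cst; last exact: ltW.
apply: integ_le; [by bm|by bm|] => x.
apply: le_trans Gc; apply: G_nd.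
apply: (le_trans (ler_norm _)).
rewrite -(ler_pXn2r (ltn0Sn 1)) ?nnegrE// real_normK ?num_real//.
apply: (le_trans (prim_sqr_le_Phi hab coef x bg)).
have h : 0 <= 2 * (b - a) / p0 by rewrite divr_ge0 ?mulr_ge0// ltW.
apply: (le_trans (ler_wpM2l h Phic)).
rewrite le_eqVlt; apply/orP; left; apply/eqP.
by field; rewrite !gt_eqF.
Qed.

(** Poincare's inequality turns the growth e t^2 into e (b-a)^2 [sqn g], and the smallness of e
    leaves half of the coercivity p0 / 2 of Phi. *)
Lemma energy_coercive e C g : bmeas g -> 0 <= e -> (forall t, G t <= e * t ^+ 2 + C) ->
  lam * (e * (b - a) ^+ 2) <= p0 / 4 ->
  p0 / 4 * sqn g - lam * (C * (b - a)) <= energy g.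
Proof.
move=> bg e0 GC small.
have h1 := Phi_ge a b coef bg.
have h2 : integ (fun x => G (prim g x)) <= e * sqn (prim g) + C * (b - a).
  rewrite -(integ_cst C (ltW hab)) -integZ; last by bm.
  rewrite -integD; [|by bm..].
  by apply: integ_le; [by bm|by bm|move=> x; exact: GC].
have h3 := sqn_prim_le hab bg.
have h4 : integ (fun x => G (prim g x)) <= e * ((b - a) ^+ 2 * sqn g) + C * (b - a).
  by apply: (le_trans h2); rewrite lerD2r ler_wpM2l.
have h5 := ler_wpM2l lam0 h4.
have h6 := ler_wpM2r (sqn_ge0 a b g) small.
rewrite /energy_def; move: h1 h5 h6.
move: (Phi g) (sqn g) (integ _) => A B D; lra.
Qed.

(** The bound involves the size [L] of [f] and not its Lipschitz constant, which is n for the n-th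
    regularization and would be useless in the limit. *)
Lemma energy_dist L S g h : bmeas g -> bmeas h ->
  (forall t, `|t| <= S -> 0 <= f t <= L) ->
  (forall x, `|prim g x| <= S) -> (forall x, `|prim h x| <= S) ->
  (forall s t, - S <= s -> s <= t -> t <= S -> G t - G s <= L * (t - s)) -> 0 <= L ->
  (integ (fun x => G (prim g x)) - integ (fun x => G (prim h x))) ^+ 2 <=
    (b - a) ^+ 2 * (L ^+ 2 * ((b - a) * sqn (fun x => g x - h x))).
Proof.
move=> bg bh fb gS hS GL L0.
have bd : bmeas (fun x => g x - h x) by bm.
set D := sqn _.
have D0 : 0 <= (b - a) * D by rewrite mulr_ge0 ?sqn_ge0// ltW.
pose e := Num.sqrt ((b - a) * D).
have e2 : e ^+ 2 = (b - a) * D by rewrite sqr_sqrtr.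
have pe x : `|prim g x - prim h x| <= e.
  rewrite -(ler_pXn2r (ltn0Sn 1)) ?nnegrE ?sqrtr_ge0// real_normK ?num_real// e2.
  by rewrite -primB; [exact: prim_sqr_le|bm|bm].
have Gd x : `|G (prim g x) - G (prim h x)| <= L * e.
  have W s t : - S <= s -> s <= t -> t <= S -> `|t - s| <= e -> `|G t - G s| <= L * e.
    move=> h1 h2 h3 h4; rewrite ger0_norm ?subr_ge0; last exact: G_nd.
    apply: (le_trans (GL s t h1 h2 h3)); rewrite ler_wpM2l//.
    by apply: le_trans h4; exact: ler_norm.
  have /andP[a1 a2] : - S <= prim h x <= S by rewrite -ler_norml.
  have /andP[a3 a4] : - S <= prim g x <= S by rewrite -ler_norml.
  have pex := pe x.
  case: (leP (prim h x) (prim g x)) => [hg|/ltW gh]; first by apply: W.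
  by rewrite distrC; apply: W => //; rewrite distrC.
rewrite -integB; [|by bm..].
set I := integ _.
have : `|I| <= L * e * (b - a).
  apply: (le_trans (integ_norm _)); first by bm.
  by apply: integ_norm_sup => //; bm.
move=> IL; rewrite -real_normK ?num_real//.
have : `|I| ^+ 2 <= (L * e * (b - a)) ^+ 2.
  by rewrite lerXn2r ?nnegrE// mulr_ge0 ?(ltW ba0)// mulr_ge0// sqrtr_ge0.
by move/le_trans; apply; rewrite !exprMn e2; move: ((b-a) * D) => X; lra.
Qed.

Section bump_profile.
Variable d : R.
Hypothesis d0 : 0 < d.

Definition slope : R := 2 * d / (b - a).
Definition mid : R := (a + b) / 2.
(* The derivative of the function that is affine on [a, mid] and equal to d on
   [mid, b]. *)
Definition profile x : R := slope * (x <= mid)%R%:R.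

Let a_mid : a < mid. Proof. by rewrite /mid; move: hab; lra. Qed.
Let mid_b : mid < b. Proof. by rewrite /mid; move: hab; lra. Qed.
Let slope0 : 0 < slope. Proof. by rewrite divr_gt0// mulr_gt0. Qed.

Lemma profile_bmeas : bmeas profile.
Proof. have bi := bmeas_le_indic mid; rewrite /profile; bm. Qed.

Lemma integ_le_indic z : a < z < b -> integ (fun t => (t <= z)%R%:R) = z - a.
Proof.
move=> /andP[az zb]; rewrite -(integ_indic_itv (lexx a) (ltW az) zb).
apply: integ_ae; [by case: (bmeas_le_indic z)|exact: measurable_indic|].
apply: filterS (ae_leb_itv a b) => t; rewrite in_itv/= => /andP[at_ _].
by rewrite indicE mem_setE/= in_itv/= at_.
Qed.

Lemma prim_profile x : a < x < b -> prim profile x = slope * (Num.min x mid - a).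
Proof.
move=> /andP[ax xb]; rewrite /prim_def.
rewrite -integ_le_indic; last first.
  by rewrite lt_min ax a_mid gt_min xb.
rewrite -integZ; last exact/bmeas_itg/bmeas_le_indic.
apply: integ_eq => t; rewrite /profile -mulrA le_min; congr (_ * _).
by case: (t <= x)%R; case: (t <= mid)%R; rewrite ?mulr1 ?mulr0.
Qed.

Lemma slope_half : slope * (mid - a) = d.
Proof. by rewrite /slope /mid; field; rewrite gt_eqF. Qed.

Lemma prim_profile_ge0 x : 0 <= prim profile x.
Proof.
apply: integ_ge0 => t; rewrite /profile.
by rewrite mulr_ge0 ?ler0n// mulr_ge0 ?ler0n// ltW.
Qed.

Lemma sqn_profile : sqn profile = slope ^+ 2 * ((b - a) / 2).
Proof.
have E : (b - a) / 2 = mid - a by rewrite /mid; field.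
rewrite E -(@integ_le_indic mid) ?a_mid//.
rewrite -integZ; last exact/bmeas_itg/bmeas_le_indic.
apply: integ_eq => t; rewrite /profile exprMn; congr (_ * _).
by case: (t <= mid)%R; rewrite ?expr1n ?expr0n.
Qed.

(** The affine half contributes d^2 (b-a) / 6 and the flat half d^2 (b-a) / 2. *)
Lemma sqn_prim_profile : sqn (prim profile) = 2 / 3 * d ^+ 2 * (b - a).
Proof.
pose k x : R := (slope * (Num.min x mid - a)) ^+ 2.
have cm : continuous (fun x : R => Num.min x mid).
  move=> x; have k1 : {for x, continuous (cst mid : R -> R^o)} by exact: cvg_cst.
  have k2 : {for x, continuous (id : R -> R^o)} by exact: cvg_id.
  by have := continuous_min k2 k1; exact.
have ck : continuous k.
  move=> x; rewrite /k; under eq_fun do rewrite expr2.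
  by apply: cvgM; apply: cvgMr; apply: cvgB; [exact: cm|exact: cvg_cst|exact: cm|exact: cvg_cst].
transitivity (integ k).
  have bp := bmeas_prim a b profile_bmeas.
  apply: integ_ae.
  - by case: (bmeasX 2 bp).
  - exact: continuous_measurable_fun.
  - apply: filterS (ae_leb_itv a b) => x; rewrite in_itv/= => xab.
    by rewrite prim_profile.
rewrite integ_itv_int// (itv_int_chasles ck (ltW a_mid) (ltW mid_b)).
have -> : itv_int k mid b = d ^+ 2 * (b - mid).
  have := @itv_int_bound _ k mid b (d ^+ 2) (d ^+ 2) ck (ltW mid_b).
  move=> H; apply/eqP; rewrite eq_le andbC; apply: H => t /andP[mt _].
  by rewrite /k min_r// slope_half lexx.
pose phi x : R := slope ^+ 2 / 3 * (x - a) ^+ 3.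
have dphi (x : R) : is_derive x (1 : R) phi (slope ^+ 2 * (x - a) ^+ 2).
  have D := is_deriveZ (slope ^+ 2 / 3) (is_deriveX 3 (is_deriveB (is_derive_id x 1) (is_derive_cst a x 1))).
  apply: is_derive_eq; rewrite /GRing.scale/= ?subr0.
  have -> : (id - cst a : R -> R) x = x - a by [].
  by field.
have dE : derive1 phi = (fun y => slope ^+ 2 * (y - a) ^+ 2).
  by apply: funext => y; rewrite derive1E; have D := dphi y; exact: derive_val.
have -> : itv_int k a mid = itv_int (derive1 phi) a mid.
  rewrite dE /itv_int; apply: eq_Rintegral => x; rewrite mem_setE/= in_itv/= => /andP[_ xm].
  by rewrite /k min_l// exprMn.
rewrite ftc_derivable ?(ltW a_mid)//.
- rewrite /phi subrr expr0n/= mulr0 subr0 /slope /mid; field.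
  by rewrite gt_eqF.
- rewrite dE => x; apply: cvgMr; under eq_fun do rewrite expr2.
  by apply: cvgM; apply: cvgB; (exact: cvg_id || exact: cvg_cst).
Qed.

(** P is weighted by 2 d^2 / (b-a) and Q by 2/3 d^2 (b-a). When P and Q are the sup norms the bound
    equals p0 d^2 / (4 K (b-a)), which explains K. *)
Lemma Phi_profile_le : Phi profile <=
  d ^+ 2 * (12 * P + 4 * (b - a) ^+ 2 * Q) / (12 * (b - a)).
Proof.
have bg := profile_bmeas.
have : Phi profile <= 2^-1 * (P * sqn profile + Q * sqn (prim profile)).
  rewrite -!integZ; [|by bm..].
  rewrite -integD; [|by bm..].
  rewrite -integZ; last by bm.
  apply: integ_le; [by bm..|] => x.
  have /andP[_ p2] := p_bound x; have /andP[_ q2] := q_bound x.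
  by rewrite ler_wpM2l// lerD// ler_wpM2r// sqr_ge0.
move/le_trans; apply; rewrite sqn_profile sqn_prim_profile /slope.
rewrite le_eqVlt; apply/orP; left; apply/eqP.
by field; rewrite gt_eqF.
Qed.

(** Together with c < d this places the profile outside the sphere Phi = r. *)
Lemma Phi_profile_ge : p0 * d ^+ 2 / (b - a) <= Phi profile.
Proof.
apply: le_trans (Phi_ge a b coef profile_bmeas); rewrite sqn_profile /slope.
rewrite le_eqVlt; apply/orP; left; apply/eqP.
by field; rewrite gt_eqF.
Qed.

(** On the right half the function equals d; on the left half G >= 0 is dropped. *)
Lemma profile_source : (b - a) / 2 * G d <= integ (fun x => G (prim profile x)).
Proof.
have bg := profile_bmeas.
have bl := lt_indic_bmeas mid.
have E : (b - a) / 2 = integ (fun x => (mid < x)%R%:R).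
  have := integ_le_indic (z := mid); rewrite a_mid mid_b => /(_ isT) I1.
  have -> : integ (fun x => (mid < x)%R%:R) = integ (fun=> 1) - integ (fun x => (x <= mid)%R%:R).
    rewrite -integB; [|exact/bmeas_itg/bmeas_cst|exact/bmeas_itg/bmeas_le_indic].
    by apply: integ_eq => x; rewrite ltNge; case: (x <= mid)%R; rewrite ?subrr ?subr0.
  by rewrite I1 integ_cst ?ltW// /mid; field.
rewrite E mulrC -integZ; last by bm.
have pos x : 0 <= G (prim profile x) by rewrite -G0; apply: G_nd; exact: prim_profile_ge0.
have : integ (fun x => G d * (mid < x)%R%:R) =
       integ (fun x => G (prim profile x) * (mid < x)%R%:R).
  apply: integ_ae.
  - by have [] : bmeas (fun x => G d * (mid < x)%R%:R) by bm.
  - by have [] : bmeas (fun x => G (prim profile x) * (mid < x)%R%:R) by bm.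
  - apply: filterS (ae_leb_itv a b) => x; rewrite in_itv/= => xab.
    case: (boolP (mid < x)) => mx; rewrite ?mulr0//.
    by rewrite prim_profile// min_r ?(ltW mx)// slope_half.
move=> ->; apply: integ_le; [by bm..|] => x.
by case: (mid < x); rewrite ?mulr1 ?mulr0.
Qed.

(** The bound is free of G, so it is a common energy level for all regularizations. *)
Lemma energy_profile_path th : 0 <= th <= 1 ->
  energy (fun x => th * profile x) <= Phi profile.
Proof.
move=> /andP[t0 t1]; have bg := profile_bmeas.
have pE x : prim (fun x => th * profile x) x = th * prim profile x by rewrite primZ//; bm.
have -> : Phi profile = Phi profile - lam * 0 by rewrite mulr0 subr0.
rewrite /energy_def lerB//; last first.
  rewrite ler_wpM2l//; apply: integ_ge0 => x; rewrite -G0; apply: G_nd.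
  by rewrite pE mulr_ge0// prim_profile_ge0.
apply: integ_le; [by bm..|] => x; rewrite pE ler_wpM2l//.
have th2 : th ^+ 2 <= 1 by rewrite expr_le1.
have /andP[p1 _] := p_bound x; have /andP[q1 _] := q_bound x.
have pp : 0 <= p x := le_trans (ltW p0_gt0) p1.
have le1 y : (th * y) ^+ 2 <= y ^+ 2 by rewrite exprMn ler_piMl// sqr_ge0.
by apply: lerD; apply: ler_wpM2l.
Qed.

End bump_profile.
End energy_estimates.

(** * Three almost critical points of one regularized energy *)

Section approximate_critical_points.
Context (R : realType) (a b : R) (hab : a < b).
Variables (p q : R -> R) (p0 P Q lam : R).
Hypothesis coef : coefficients p q p0 P Q.
Hypothesis lam0 : 0 <= lam.
Variables (f G : R -> R) (ell : R).
Hypothesis nl : nonlinearity f G ell.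
Hypothesis G_nd : nondecreasing G.
Hypothesis G0 : G 0 = 0.
Variables (c d gc Emin eps : R).
Local Notation Phi := (Phi a b p q).
Local Notation energy := (energy a b p q lam G).
Local Notation resnorm := (resnorm a b p q lam f).
Local Notation bump := (profile a b d).
Local Notation r := (p0 * c ^+ 2 / (2 * (b - a))).
Local Notation dl := (r - lam * (gc * (b - a))).
Hypothesis c0 : 0 <= c.
Hypothesis d0 : 0 < d.
Hypothesis Gc : G c <= gc.
Hypothesis dl0 : 0 < dl.
Hypothesis bounded_below : forall g, bmeas g -> Emin <= energy g.
Hypothesis bump_energy : energy bump < 0.
Hypothesis bump_Phi : r < Phi bump.
Hypothesis eps0 : 0 < eps.

Lemma Phi_zero : Phi (fun x => 0 * bump x) = 0.
Proof.
transitivity (integ a b (fun=> 0)); last by rewrite integ_cst ?mul0r// ltW.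
apply: integ_eq => x.
rewrite primZ; last exact/bmeas_itg/profile_bmeas.
by rewrite !mul0r expr0n !mulr0 addr0 mulr0.
Qed.

Lemma energy_zero : energy (fun x => 0 * bump x) = 0.
Proof.
rewrite /energy_def Phi_zero sub0r; apply/eqP; rewrite oppr_eq0; apply/eqP.
rewrite -[RHS](mulr0 lam); congr (_ * _).
transitivity (integ a b (fun=> 0)); last by rewrite integ_cst ?mul0r// ltW.
apply: integ_eq => x.
rewrite primZ; last exact/bmeas_itg/profile_bmeas.
by rewrite mul0r G0.
Qed.

(** Descent from 0, descent from the bump, and the mountain pass along the segment between them. Any
    two of the points are separated, in Phi or in energy, by a margin depending on dl alone, which
    strict inequalities would not give in the limit. *)
Lemma three_approximate_critical_points : exists g1 g2 g3,
  [/\ [/\ bmeas g1, resnorm g1 <= eps, energy g1 <= 0 & Phi g1 <= r - dl],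
      [/\ bmeas g2, resnorm g2 <= eps, energy g2 <= 0 & r < Phi g2] &
      [/\ bmeas g3, resnorm g3 <= eps, energy g3 <= Phi bump & dl / 2 <= energy g3]].
Proof.
have bb : bmeas bump := profile_bmeas a b d.
have bz : bmeas (fun x => 0 * bump x) by bm.
have barrier g : bmeas g -> Phi g = r -> dl <= energy g.
  by move=> bg Pg; have := energy_barrier hab coef lam0 nl G_nd bg c0 Gc; rewrite Pg; apply.
have K0 : 0 <= descent_cst a b Q lam ell / p0.
  rewrite divr_ge0 ?(ltW (coef_p0_gt0 coef))// mulr_ge0 ?sqr_ge0//.
  by rewrite addr_ge0 ?divr_ge0 ?(Q_ge0 coef)// mulr_ge0// (nl_ell nl).
have K1 : 0 < 2^-1 + descent_cst a b Q lam ell / p0 by rewrite ltr_pwDl.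
(* The largest step length allowed by [step_descent]. *)
pose tau := 2^-1 / (2^-1 + descent_cst a b Q lam ell / p0).
have tau0 : 0 < tau by rewrite divr_gt0.
have tau_small : tau * (2^-1 + descent_cst a b Q lam ell / p0) <= 2^-1.
  by rewrite divfK// gt_eqF.
have tau20 : 0 < tau / 2 by rewrite divr_gt0.
pose T := step a b p q lam f tau.
have ST g : bmeas g -> bmeas (T g) by exact: (step_bmeas a b lam coef nl).
have rho0 g := @resnorm_ge0 _ a b _ _ _ _ _ lam coef f g.
have dsc g := @step_tau_descent _ _ _ hab _ _ _ _ _ _ coef lam0 _ _ _ nl _ tau0 tau_small g.
have side g := @step_same_side _ _ _ hab _ _ _ _ _ _ coef lam0 _ _ _ nl _ tau0 tau_small _ _ barrier g.
have dl2 : dl / 2 < dl by move: dl0; lra.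
have gc0 : 0 <= gc by apply: le_trans Gc; rewrite -G0; exact: G_nd.
have r0 : 0 < r.
  by apply: (lt_le_trans dl0); rewrite gerBl mulr_ge0// mulr_ge0// subr_ge0; exact: ltW.
have approx g : bmeas g -> exists n, resnorm (iter n T g) <= eps.
  by move=> bg; exact: (descent_approx tau20 ST dsc bounded_below bg eps0).
have keep n g : bmeas g -> energy g < dl -> Phi g != r ->
    0 < (Phi g - r) * (Phi (iter n T g) - r).
  exact: (iter_same_side tau20 ST rho0 dsc side).
have above (x y : R) : r < x -> 0 < (x - r) * (y - r) -> r < y.
  by rewrite -[in X in X -> _]subr_gt0 => xr; rewrite (pmulr_rgt0 _ xr) subr_gt0.
have below (x y : R) : x < r -> 0 < (x - r) * (y - r) -> y < r.
  by rewrite -[in X in X -> _]subr_lt0 => xr; rewrite (nmulr_rgt0 _ xr) subr_lt0.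
have low n g : bmeas g -> energy (iter n T g) <= energy g.
  by move=> bg; exact: (iter_le tau20 ST rho0 dsc).
have bit n g : bmeas g -> bmeas (iter n T g) by exact: (iter_S ST).
have Pz := Phi_zero; have Ez := energy_zero.
have one : (fun x => 1 * bump x) = bump by apply/funext => x; rewrite mul1r.
have [g3 [bg3 res3 lo3 hi3]] : exists g, [/\ bmeas g, resnorm g <= eps, dl / 2 <= energy g &
    energy g <= Phi bump].
  apply: (mountain_pass tau20 ST rho0 dsc side barrier (c := fun th x => th * bump x) eps0 dl2).
  - by move=> th; bm.
  - by move=> th th01; exact: (energy_profile_path hab coef lam0 G_nd G0 d0 th01).
  - by move=> n; apply: (iter_crossing hab coef lam0 nl).
  - by rewrite Ez.
  - by rewrite one; exact: lt_trans dl0.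
  - by rewrite Pz.
  - by rewrite one.
have [g1 [bg1 res1 lo1 hi1]] : exists g, [/\ bmeas g, resnorm g <= eps,
    energy g <= 0 & Phi g < r].
  have [n res] := approx _ bz.
  exists (iter n T (fun x => 0 * bump x)).
  have bn := bit n _ bz; have En := low n _ bz; rewrite Ez in En.
  have E0 : energy (fun x => 0 * bump x) < dl by rewrite Ez.
  have P0 : Phi (fun x => 0 * bump x) < r by rewrite Pz.
  have Pn := below _ _ P0 (keep n _ bz E0 (negbT (lt_eqF P0))).
  exact: And4 bn res En Pn.
have [g2 [bg2 res2 lo2 hi2]] : exists g, [/\ bmeas g, resnorm g <= eps,
    energy g <= 0 & r < Phi g].
  have [n res] := approx _ bb.
  exists (iter n T bump).
  have bn := bit n _ bb; have En := le_trans (low n _ bb) (ltW bump_energy).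
  have Eb := lt_trans bump_energy dl0.
  have Pn := above _ _ bump_Phi (keep n _ bb Eb (negbT (gt_eqF bump_Phi))).
  exact: And4 bn res En Pn.
exists g1, g2, g3; split; split => //.
(* Inside the ball, energy at most 0 forces Phi <= lam gc (b-a) = r - dl, which improves Phi < r to
   a definite gap. *)
have h := le_trans (energy_barrier hab coef lam0 nl G_nd bg1 c0 Gc (ltW hi1)) lo1.
by rewrite subKr -subr_le0.
Qed.
End approximate_critical_points.

(** Young's inequality with exponents 1 / th and 1 / (1 - th) for the product of (e y)^th and
    e^(-th), which is y^th. *)
Lemma powR_sublinear (R : realType) (th e : R) : 0 < th < 1 -> 0 < e ->
  exists2 C, 0 <= C & forall y, 0 <= y -> y `^ th <= e * y + C.
Proof.
move=> /andP[th0 th1] e0.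
pose B := e `^ (- th).
have B0 : 0 <= B by exact: powR_ge0.
exists (B `^ (1 - th)^-1 / (1 - th)^-1).
  by rewrite divr_ge0 ?powR_ge0// invr_ge0 subr_ge0 ltW.
move=> y y0; have ey : 0 <= e * y by rewrite mulr_ge0// ltW.
have := @conjugate_powR R ((e * y) `^ th) B th^-1 (1 - th)^-1 (powR_ge0 _ _) B0.
rewrite !invrK invr_gt0 th0 invr_gt0 subr_gt0 th1 addrC subrK => /(_ isT isT erefl).
rewrite -powRrM divff ?gt_eqF// powRr1// /B powRN.
rewrite powRM ?(ltW e0)// mulrAC divff ?mul1r ?gt_eqF ?powR_gt0//.
move/le_trans; apply; rewrite lerD2r ler_piMr// ltW//.
Qed.

Lemma growth_sublinear (R : realType) (alpha s e : R) : 0 < alpha -> 1 < s -> s < 2 -> 0 < e ->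
  exists2 C, 0 <= C & forall t : R, alpha * (1 + `|t| `^ (s - 1)) <= e * `|t| + C.
Proof.
move=> a0 s1 s2 e0.
have [||C C0 H] := @powR_sublinear R (s - 1) (e / alpha).
- by rewrite subr_gt0 s1/= ltrBlDr.
- exact: divr_gt0.
exists (alpha * (1 + C)); first by rewrite mulr_ge0 ?(ltW a0)// addr_ge0.
move=> t; have -> : e * `|t| + alpha * (1 + C) = alpha * (1 + (e / alpha * `|t| + C)).
  by field; rewrite gt_eqF.
by rewrite ler_pM2l// lerD2l H.
Qed.

(** For t >= 0, (e t + C) t is below the claimed bound by a completed square; for t <= 0 the
    primitive is nonpositive. *)
Lemma primitive0_growth (R : realType) (f : R -> R) (e C t : R) : continuous f ->
  0 < e -> 0 <= C -> (forall t, 0 <= f t <= e * `|t| + C) ->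
  primitive0 f t <= 2 * e * t ^+ 2 + C ^+ 2 / (4 * e).
Proof.
move=> cf e0 C0 fb.
have sq : 2 * e * t ^+ 2 + C ^+ 2 / (4 * e) - (e * t + C) * t =
    (2 * e * t - C) ^+ 2 / (4 * e) by field; rewrite gt_eqF.
have f0 t' : 0 <= f t' by have /andP[] := fb t'.
have [t0|/ltW t0] := leP 0 t.
  apply: (@le_trans _ _ ((e * t + C) * t)).
    apply: primitive0_le => // t' /andP[h1 h2]; have /andP[-> h] := fb t'.
    by apply: (le_trans h); rewrite lerD2r ler_pM2l// ger0_norm.
  by rewrite -subr_ge0 sq divr_ge0 ?sqr_ge0// mulr_ge0// ltW.
apply: (@le_trans _ _ 0).
  by rewrite -(primitive0_at0 f); exact: primitive0_nd.
apply: addr_ge0; first by rewrite mulr_ge0 ?sqr_ge0// mulr_ge0// ltW.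
by rewrite divr_ge0 ?sqr_ge0// mulr_ge0// ltW.
Qed.

(** Both functions are weak derivatives of the same primitive. This reduces distinctness of
    solutions to distinctness of their derivatives. *)
Lemma prim_ae_inj (R : realType) (a b : R) (g h : R -> R) : a < b -> bmeas g -> bmeas h ->
  prim a b g = prim a b h %[ae (leb a b)] -> \forall x \ae leb a b, g x = h x.
Proof.
move=> hab bg bh gh.
have [mpg _] := bmeas_prim a b bg; have [mph _] := bmeas_prim a b bh.
apply: (weak_derivative_unique hab (u := prim a b g)) => //.
- by bm.
- by bm.
- by apply: prim_weak_derivative => //; bm.
move=> phi tphi; rewrite -(prim_weak_derivative hab _ tphi); last by bm.
have [[mphi _] [mphi' _]] := test_bmeas hab tphi.
apply: (@integ_ae _ a b (fun x => prim a b g x * derive1 phi x)).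
- exact: measurable_funM.
- exact: measurable_funM.
- by apply: filterS gh => x /= ->.
Qed.

(** * Passage to the limit *)

Section approximating_sequences.
Context (R : realType) (a b : R) (hab : a < b).
Variables (p q p' q' : R -> R) (p0 P Q lam : R).
Hypothesis p_meas : measurable_fun setT p.
Hypothesis q_meas : measurable_fun setT q.
Hypothesis coef : coefficients p' q' p0 P Q.
Hypothesis pE : \forall x \ae leb a b, p x = p' x.
Hypothesis qE : \forall x \ae leb a b, q x = q' x.
Hypothesis lam0 : 0 <= lam.
Variable F : R -> set R.
Context (U : set_system nat) (UU : UltraFilter U).
Hypothesis U_oo : forall N, \forall n \near U, (N <= n)%N.
Variables (f_ : nat -> R -> R) (ell_ : nat -> R).
Local Notation G_ n := (primitive0 (f_ n)).
Hypothesis ell_ge0 : forall n, 0 <= ell_ n.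
Hypothesis f_lipschitz : forall n x y, `|f_ n x - f_ n y| <= ell_ n * `|x - y|.
Hypothesis f_ge0 : forall n t, 0 <= f_ n t.
Hypothesis f_sublinear : forall e, 0 < e -> exists2 C, 0 <= C &
  forall n t, f_ n t <= e * `|t| + C.
Hypothesis separation : forall t v, ~ F t v -> exists al be,
  (v < al \/ be < v) /\ exists2 dl, 0 < dl & exists N, forall n, (N <= n)%N ->
    forall t', `|t' - t| < dl -> al <= f_ n t' <= be.
Variable E0 : R.
Local Notation Phi := (Phi a b p' q').
Local Notation sqn := (sqn a b).
Local Notation prim := (prim a b).
Local Notation energy n := (energy a b p' q' lam (G_ n)).
Local Notation resnorm n := (resnorm a b p' q' lam (f_ n)).

Let ba0 : 0 < b - a. Proof. by rewrite subr_gt0. Qed.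
Let p0_gt0 := coef_p0_gt0 coef.
Let cf n : continuous (f_ n).
Proof. exact: lipschitz_continuous (ell_ge0 n) (f_lipschitz n). Qed.
Let nl n : nonlinearity (f_ n) (G_ n) (ell_ n).
Proof. exact: primitive0_nonlinearity. Qed.
Let G_nd n : nondecreasing (G_ n).
Proof. exact: primitive0_nd. Qed.

Lemma uniform_coercive : exists C, forall n g, bmeas g ->
  p0 / 4 * sqn g - C <= energy n g.
Proof.
(* Tuned to the smallness condition of [energy_coercive] for the growth rate 2 e of G_n; lam + 1 in
   place of lam covers lam = 0. *)
pose e := p0 / 8 / ((lam + 1) * (b - a) ^+ 2).
have l1 : 0 < lam + 1 by rewrite ltr_wpDl.
have D0 : 0 < (lam + 1) * (b - a) ^+ 2 by rewrite mulr_gt0// exprn_gt0.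
have e0 : 0 < e by rewrite divr_gt0// divr_gt0.
have [C C0 fC] := f_sublinear e0.
exists (lam * (C ^+ 2 / (4 * e) * (b - a))) => n g bg.
apply: (energy_coercive hab coef lam0 (nl n) bg (e := 2 * e)).
- by rewrite mulr_ge0// ltW.
- by move=> t; apply: primitive0_growth => // t'; rewrite f_ge0 fC.
have -> : lam * (2 * e * (b - a) ^+ 2) = lam / (lam + 1) * (p0 / 4).
  by rewrite /e; field; rewrite !gt_eqF.
rewrite ler_piMl ?divr_ge0 ?(ltW p0_gt0)//.
by rewrite ler_pdivrMr// mul1r lerDl.
Qed.

Definition almost_critical n g :=
  [/\ bmeas g, resnorm n g <= n.+1%:R^-1 & energy n g <= E0].

Lemma almost_critical_bound : exists2 B, 0 <= B &
  forall n g, almost_critical n g -> sqn g <= B.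
Proof.
have [C HC] := uniform_coercive.
exists (`|4 / p0 * (E0 + C)|) => // n g [bg _ gE].
apply: le_trans (ler_norm _).
have := le_trans (HC n g bg) gE; rewrite lerBlDr => h.
have -> : sqn g = 4 / p0 * (p0 / 4 * sqn g) by field; rewrite gt_eqF.
by rewrite ler_wpM2l// divr_ge0// ltW.
Qed.

Lemma almost_critical_sup : exists S L, [/\ 0 <= S, 0 <= L,
  forall n g x, almost_critical n g -> `|prim g x| <= S &
  forall n t, `|t| <= S -> 0 <= f_ n t <= L].
Proof.
have [B B0 sB] := almost_critical_bound.
have [C C0 fC] := f_sublinear (ltr01 : 0 < 1 :> R).
have S0 : 0 <= 1 + (b - a) * B by rewrite addr_ge0// mulr_ge0// ltW.
(* 1 + y bounds the square root of y, here for y = (b-a) B. *)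
exists (1 + (b - a) * B), (1 + (b - a) * B + C); split => //.
- by rewrite addr_ge0.
- move=> n g x ng; have [bg _ _] := ng.
  have h := le_trans (prim_sqr_le hab x bg) (ler_wpM2l (ltW ba0) (sB n g ng)).
  rewrite -(ler_pXn2r (ltn0Sn 1)) ?nnegrE// real_normK ?num_real//.
  apply: (le_trans h); rewrite expr2; move: S0.
  have : 0 <= (b - a) * B by rewrite mulr_ge0// ltW.
  by move: ((b - a) * B) => y; nra.
- move=> n t tS; rewrite f_ge0/=; apply: (le_trans (fC n t)).
  by rewrite mul1r lerD2r.
Qed.

Lemma almost_critical_limit g_ : (forall n, almost_critical n (g_ n)) ->
  exists g, [/\ bmeas g, weak_solution a b p q F lam (prim g) &
    forall e, 0 < e -> \forall n \near U, sqn (fun x => g_ n x - g x) <= e].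
Proof.
move=> good; have [S [L [S0 L0 pS fL]]] := almost_critical_sup.
have bg n : bmeas (g_ n) by case: (good n).
have rc : resnorm n (g_ n) @[n --> U] --> (0 : R).
  apply/cvgrPdist_le => /= e e0.
  apply: filterS (U_oo (Num.truncn e^-1)) => n Nn.
  rewrite sub0r normrN ger0_norm ?(resnorm_ge0 _ _ _ coef)//.
  have [_ rn _] := good n; apply: (le_trans rn).
  rewrite invf_ple ?posrE//; apply/ltW/(lt_le_trans (truncnS_gt _)).
  by rewrite ler_nat.
have [g [w [bgl bw eqn incl gcv]]] := approximate_limit hab coef lam0 UU nl bg
  (fun n x => pS n (g_ n) x (good n)) fL rc separation U_oo.
exists g; split => //.
exact: (limit_weak_solution hab p_meas q_meas coef pE qE bgl bw eqn incl).
Qed.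

(** [Phi_close] and [energy_dist] apply with constants built from the common bounds B and L:
    although the energy changes with n, derivatives close in L^2 have close levels. *)
Lemma almost_critical_close g_ h_ :
  (forall n, almost_critical n (g_ n)) -> (forall n, almost_critical n (h_ n)) ->
  (forall e, 0 < e -> \forall n \near U, sqn (fun x => h_ n x - g_ n x) <= e) ->
  forall e, 0 < e -> \forall n \near U,
    `|Phi (h_ n) - Phi (g_ n)| <= e /\ `|energy n (h_ n) - energy n (g_ n)| <= e.
Proof.
move=> gg hh close e e0; have [B B0 sB] := almost_critical_bound.
have [S [L [S0 L0 pS fL]]] := almost_critical_sup.
pose Pc := Phi_cst a b P Q.
have Pc0 : 0 <= Pc by exact: (Phi_cst_ge0 hab coef).
(* [eta] controls the term in [sqn (g_ n)]; [K1] and [K2] then convert e / 2 into thresholds for the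
   distance of the two sequences, for Phi and for the source term. *)
pose eta := e / 2 / (Pc * B + 1).
have PB : 0 < Pc * B + 1 by rewrite ltr_wpDl// mulr_ge0.
have eta0 : 0 < eta by rewrite !divr_gt0.
pose K1 := Pc * (eta^-1 + 1) + 1.
have K10 : 0 < K1.
  by rewrite ltr_wpDl// mulr_ge0// addr_ge0// invr_ge0 ltW.
pose K2 := lam ^+ 2 * ((b - a) ^+ 2 * (L ^+ 2 * (b - a))) + 1.
have K20 : 0 < K2.
  rewrite ltr_wpDl// mulr_ge0 ?sqr_ge0// mulr_ge0 ?sqr_ge0//.
  by rewrite mulr_ge0 ?sqr_ge0// ltW.
have d1 : 0 < e / 2 / K1 by rewrite !divr_gt0.
have d2 : 0 < (e / 2) ^+ 2 / K2 by rewrite divr_gt0// exprn_gt0// divr_gt0.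
apply: filterS2 (close _ d1) (close _ d2) => n c1 c2.
have [bg _ _] := gg n; have [bh _ _] := hh n.
have D0 := sqn_ge0 a b (fun x => h_ n x - g_ n x).
have bd : bmeas (fun x => h_ n x - g_ n x) by bm.
have Ph : `|Phi (h_ n) - Phi (g_ n)| <= e / 2.
  have := Phi_close hab coef bg bd eta0.
  have -> : (fun x => g_ n x + (h_ n x - g_ n x)) = h_ n by apply/funext => x; ring.
  move/le_trans; apply.
  set D := sqn (fun x => _) in c1 D0 *.
  apply: (@le_trans _ _ (Pc / 2 * (eta * B + (eta^-1 + 1) * (e / 2 / K1)))).
    rewrite ler_wpM2l ?divr_ge0// lerD// ler_wpM2l ?sB ?(ltW eta0)//.
      exact: sB (gg n).
    by rewrite addr_ge0// invr_ge0 ltW.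
  have h1 : Pc * B * eta <= e / 2.
    rewrite /eta mulrCA ler_piMr ?divr_ge0 ?(ltW e0)//.
    by rewrite ler_pdivrMr// mul1r lerDl.
  have h2 : Pc * (eta^-1 + 1) * (e / 2 / K1) <= e / 2.
    rewrite mulrCA ler_piMr ?divr_ge0 ?(ltW e0)//.
    by rewrite ler_pdivrMr// mul1r lerDl.
  move: h1 h2; move: (eta^-1) (e / 2 / K1) => i X; nra.
split; first by apply: (le_trans Ph); rewrite ler_pdivrMr// ler_peMr ?(ltW e0)// ler1n.
set I1 := integ a b (fun x => G_ n (prim (h_ n) x)).
set I2 := integ a b (fun x => G_ n (prim (g_ n) x)).
have GL s t : - S <= s -> s <= t -> t <= S -> G_ n t - G_ n s <= L * (t - s).
  move=> h1 h2 h3; rewrite primitive0_sub//.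
  have fst t' : s <= t' <= t -> 0 <= f_ n t' <= L.
    move=> /andP[h4 h5]; apply: fL; rewrite ler_norml.
    by rewrite (le_trans h1 h4) (le_trans h5 h3).
  by have /andP[_] := itv_int_bound (@cf n) h2 fst.
have ID : (I1 - I2) ^+ 2 <=
    (b - a) ^+ 2 * (L ^+ 2 * ((b - a) * sqn (fun x => h_ n x - g_ n x))).
  exact: (energy_dist hab (nl n) (G_nd n) bh bg (fL n) (fun x => pS n _ x (hh n))
    (fun x => pS n _ x (gg n)) GL L0).
have lI : `|lam * (I1 - I2)| <= e / 2.
  rewrite -(ler_pXn2r (ltn0Sn 1)) ?nnegrE ?divr_ge0 ?(ltW e0)//.
  rewrite real_normK ?num_real// exprMn.
  apply: (le_trans (ler_wpM2l (sqr_ge0 lam) ID)).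
  move: c2; rewrite ler_pdivlMr//; apply: le_trans.
  set D := sqn _ in D0 *.
  have -> : D * K2 = lam ^+ 2 * ((b - a) ^+ 2 * (L ^+ 2 * ((b - a) * D))) + D.
    by rewrite /K2; ring.
  by rewrite lerDl.
have -> : energy n (h_ n) - energy n (g_ n) =
    (Phi (h_ n) - Phi (g_ n)) - lam * (I1 - I2).
  transitivity (Phi (h_ n) - lam * I1 - (Phi (g_ n) - lam * I2)) => //.
  by move: (Phi (h_ n)) (Phi (g_ n)) => u1 u2; ring.
apply: (le_trans (ler_normB _ _)).
rewrite [leRHS](splitr e); exact: lerD.
Qed.

(** Equal limits have equal derivatives, so the two sequences approach each other in L^2 and, by
    [almost_critical_close], a gap e in their levels cannot persist for all n. *)
Lemma almost_critical_distinct g_ h_ g h e :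
  (forall n, almost_critical n (g_ n)) -> (forall n, almost_critical n (h_ n)) ->
  bmeas g -> bmeas h ->
  (forall e, 0 < e -> \forall n \near U, sqn (fun x => g_ n x - g x) <= e) ->
  (forall e, 0 < e -> \forall n \near U, sqn (fun x => h_ n x - h x) <= e) ->
  0 < e ->
  (forall n, e < `|Phi (h_ n) - Phi (g_ n)| \/
             e < `|energy n (h_ n) - energy n (g_ n)|) ->
  ~ (prim g = prim h %[ae (leb a b)]).
Proof.
move=> gg hh bg bh gcv hcv e0 far gh.
have E := prim_ae_inj hab bg bh gh.
have close e' : 0 < e' -> \forall n \near U, sqn (fun x => h_ n x - g_ n x) <= e'.
  move=> e'0; have e4 : 0 < e' / 4 by rewrite divr_gt0.
  apply: filterS2 (gcv _ e4) (hcv _ e4) => n h1 h2.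
  have [bgn _ _] := gg n; have [bhn _ _] := hh n.
  have b1 : bmeas (fun x => (g_ n x - g x) ^+ 2) by bm.
  have b2 : bmeas (fun x => (g_ n x - h x) ^+ 2) by bm.
  have b3 : bmeas (fun x => (h_ n x - h x) ^+ 2) by bm.
  have {}h1 : sqn (fun x => g_ n x - h x) <= e' / 4.
    have <- // : sqn (fun x => g_ n x - g x) = sqn (fun x => g_ n x - h x).
    apply: integ_ae; [by case: b1|by case: b2|].
    by apply: filterS E => x ->.
  apply: (@le_trans _ _ (2 * sqn (fun x => h_ n x - h x) + 2 * sqn (fun x => g_ n x - h x))).
    rewrite -!integZ; [|by bm..].
    rewrite -integD; [|by bm..].
    apply: integ_le; [by bm..|] => x; rewrite -subr_ge0.
    have -> : 2 * (h_ n x - h x) ^+ 2 + 2 * (g_ n x - h x) ^+ 2 - (h_ n x - g_ n x) ^+ 2 =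
      (h_ n x + g_ n x - 2 * h x) ^+ 2 by ring.
    exact: sqr_ge0.
  by move: h1 h2; move: (sqn _) (sqn _) => u1 u2; lra.
have [n [c1 c2]] := filter_ex (almost_critical_close gg hh close e0).
by case: (far n); rewrite ltNge ?c1 ?c2.
Qed.

End approximating_sequences.

Lemma itv_int_le (R : realType) (f g : R -> R) M x y : continuous f ->
  measurable_fun setT g -> (forall t, x <= t <= y -> 0 <= f t <= g t /\ g t <= M) ->
  itv_int f x y <= itv_int g x y.
Proof.
move=> cf mg fg.
have mI := measurable_itv `[x, y] : measurable (`[x, y]%classic : set (measurableTypeR R)).
have cM : continuous (cst M : R -> R) by move=> z; exact: cvg_cst.
have iM := continuous_itv_integrable x y cM.
apply: le_Rintegral => //; first exact: continuous_itv_integrable.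
  apply: le_integrable iM => //; first exact/measurable_EFinP/measurable_funTS.
  move=> t; rewrite /= in_itv/= => /fg[/andP[h1 h2] h3].
  by rewrite lee_fin !ger0_norm ?(le_trans h1)// (le_trans _ h3)// (le_trans h1).
by move=> t; rewrite /= in_itv/= => /fg[/andP[_ h2] _].
Qed.

Lemma gap_norm (R : realType) (x y D : R) : 0 < D -> x + D / 2 <= y -> D / 4 < `|y - x|.
Proof. by move=> D0 xy; apply: lt_le_trans (ler_norm _); lra. Qed.

(** * Three weak solutions *)

Section solutions.
Context (R : realType) (a b : R) (hab : a < b).
Variables (p q p' q' : R -> R) (p0 P Q : R).
Hypothesis p_meas : measurable_fun setT p.
Hypothesis q_meas : measurable_fun setT q.
Hypothesis coef : coefficients p' q' p0 P Q.
Hypothesis pE : \forall x \ae leb a b, p x = p' x.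
Hypothesis qE : \forall x \ae leb a b, q x = q' x.
Variables (F : R -> set R) (c d lam : R).
Hypothesis F_usc : upper_semicontinuous F.
Hypothesis F_ne : forall t, F t !=set0.
Hypothesis F_compact : forall t, compact (F t).
Hypothesis F_convex : forall t, convex_set (F t : set R^o).
Hypothesis min_ge0 : forall t, 0 <= set_min (F t).
Hypothesis min_sublinear : forall e, 0 < e -> exists2 C, 0 <= C &
  forall t, set_min (F t) <= e * `|t| + C.
Hypothesis lam0 : 0 <= lam.
Hypothesis c0 : 0 < c.
Hypothesis cd : c < d.
Hypothesis lam_c : lam * int_min F c < p0 * c ^+ 2 / (2 * (b - a) ^+ 2).
Hypothesis lam_d :
  d ^+ 2 * (12 * P + 4 * (b - a) ^+ 2 * Q) / (6 * (b - a) ^+ 2) < lam * int_min F d.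
Let ba0 : 0 < b - a. Proof. by rewrite subr_gt0. Qed.
Let p0_gt0 := coef_p0_gt0 coef.
Let d0 : 0 < d := lt_trans c0 cd.
Local Notation Phi := (Phi a b p' q').
Local Notation G n := (primitive0 (yosida F n)).
Local Notation energy n := (energy a b p' q' lam (G n)).
Local Notation resnorm n := (resnorm a b p' q' lam (yosida F n)).
Local Notation r := (p0 * c ^+ 2 / (2 * (b - a))).
Local Notation dl := (r - lam * (int_min F c * (b - a))).
Local Notation bump := (profile a b d).

Let lip n x y : `|yosida F n x - yosida F n y| <= n%:R * `|x - y|.
Proof. exact: yosida_lipschitz. Qed.
Let cy n : continuous (yosida F n).
Proof. exact: lipschitz_continuous (ler0n R n) (lip n). Qed.
Let y0 n t : 0 <= yosida F n t.
Proof. exact: yosida_ge0. Qed.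
Let nl n : nonlinearity (yosida F n) (G n) n%:R.
Proof. exact: primitive0_nonlinearity (ler0n R n) (lip n). Qed.
Let G_nd n : nondecreasing (G n).
Proof. exact: primitive0_nd. Qed.
Let G_at0 n : G n 0 = 0 := primitive0_at0 _.
Let m_meas : measurable_fun setT (fun t => set_min (F t)).
Proof. exact: set_min_measurable. Qed.

Lemma yosida_primitive_le n : G n c <= int_min F c.
Proof.
have [C C0 HC] := min_sublinear (ltr01 : 0 < 1 :> R).
rewrite primitive0_pos ?(ltW c0)//.
apply: (itv_int_le (M := 1 * c + C)) => // t /andP[t0 tc].
rewrite y0 yosida_le//; split => //; apply: (le_trans (HC t)).
by rewrite lerD2r !mul1r ger0_norm.
Qed.

Lemma yosida_primitive_cvg : G n d @[n --> \oo] --> int_min F d.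
Proof.
have [C C0 HC] := min_sublinear (ltr01 : 0 < 1 :> R).
have E n : itv_int (yosida F n) 0 d = G n d by rewrite primitive0_pos// ltW.
under eq_fun do rewrite -E.
apply: (itv_int_cvg (M := 1 * d + C)) => //; first exact: ltW.
  move=> n t /andP[t0 td]; rewrite y0/=.
  apply: (@le_trans _ _ (set_min (F t))); first exact: yosida_le.
  apply: (le_trans (HC t)).
  by rewrite lerD2r !mul1r ger0_norm.
by move=> t; exact: yosida_cvg.
Qed.

Lemma barrier_gt0 : 0 < dl.
Proof.
rewrite subr_gt0.
have -> : r = p0 * c ^+ 2 / (2 * (b - a) ^+ 2) * (b - a) by field; rewrite gt_eqF.
by rewrite mulrA ltr_pM2r.
Qed.

Lemma bump_above : r < Phi bump.
Proof.
apply: lt_le_trans (Phi_profile_ge hab coef d).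
have -> : r = p0 * (c ^+ 2 / 2) / (b - a) by field; rewrite gt_eqF.
rewrite ltr_pM2r ?invr_gt0// ltr_pM2l//.
have : c ^+ 2 < d ^+ 2 by rewrite ltrXn2r// ?nnegrE ltW.
have : 0 < c ^+ 2 by rewrite exprn_gt0.
by move: (c ^+ 2) (d ^+ 2) => u v; lra.
Qed.

(** The envelopes approach min F from below, so the estimate at c holds for every n, but the one at
    d only for n large. *)
Lemma bump_energy_near : \forall n \near \oo, energy n bump < 0.
Proof.
have : d ^+ 2 * (12 * P + 4 * (b - a) ^+ 2 * Q) / (12 * (b - a)) <
    lam * ((b - a) / 2) * int_min F d.
  have -> : d ^+ 2 * (12 * P + 4 * (b - a) ^+ 2 * Q) / (12 * (b - a)) =
    (b - a) / 2 * (d ^+ 2 * (12 * P + 4 * (b - a) ^+ 2 * Q) / (6 * (b - a) ^+ 2)).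
    by field; rewrite gt_eqF.
  by rewrite -[ltRHS]mulrA [ltRHS]mulrCA ltr_pM2l ?divr_gt0.
have /cvgr_gt /[apply] : lam * ((b - a) / 2) * G n d @[n --> \oo] -->
  lam * ((b - a) / 2) * int_min F d by apply: cvgMr; exact: yosida_primitive_cvg.
apply: filterS => n hn.
have h1 := le_lt_trans (Phi_profile_le hab coef d) hn.
have h2 := ler_wpM2l lam0 (profile_source hab (nl n) (@G_nd n) (G_at0 n) d0).
rewrite mulrA in h2.
by rewrite /energy_def subr_lt0; exact: lt_le_trans h1 h2.
Qed.

Theorem three_weak_solutions : exists u1 u2 u3 : R -> R,
  [/\ weak_solution a b p q F lam u1, weak_solution a b p q F lam u2 &
      weak_solution a b p q F lam u3] /\
  [/\ ~ (u1 = u2 %[ae (leb a b)]), ~ (u1 = u3 %[ae (leb a b)]) &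
      ~ (u2 = u3 %[ae (leb a b)])].
Proof.
have [N0 _ HN0] := bump_energy_near.
(* The shift by N0 makes the energy of the bump negative at every index. *)
pose f_ n := yosida F (n + N0); pose ell_ n : R := (n + N0)%:R.
(* One ultrafilter serves the three sequences, so that they can be compared at the same n. *)
have [U [UU Uoo]] := ultraFilterLemma (T := nat) (F := \oo) _.
have U_oo N : \forall n \near U, (N <= n)%N by apply: Uoo; exists N.
have ell0 n : 0 <= ell_ n := ler0n R _.
have lip_ n := lip (n + N0).
have f0 n t : 0 <= f_ n t := y0 _ _.
have sub e : 0 < e -> exists2 C, 0 <= C & forall n t, f_ n t <= e * `|t| + C.
  move=> /min_sublinear[C C0 HC]; exists C => // n t.
  by apply: le_trans (HC t); exact: yosida_le.
have sep t v : ~ F t v -> exists al be, (v < al \/ be < v) /\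
    exists2 dl', 0 < dl' & exists N, forall n, (N <= n)%N ->
      forall t', `|t' - t| < dl' -> al <= f_ n t' <= be.
  move=> /(yosida_separation F_usc F_ne F_compact F_convex min_ge0).
  move=> [al [be [out [e e0 [N HN]]]]]; exists al, be; split => //.
  by exists e => //; exists N => n Nn; apply: HN; exact: (leq_trans Nn (leq_addr _ _)).
have [C HC] := uniform_coercive hab coef lam0 ell0 lip_ f0 sub.
pose good n g := almost_critical a b p' q' lam f_ (Phi bump) n g.
have Pb0 : 0 <= Phi bump.
  apply: ltW; apply: le_lt_trans bump_above.
  by rewrite divr_ge0 ?mulr_ge0 ?sqr_ge0// ltW.
have dl0 := barrier_gt0.
have trio n : exists g1 g2 g3,
    [/\ good n g1, good n g2, good n g3 &
    [/\ Phi g1 <= r - dl, r < Phi g2, energy (n + N0) g1 <= 0, energy (n + N0) g2 <= 0 &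
        dl / 2 <= energy (n + N0) g3]].
  have low g : bmeas g -> - C <= energy (n + N0) g.
    move=> bg; apply: le_trans (HC n g bg); rewrite lerDr mulr_ge0 ?sqn_ge0//.
    by rewrite divr_ge0// ltW.
  have be : energy (n + N0) bump < 0 by apply: HN0; exact: leq_addl.
  have e0 : 0 < n.+1%:R^-1 :> R by rewrite invr_gt0.
  have [g1 [g2 [g3 [[a1 a2 a3 a4] [b1 b2 b3 b4] [c1 c2 c3 c4]]]]] :=
    three_approximate_critical_points hab coef lam0 (nl (n + N0)) (@G_nd (n + N0))
      (G_at0 _) (ltW c0) d0 (yosida_primitive_le _) dl0 low be bump_above e0.
  exists g1, g2, g3.
  exact: And4 (And3 a1 a2 (le_trans a3 Pb0)) (And3 b1 b2 (le_trans b3 Pb0))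
    (And3 c1 c2 c3) (And5 a4 b4 a3 b3 c4).
have [g1 /choice[g2 /choice[g3 H]]] := choice trio.
have G1 n : good n (g1 n) by case: (H n).
have G2 n : good n (g2 n) by case: (H n).
have G3 n : good n (g3 n) by case: (H n).
have lim g_ := @almost_critical_limit R a b hab p q p' q' p0 P Q lam p_meas q_meas
  coef pE qE lam0 F U UU U_oo f_ ell_ ell0 lip_ f0 sub sep (Phi bump) g_.
have far g_ h_ g h := @almost_critical_distinct R a b hab p' q' p0 P Q lam
  coef lam0 U UU f_ ell_ ell0 lip_ f0 sub (Phi bump) g_ h_ g h (dl / 4).
have [u1 [bu1 s1 l1]] := lim g1 G1.
have [u2 [bu2 s2 l2]] := lim g2 G2.
have [u3 [bu3 s3 l3]] := lim g3 G3.
exists (prim a b u1), (prim a b u2), (prim a b u3); split => //.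
have d4 : 0 < dl / 4 by rewrite divr_gt0.
(* The first two solutions are told apart by Phi, with gap dl; the third by its energy, at least dl
   / 2 against at most 0. *)
split.
- apply: (far g1 g2 u1 u2 G1 G2 bu1 bu2 l1 l2 d4) => n; left.
  have [_ _ _ [h1 h2 _ _ _]] := H n.
  apply: (gap_norm dl0); rewrite (le_trans _ (ltW h2))// -lerBrDr.
  by apply: (le_trans h1); rewrite lerD2l lerN2 ger_pMr// invf_le1// ler1n.
- apply: (far g1 g3 u1 u3 G1 G3 bu1 bu3 l1 l3 d4) => n; right.
  have [_ _ _ [_ _ h1 _ h2]] := H n.
  by apply: (gap_norm dl0); apply: le_trans h2; rewrite gerDr.
- apply: (far g2 g3 u2 u3 G2 G3 bu2 bu3 l2 l3 d4) => n; right.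
  have [_ _ _ [_ _ _ h1 h2]] := H n.
  by apply: (gap_norm dl0); apply: le_trans h2; rewrite gerDr.
Qed.

End solutions.

Theorem theorem1p1 (R : realType) (a b : R) (p q : R -> R) (p0 : R)
    (F : R -> set R) (alpha s c d : R)
    (hab : a < b)
    (hp : p \in Lfun (leb a b) +oo%E)
    (hq : q \in Lfun (leb a b) +oo%E)
    (hp0 : ess_inf (leb a b) (EFin \o p) = p0%:E)
    (hp0_gt0 : 0 < p0)
    (hq_ge0 : (0 <= ess_inf (leb a b) (EFin \o q))%E)
    (hFusc : upper_semicontinuous F)
    (hFne : forall t, F t !=set0)
    (hFcompact : forall t, compact (F t))
    (hFconvex : forall t, convex_set (F t : set R^o))
    (halpha : 0 < alpha) (hs1 : 1 < s) (hs2 : s < 2)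
    (hc : 0 < c) (hcd : c < d)
    (hi : forall t, 0 <= set_min (F t) <= alpha * (1 + `|t| `^ (s - 1)))
    (hii : 1 / c ^+ 2 * int_min F c
             < K a b p0 p q / d ^+ 2 * int_min F d) :
  forall lambda : R, Lambda a b p0 p q F c d lambda ->
    exists u1 u2 u3 : R -> R,
      [/\ weak_solution a b p q F lambda u1,
          weak_solution a b p q F lambda u2 &
          weak_solution a b p q F lambda u3] /\
      [/\ ~ (u1 = u2 %[ae (leb a b)]),
          ~ (u1 = u3 %[ae (leb a b)]) &
          ~ (u2 = u3 %[ae (leb a b)])].
Proof.
move=> lam [lam_lo lam_hi].
have [p' [q' [coef pE qE]]] := clamped_coefficients hab hp hq hp0 hp0_gt0 hq_ge0.
have P0 := P_gt0 coef; have Q0 := Q_ge0 coef.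
set P := norm_oo a b p in coef P0; set Q := norm_oo a b q in coef Q0.
have m0 t : 0 <= set_min (F t) by have /andP[] := hi t.
have M0 x : 0 <= int_min F x by apply: Rintegral_ge0 => t _.
have d0 : 0 < d := lt_trans hc hcd.
have ba0 : 0 < b - a by rewrite subr_gt0.
pose D := 12 * P + 4 * (b - a) ^+ 2 * Q.
have D0 : 0 < D.
  by apply: ltr_pwDl; rewrite ?mulr_gt0// mulr_ge0// mulr_ge0// sqr_ge0.
have KE : K a b p0 p q = 3 * p0 / D by [].
(* The left side of (ii) is nonnegative, so its right side is positive. *)
have Md : 0 < int_min F d.
  rewrite lt_neqAle M0 andbT eq_sym; apply/negP => /eqP Md0.
  move: hii; rewrite Md0 mulr0 ltNge mulr_ge0//.
  by rewrite divr_ge0// sqr_ge0.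
have lo : p0 * d ^+ 2 / (2 * K a b p0 p q * (b - a) ^+ 2) < lam * int_min F d.
  by move: lam_lo; rewrite inver gt_eqF// -EFinM lte_fin ltr_pdivrMr.
have lam0 : 0 < lam.
  rewrite -(pmulr_lgt0 _ Md); apply: le_lt_trans lo.
  by apply/ltW; rewrite KE !(mulr_gt0, exprn_gt0, invr_gt0).
have hi_c : lam * int_min F c < p0 * c ^+ 2 / (2 * (b - a) ^+ 2).
  (* If the integral up to c is 0, the upper end of Lambda is +oo and the claim becomes positivity
     of the right side. *)
  move: lam_hi; rewrite inver; have [->|Mc] := eqVneq (int_min F c) 0.
    by move=> _; rewrite mulr0 divr_gt0 ?mulr_gt0 ?exprn_gt0.
  by rewrite -EFinM lte_fin ltr_pdivlMr// lt_neqAle eq_sym Mc M0.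
apply: (@three_weak_solutions R a b hab p q p' q' p0 P Q _ _ coef pE qE F c d lam) => //.
- by move: hp; rewrite inE => /andP[]; rewrite !inE.
- by move: hq; rewrite inE => /andP[]; rewrite !inE.
- move=> e e0; have [C C0 HC] := growth_sublinear halpha hs1 hs2 e0.
  by exists C => // t; have /andP[_ h] := hi t; exact: le_trans (HC t).
- exact: ltW.
(* With K = 3 p0 / D, the lower end of Lambda is the bound obtained from the profile. *)
apply: le_lt_trans lo; rewrite KE -/D le_eqVlt; apply/orP; left; apply/eqP.
by field; rewrite !gt_eqF.
Qed.
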